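(* Let $V\subset\mathbb{R}^3=\{(x,y,z)\}$ be an open, simply connected set, and let $w>0$ and $u$ be smooth real-valued functions on $V$ satisfying $$w_{xx}+w_{yy}+(we^u)_{zz}=0 .$$ Let $M=\mathbb{R}\times V$, and let $\omega$ be a 1-form on $M$, non-vanishing when restricted to the $\mathbb{R}$-factor, such that $$d\omega=w_x\,dy\wedge dz+w_y\,dz\wedge dx+(we^u)_z\,dx\wedge dy .$$ Let $g=e^uw(dx^2+dy^2)+w\,dz^2+w^{-1}\omega^2$ and let $J$ be the $g$-orthogonal almost complex structure with fundamental 2-form $\Omega_J=-dz\wedge\omega+e^uw\,dx\wedge dy$. Then $(g,J)$ is almost Kähler if and only if $(e^uw)_z=0$. It is Kähler if moreover $w$ does not depend on $x$ and $y$. Furthermore: (i) $(M,g,J)$ is non-Kähler and belongs to $\mathcal{AK}_3$ if and only if $w$ is a non-constant, positive harmonic function of $x$ and $y$ (in particular independent of $z$), and $u=u(x,y)$ is any (smooth) function of $x$ and $y$ only, both being regarded as functions on the domain $U\subset\mathbb{R}^2$ of the variables $(x,y)$. (ii) $(M,g,J)$ is non-Kähler and belongs to $\mathcal{AK}_2$ if and only if, in addition to the conditions in (i), $w$ has no critical points on $U$ and $u$ is given by $$u=\ln(w_x^2+w_y^2)-3\ln w+\mathrm{const}.$$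
   Context: The fundamental 2-form of an almost Hermitian structure $(g,J)$ is $\Omega(X,Y)=g(JX,Y)$. An almost Hermitian structure is almost Kähler if its fundamental form is closed, and Kähler if in addition $J$ is integrable. $\mathcal{AK}_3$ denotes the class of almost Kähler manifolds whose Riemannian curvature satisfies $R_{XYZW}=R_{JX\,JY\,JZ\,JW}$ for all $X,Y,Z,W$; $\mathcal{AK}_2$ denotes the class of almost Kähler manifolds whose Riemannian curvature satisfies $R_{XYZW}-R_{JX\,JY\,ZW}=R_{JX\,Y\,JZ\,W}+R_{JX\,Y\,Z\,JW}$ for all $X,Y,Z,W$ (so $\mathcal{AK}_2\subseteq\mathcal{AK}_3$, and both contain the Kähler manifolds). Subscripts on $u,w$ denote partial derivatives. $U$ denotes the projection of $V$ to the $(x,y)$-plane.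
   Formalization: In (i),(ii), for general V, ''function of x and y only'' means the z-derivative vanishes on V; u and w are regarded as functions on U only when the vertical fibres of V over U are connected, since otherwise (e.g. a helical staircase with w=10+θ, u=0) they may be multivalued on U. *)

(* Defs.v *)
From HB Require Import structures.
From mathcomp Require Import all_boot all_order all_algebra.
From mathcomp Require Import all_classical all_reals all_analysis.

Set Implicit Arguments.
Unset Strict Implicit.
Unset Printing Implicit Defensive.

Import Order.TTheory GRing.Theory Num.Theory.
Import numFieldNormedType.Exports.

Local Open Scope classical_set_scope.
Local Open Scope ring_scope.

(* Points and tangent vectors of R^n are both row vectors.  A tensor field on
   an open set is given by its components in the standard coordinates, so that
     - a covector a acts by X |-> \sum_i a_i X_i,
     - a bilinear form B acts by (X, Y) |-> X B Y^T,
     - an endomorphism J acts on the right, X |-> X J (row i of J is the image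
       of the i-th coordinate vector).
   Fields are total functions on R^n; only their values on the open set at hand
   are ever constrained or used. *)

Section Calculus.
Context {R : realType} {n : nat}.
Implicit Types (D : set 'rV[R]_n) (f : 'rV[R]_n -> R).

Definition partial (i : 'I_n) f (p : 'rV[R]_n) : R := 'D_(delta_mx 0 i) f p.

Fixpoint Ck (k : nat) D f : Prop :=
  {in D, continuous f} /\
  if k is k'.+1 then
    forall i, {in D, forall p, derivable f p (delta_mx 0 i)} /\
              Ck k' D (partial i f)
  else True.

Definition smooth D f : Prop := forall k, Ck k D f.

Definition smooth_vec D (X : 'rV[R]_n -> 'rV[R]_n) : Prop :=
  forall i, smooth D (fun p => X p 0 i).

Definition smooth_mx D (A : 'rV[R]_n -> 'M[R]_n) : Prop :=
  forall i j, smooth D (fun p => A p i j).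

(* No factor 1/2: (a /\ b)(X, Y) = a(X) b(Y) - a(Y) b(X), and likewise
   d a (X, Y) = X(a(Y)) - Y(a(X)) - a([X, Y]). *)
Definition wedge (a b : 'rV[R]_n) : 'M[R]_n :=
  \matrix_(i, j) (a 0 i * b 0 j - a 0 j * b 0 i).

Definition ext_d (a : 'rV[R]_n -> 'rV[R]_n) (p : 'rV[R]_n) : 'M[R]_n :=
  \matrix_(i, j) (partial i (fun q => a q 0 j) p
                  - partial j (fun q => a q 0 i) p).

Definition closed_2form D (B : 'rV[R]_n -> 'M[R]_n) : Prop :=
  {in D, forall p, forall i j k,
    partial i (fun q => B q j k) p + partial j (fun q => B q k i) p
    + partial k (fun q => B q i j) p = 0}.

Definition lie_bracket (X Y : 'rV[R]_n -> 'rV[R]_n) (p : 'rV[R]_n) :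
    'rV[R]_n :=
  \row_k \sum_i (X p 0 i * partial i (fun q => Y q 0 k) p
                 - Y p 0 i * partial i (fun q => X q 0 k) p).

End Calculus.

Section AlmostHermitian.
Context {R : realType} {n : nat}.
Implicit Types (M : set 'rV[R]_n) (g J : 'rV[R]_n -> 'M[R]_n).

Definition inner (A : 'M[R]_n) (X Y : 'rV[R]_n) : R := (X *m A *m Y^T) 0 0.

Definition riemannian M g : Prop :=
  smooth_mx M g /\
  {in M, forall p, (g p)^T = g p /\
    forall X : 'rV[R]_n, X != 0 -> 0 < inner (g p) X X}.

Definition almost_complex M J : Prop :=
  smooth_mx M J /\ {in M, forall p, J p *m J p = - 1%:M}.

Definition orthogonal_for M g J : Prop :=
  {in M, forall p, forall X Y : 'rV[R]_n,
    inner (g p) (X *m J p) (Y *m J p) = inner (g p) X Y}.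

Definition almost_hermitian M g J : Prop :=
  [/\ riemannian M g, almost_complex M J & orthogonal_for M g J].

(* Omega(X, Y) = g(JX, Y) *)
Definition fundamental_form g J (p : 'rV[R]_n) : 'M[R]_n := J p *m g p.

Definition almost_kahler M g J : Prop :=
  almost_hermitian M g J /\ closed_2form M (fundamental_form g J).

Definition nijenhuis J (X Y : 'rV[R]_n -> 'rV[R]_n) (p : 'rV[R]_n) :
    'rV[R]_n :=
  let JX q := X q *m J q in
  let JY q := Y q *m J q in
  lie_bracket JX JY p - lie_bracket JX Y p *m J p
  - lie_bracket X JY p *m J p - lie_bracket X Y p.

Definition integrable_acs M J : Prop :=
  forall X Y, smooth_vec M X -> smooth_vec M Y ->
    {in M, forall p, nijenhuis J X Y p = 0}.

Definition kahler M g J : Prop := almost_kahler M g J /\ integrable_acs M J.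

(* k-th component of nabla_{d_i} d_j for the Levi-Civita connection of g *)
Definition christoffel g (i j k : 'I_n) (p : 'rV[R]_n) : R :=
  2^-1 * \sum_l invmx (g p) k l *
    (partial i (fun q => g q j l) p + partial j (fun q => g q i l) p
     - partial l (fun q => g q i j) p).

(* l-th component of R(d_i, d_j) d_k
     = nabla_{d_i} nabla_{d_j} d_k - nabla_{d_j} nabla_{d_i} d_k *)
Definition curvature g (i j k l : 'I_n) (p : 'rV[R]_n) : R :=
  partial i (christoffel g j k l) p - partial j (christoffel g i k l) p
  + \sum_m (christoffel g i m l p * christoffel g j k m p
            - christoffel g j m l p * christoffel g i k m p).

(* R_{XYZW} = g(R(X, Y) Z, W) *)
Definition riemann g (p X Y Z W : 'rV[R]_n) : R :=
  \sum_i \sum_j \sum_k \sum_l \sum_m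
    X 0 i * Y 0 j * Z 0 k * W 0 l * (curvature g i j k m p * g p m l).

Definition AK3 M g J : Prop :=
  almost_kahler M g J /\
  {in M, forall p, forall X Y Z W : 'rV[R]_n,
    riemann g p X Y Z W
    = riemann g p (X *m J p) (Y *m J p) (Z *m J p) (W *m J p)}.

Definition AK2 M g J : Prop :=
  almost_kahler M g J /\
  {in M, forall p, forall X Y Z W : 'rV[R]_n,
    riemann g p X Y Z W - riemann g p (X *m J p) (Y *m J p) Z W
    = riemann g p (X *m J p) Y (Z *m J p) W
      + riemann g p (X *m J p) Y Z (W *m J p)}.

End AlmostHermitian.

Section SimplyConnected.
Context {R : realType} {T : topologicalType}.
Implicit Types V : set T.

Definition path_in V (c : R -> T) : Prop :=
  {within `[0, 1], continuous c} /\ (forall s, s \in `[0, 1] -> V (c s)).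

Definition path_connected V : Prop :=
  V !=set0 /\
  forall p q, V p -> V q -> exists c, [/\ path_in V c, c 0 = p & c 1 = q].

Definition null_homotopic V (c : R -> T) : Prop :=
  exists H : R * R -> T,
    [/\ {within `[0, 1] `*` `[0, 1], continuous H},
        forall s t, s \in `[0, 1] -> t \in `[0, 1] -> V (H (s, t)),
        forall s, s \in `[0, 1] -> H (s, 0) = c s /\ H (s, 1) = c 0
      & forall t, t \in `[0, 1] -> H (0, t) = c 0 /\ H (1, t) = c 0].

Definition simply_connected V : Prop :=
  path_connected V /\
  forall c, path_in V c -> c 0 = c 1 -> null_homotopic V c.

End SimplyConnected.
Arguments simply_connected R {T} V.

(* Coordinates (x, y, z) on R^3 and (x, y) on R^2; on R^4 = R x R^3 the
   coordinate of index 0 is that of the R-factor and x, y, z are shifted. *)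
Definition ix : 'I_3 := @Ordinal 3 0 isT.
Definition iy : 'I_3 := @Ordinal 3 1 isT.
Definition iz : 'I_3 := @Ordinal 3 2 isT.
Definition jx : 'I_2 := @Ordinal 2 0 isT.
Definition jy : 'I_2 := @Ordinal 2 1 isT.

Section Ansatz.
Context {R : realType}.
Implicit Types (V : set 'rV[R]_3) (u w : 'rV[R]_3 -> R)
  (omega : 'rV[R]_4 -> 'rV[R]_4).

Definition base (p : 'rV[R]_4) : 'rV[R]_3 := \row_(i < 3) p 0 (lift ord0 i).

Definition R_times V : set 'rV[R]_4 := [set p | V (base p)].

Definition dcoord (i : 'I_3) : 'rV[R]_4 := delta_mx 0 (lift ord0 i).

Definition dx := dcoord ix.
Definition dy := dcoord iy.
Definition dz := dcoord iz.

Definition sq (a : 'rV[R]_4) : 'M[R]_4 := a^T *m a.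

Definition euw u w (q : 'rV[R]_3) : R := expR (u q) * w q.

Definition curvature_form u w (q : 'rV[R]_3) : 'M[R]_4 :=
  partial ix w q *: wedge dy dz + partial iy w q *: wedge dz dx
  + partial iz (euw u w) q *: wedge dx dy.

Definition metric u w omega (p : 'rV[R]_4) : 'M[R]_4 :=
  euw u w (base p) *: (sq dx + sq dy) + w (base p) *: sq dz
  + (w (base p))^-1 *: sq (omega p).

Definition Omega_J u w omega (p : 'rV[R]_4) : 'M[R]_4 :=
  - wedge dz (omega p) + euw u w (base p) *: wedge dx dy.

Definition pr_xy (q : 'rV[R]_3) : 'rV[R]_2 :=
  \row_(i < 2) q 0 (widen_ord (isT : 2 <= 3)%N i).

Definition shadow V : set 'rV[R]_2 := pr_xy @` V.

Definition connected_fibres V : Prop :=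
  forall c : 'rV[R]_2, connected (V `&` pr_xy @^-1` [set c]).

Definition constant_on (T : Type) (A : set T) (f : T -> R) : Prop :=
  exists c, forall q, A q -> f q = c.

(* u and w are functions of (x, y) only, w being non-constant and harmonic.
   On an arbitrary domain V "function of (x, y)" means that the z-derivative
   vanishes; when the vertical fibres of V are disconnected such a function may
   be multivalued on the projection of V. *)
Definition harmonic_xy V u w : Prop :=
  [/\ {in V, forall q, partial iz u q = 0 /\ partial iz w q = 0},
      {in V, forall q,
        partial ix (partial ix w) q + partial iy (partial iy w) q = 0}
    & ~ constant_on V w].

Definition explicit_u V u w : Prop :=
  {in V, forall q, ~ (partial ix w q = 0 /\ partial iy w q = 0)} /\
  exists C, {in V, forall q,
    u q = ln (partial ix w q ^+ 2 + partial iy w q ^+ 2) - 3 * ln (w q) + C}.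

(* The same conditions for functions u0, w0 on the plane domain U = shadow V
   from which u and w are pulled back. *)
Definition descends V (f : 'rV[R]_3 -> R) (f0 : 'rV[R]_2 -> R) : Prop :=
  smooth (shadow V) f0 /\ {in V, forall q, f q = f0 (pr_xy q)}.

Definition harmonic_plane (U : set 'rV[R]_2) (w0 : 'rV[R]_2 -> R) : Prop :=
  [/\ {in U, forall c, 0 < w0 c},
      {in U, forall c,
        partial jx (partial jx w0) c + partial jy (partial jy w0) c = 0}
    & ~ constant_on U w0].

Definition explicit_u_plane (U : set 'rV[R]_2) (u0 w0 : 'rV[R]_2 -> R) :
    Prop :=
  {in U, forall c, ~ (partial jx w0 c = 0 /\ partial jy w0 c = 0)} /\
  exists C, {in U, forall c,
    u0 c = ln (partial jx w0 c ^+ 2 + partial jy w0 c ^+ 2)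
           - 3 * ln (w0 c) + C}.

End Ansatz.

(* Main.v *)
Require Import Defs.
From HB Require Import structures.
From mathcomp Require Import all_boot all_order all_algebra.
From mathcomp Require Import all_classical all_reals all_analysis.
From mathcomp Require Import ring lra.
Import Order.TTheory GRing.Theory Num.Theory.
Import numFieldNormedType.Exports.
Local Open Scope classical_set_scope.
Local Open Scope ring_scope.

(* In the frame dual to (omega / w, dx, dy, dz) the metric is diag (w, a, a, w)
   with a = e^u w, J is constant, and d omega makes all structure functions
   depend on the base point only. There d Omega = 2 a_z dx dy dz, and when
   a_z = 0 the curvature is an explicit quadratic form on 2-vectors: AK3 kills its
   entries R0103 and R0203, that is (grad w / w^2)_z = 0 for the gradient in x, y;
   AK2 moreover gives R0102 = 0 and R0101 = R0202, which are first order in u and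
   integrate to the constancy of |grad w|^2 e^(-u) w^(-3). The structure is
   integrable exactly where grad w = 0.
   Since w is harmonic in x, y, the AK3 condition forces w_z |grad w|^2 = 0 and
   grad w_z = 0. If w_z <> 0 somewhere then the holomorphic function w_x - i w_y
   vanishes on an open set, hence everywhere, and the structure is Kaehler. *)

Set Implicit Arguments.
Unset Strict Implicit.
Unset Printing Implicit Defensive.

(** * Directional derivatives and smooth functions *)

(** The coefficients of [omega] are unknown functions of all four coordinates and only its
    differential is prescribed, so the coordinate Christoffel symbols need not depend on the base
    point alone. In the moving frame only that differential enters. Dividing [omega] by w, rather
    than normalising to an orthonormal frame, makes J constant without square roots: connection
    coefficients stay quotients of first jets, and every curvature entry becomes a rational
    identity. When a_z = 0 the equation for w turns into harmonicity in x and y, which makes w_x - i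
    w_y holomorphic on horizontal slices. The AK3 condition is pointwise and only makes a product
    vanish; to select the same factor at all points takes a global argument. Vanishing is propagated
    on discs in slices of constant z by a weighted maximum principle, then over V by connectedness,
    as V need not be a product. The shape of V matters again at the end: a function with zero
    z-derivative comes from the plane once the vertical fibres are connected. *)

Section DirectionalDerivative.
Context {R : realType} {V : normedModType R}.
Implicit Types (f g : V -> R) (p v : V).

Lemma isd_cst p v (c : R) : is_derive p v (fun=> c) 0.
Proof. exact: is_derive_cst. Qed.

Lemma isd_add p v f g a b : is_derive p v f a -> is_derive p v g b ->
  is_derive p v (fun q => f q + g q) (a + b).
Proof. by move=> fa gb; exact: is_deriveD. Qed.

Lemma isd_opp p v f a : is_derive p v f a ->
  is_derive p v (fun q => - f q) (- a).
Proof. by move=> fa; exact: is_deriveN. Qed.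

Lemma isd_mul p v f g a b : is_derive p v f a -> is_derive p v g b ->
  is_derive p v (fun q => f q * g q) (a * g p + f p * b).
Proof.
move=> fa gb; have := is_deriveM fa gb; rewrite addrC => h.
by apply: (is_derive_eq h); rewrite /GRing.scale /= (mulrC (g p)).
Qed.

Lemma isd_inv p v f a : f p != 0 -> is_derive p v f a ->
  is_derive p v (fun q => (f q)^-1) (- a / f p ^+ 2).
Proof.
move=> f0 fa; split; first exact: derivableV.
have fd : derivable f p v by [].
rewrite (deriveV f0 fd) (@derive_val _ _ _ _ _ _ _ fa) /GRing.scale /=.
by rewrite !mulNr mulrC.
Qed.

Lemma isd_comp p v f (h : R -> R) a b :
  is_derive p v f a -> is_derive (f p) 1 h b ->
  is_derive p v (fun q => h (f q)) (b * a).
Proof.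
move=> fa hb.
(* A directional derivative is an ordinary derivative along the line through [p], so the chain rule
   in one variable applies. *)
have key (k : V -> R) : 'D_v k p = 'D_1 (fun t : R => k (t *: v + p)) 0.
  rewrite /derive; set k1 := (fun h => h^-1 *: _).
  set k2 := (fun h => h^-1 *: _); suff -> : k1 = k2 by [].
  apply/funext => t; rewrite /k1 /k2 /=.
  by rewrite addr0 scale0r add0r [_%:A]mulr1.
have fa' : is_derive (0 : R) 1 (fun t : R => f (t *: v + p)) a.
  by case: fa => fd fv; split; [exact/(derivable1P f p v)|rewrite -key].
have hb' : is_derive (f (0 *: v + p)) 1 h b by rewrite scale0r add0r.
have := is_derive1_comp hb' fa' => -[d1 d2].
by split; [exact/(derivable1P (fun q => h (f q)) p v)|rewrite key].
Qed.

Lemma isd_exp p v f a : is_derive p v f a ->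
  is_derive p v (fun q => expR (f q)) (expR (f p) * a).
Proof. by move=> fa; exact: (isd_comp fa (is_derive_expR _)). Qed.

Lemma isd_ln p v f a : 0 < f p -> is_derive p v f a ->
  is_derive p v (fun q => ln (f q)) ((f p)^-1 * a).
Proof. by move=> f0 fa; exact: (isd_comp fa (is_derive1_ln f0)). Qed.

Lemma isd_exprn p v f a n : is_derive p v f a ->
  is_derive p v (fun q => f q ^+ n.+1) (n.+1%:R * f p ^+ n * a).
Proof.
move=> fa; elim: n => [|n IHn]; first by rewrite expr0 !mul1r.
under eq_fun do rewrite exprS.
apply: (is_derive_eq (isd_mul fa IHn)); rewrite -[in RHS]natr1 (exprS _ n).
ring.
Qed.

Lemma isd_sum (I : Type) (r : seq I) p v (f : I -> V -> R) a :
  (forall i, is_derive p v (f i) (a i)) ->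
  is_derive p v (fun q => \sum_(i <- r) f i q) (\sum_(i <- r) a i).
Proof.
move=> fa; elim: r => [|i r IHr].
  by under eq_fun do rewrite big_nil; rewrite big_nil; exact: isd_cst.
under eq_fun do rewrite big_cons; rewrite big_cons; exact: isd_add.
Qed.

Lemma isd_near p v f g a : (\near p, f p = g p) -> is_derive p v f a ->
  is_derive p v g a.
Proof. exact: near_eq_is_derive. Qed.

End DirectionalDerivative.

Section Smooth.
Context {R : realType} {n : nat}.
Implicit Types (D : set 'rV[R]_n) (f g : 'rV[R]_n -> R) (i j : 'I_n).

Local Notation e_ := (delta_mx 0).

Lemma in_setP_iff (T : Type) (D : set T) (P : T -> Prop) :
  {in D, forall p, P p} <-> (forall p, D p -> P p).
Proof.
by split => h p Dp; apply: h; [rewrite inE|rewrite inE in Dp].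
Qed.

Lemma partial_val i f p a : is_derive p (e_ i) f a -> partial i f p = a.
Proof. by move=> fa; exact: derive_val. Qed.

Lemma eq_on_near D f g p : open D -> D p -> (forall q, D q -> f q = g q) ->
  \near p, f p = g p.
Proof. by move=> oD Dp fg; near=> q; apply: fg; near: q; exact: open_nbhs_nbhs.
Unshelve. all: by end_near. Qed.

Lemma partial_eq D i f g p : open D -> D p -> (forall q, D q -> f q = g q) ->
  partial i f p = partial i g p.
Proof. by move=> oD Dp fg; apply: near_eq_derive; exact: (eq_on_near oD). Qed.

Lemma continuous_eq_on D f g p : open D -> D p ->
  (forall q, D q -> f q = g q) -> f @ p --> f p -> g @ p --> g p.
Proof.
move=> oD Dp fg; rewrite -(fg _ Dp).
exact: (cvg_trans (near_eq_cvg (eq_on_near oD Dp fg))).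
Qed.

Lemma Ck_cont k D f p : Ck k D f -> D p -> f @ p --> f p.
Proof. by case: k => [|k] [cf _] Dp; apply: cf; rewrite inE. Qed.

Lemma Ck_isd k D f i p : Ck k.+1 D f -> D p ->
  is_derive p (e_ i) f (partial i f p).
Proof.
move=> [_ /(_ i)[fd _]] Dp; apply: DeriveDef => //.
by apply: fd; rewrite inE.
Qed.

Lemma Ck_partial k D f i : Ck k.+1 D f -> Ck k D (partial i f).
Proof. by case=> _ /(_ i)[]. Qed.

Lemma CkW k D f : Ck k.+1 D f -> Ck k D f.
Proof.
elim: k f => [|k IHk] f; first by case=> cf _; split.
move=> /[dup] fk [cf h]; split => // i; have [fd fp] := h i.
by split => //; exact: IHk.
Qed.

Lemma Ck_eq k D f g : open D -> (forall p, D p -> f p = g p) ->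
  Ck k D f -> Ck k D g.
Proof.
move=> oD; elim: k f g => [|k IHk] f g fg fk; split.
- by move=> p; rewrite inE => Dp; exact: continuous_eq_on fg (Ck_cont fk Dp).
- by [].
- by move=> p; rewrite inE => Dp; exact: continuous_eq_on fg (Ck_cont fk Dp).
- move=> i; split.
    move=> p; rewrite inE => Dp.
    by case: (isd_near (eq_on_near oD Dp fg) (Ck_isd i fk Dp)).
  apply: IHk (Ck_partial i fk) => p Dp; exact: partial_eq fg.
Qed.

(** On an open set regularity depends only on the values there, so it suffices to give derivatives
    by formulas valid on [D]; nothing is asked of [partial i f] elsewhere. *)
Lemma CkS k D f : open D -> {in D, continuous f} ->
  (forall i, exists2 df, forall p, D p -> is_derive p (e_ i) f (df p) &
             Ck k D df) ->
  Ck k.+1 D f.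
Proof.
move=> oD cf h; split => // i; have [df fd fk] := h i; split.
  by move=> p; rewrite inE => Dp; have := fd _ Dp; case.
by apply: Ck_eq fk => // p Dp; have := fd _ Dp; case.
Qed.

Lemma Ck_cst k D (c : R) : open D -> Ck k D (fun=> c).
Proof.
move=> oD; elim: k c => [|k IHk] c.
  by split=> // p _; exact: cst_continuous.
apply: CkS => //; first by move=> p _; exact: cst_continuous.
move=> i; exists (fun=> 0) => // p _; exact: isd_cst.
Qed.

Lemma Ck_add k D f g : open D -> Ck k D f -> Ck k D g ->
  Ck k D (fun q => f q + g q).
Proof.
move=> oD; elim: k f g => [|k IHk] f g fk gk.
all: have cfg : {in D, continuous (fun q => f q + g q)}
  by move=> p; rewrite inE => Dp; 
    exact: (cvgD (Ck_cont fk Dp) (Ck_cont gk Dp)).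
  by split.
apply: CkS => // i; exists (fun q => partial i f q + partial i g q).
  by move=> p Dp; apply: isd_add; apply: Ck_isd Dp; eassumption.
by apply: IHk; exact: Ck_partial.
Qed.

Lemma Ck_mul k D f g : open D -> Ck k D f -> Ck k D g ->
  Ck k D (fun q => f q * g q).
Proof.
move=> oD; elim: k f g => [|k IHk] f g fk gk.
all: have cfg : {in D, continuous (fun q => f q * g q)}
  by move=> p; rewrite inE => Dp; 
    exact: (cvgM (Ck_cont fk Dp) (Ck_cont gk Dp)).
  by split.
apply: CkS => // i; exists (fun q => partial i f q * g q + f q * partial i g q).
  by move=> p Dp; apply: isd_mul; apply: Ck_isd Dp; eassumption.
by apply: Ck_add => //; apply: IHk; do ?[exact: Ck_partial|exact: CkW].
Qed.

Lemma Ck_inv k D f : open D -> (forall p, D p -> f p != 0) -> Ck k D f ->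
  Ck k D (fun q => (f q)^-1).
Proof.
move=> oD f0; elim: k f f0 => [|k IHk] f f0 fk.
all: have cf : {in D, continuous (fun q => (f q)^-1)}
  by move=> p; rewrite inE => Dp; 
    exact: (cvgV (f0 _ Dp) (Ck_cont fk Dp)).
  by split.
apply: CkS => // i.
(* Two separate inverses instead of the inverse of a square, so that the induction hypothesis covers
   each factor. *)
exists (fun q => -1 * partial i f q * ((f q)^-1 * (f q)^-1)).
  move=> p Dp; have h := isd_inv (f0 _ Dp) (Ck_isd i fk Dp).
  by apply: (is_derive_eq h); rewrite mulN1r expr2 invfM.
apply: (Ck_mul oD).
  by apply: (Ck_mul oD); [exact: Ck_cst|exact: Ck_partial].
by apply: (Ck_mul oD); apply: IHk => //; exact: CkW.
Qed.

Lemma Ck_exp k D f : open D -> Ck k D f -> Ck k D (fun q => expR (f q)).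
Proof.
move=> oD; elim: k f => [|k IHk] f fk.
all: have cf : {in D, continuous (fun q => expR (f q))}
  by move=> p; rewrite inE => Dp; 
    exact: (continuous_comp (Ck_cont fk Dp) (@continuous_expR R (f p))).
  by split.
apply: CkS => // i; exists (fun q => expR (f q) * partial i f q).
  by move=> p Dp; apply: isd_exp; exact: Ck_isd fk Dp.
apply: (Ck_mul oD); last exact: Ck_partial.
by apply: IHk; exact: CkW.
Qed.

Lemma smooth_cont D f p : smooth D f -> D p -> f @ p --> f p.
Proof. by move=> /(_ 0%N); exact: Ck_cont. Qed.

Lemma smooth_isd D f i p : smooth D f -> D p ->
  is_derive p (e_ i) f (partial i f p).
Proof. by move=> /(_ 1%N); exact: Ck_isd. Qed.

Lemma smooth_partial D f i : smooth D f -> smooth D (partial i f).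
Proof. by move=> fs k; exact: Ck_partial (fs k.+1). Qed.

Lemma smooth_eq D f g : open D -> (forall p, D p -> f p = g p) ->
  smooth D f -> smooth D g.
Proof. by move=> oD fg fs k; exact: Ck_eq (fs k). Qed.

Lemma smooth_cst D (c : R) : open D -> smooth D (fun=> c).
Proof. by move=> oD k; exact: Ck_cst. Qed.

Lemma smooth_add D f g : open D -> smooth D f -> smooth D g ->
  smooth D (fun q => f q + g q).
Proof. by move=> oD fs gs k; exact: Ck_add. Qed.

Lemma smooth_mul D f g : open D -> smooth D f -> smooth D g ->
  smooth D (fun q => f q * g q).
Proof. by move=> oD fs gs k; exact: Ck_mul. Qed.

Lemma smooth_opp D f : open D -> smooth D f -> smooth D (fun q => - f q).
Proof.
move=> oD fs; apply: (@smooth_eq D (fun q => -1 * f q)) => //.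
  by move=> p _; rewrite mulN1r.
by apply: smooth_mul => //; exact: smooth_cst.
Qed.

Lemma smooth_inv D f : open D -> (forall p, D p -> f p != 0) -> smooth D f ->
  smooth D (fun q => (f q)^-1).
Proof. by move=> oD f0 fs k; exact: Ck_inv. Qed.

Lemma smooth_exp D f : open D -> smooth D f -> smooth D (fun q => expR (f q)).
Proof. by move=> oD fs k; exact: Ck_exp. Qed.

Lemma smooth_sum (I : Type) (r : seq I) D (f : I -> 'rV[R]_n -> R) :
  open D -> (forall k, smooth D (f k)) ->
  smooth D (fun q => \sum_(k <- r) f k q).
Proof.
move=> oD fs; elim: r => [|i r IHr].
  by under eq_fun do rewrite big_nil; exact: smooth_cst.
by under eq_fun do rewrite big_cons; apply: smooth_add.
Qed.

Lemma isd_coord i j p : is_derive p (e_ i) (fun q : 'rV[R]_n => q 0 j) ((j == i)%:R : R).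
Proof.
split; first by apply: diff_derivable; exact: differentiable_coord.
rewrite /derive; apply: lim_near_cst => //.
near=> h; rewrite /= !mxE eqxx /= addrK.
by rewrite /GRing.scale /= mulrA mulVf ?mul1r //; near: h; exact: nbhs_dnbhs_neq.
Unshelve. all: by end_near. Qed.

Lemma smooth_coord D i : open D -> smooth D (fun q => q 0 i).
Proof.
move=> oD; case=> [|k]; first by split=> // p _; exact: coord_continuous.
apply: CkS => //; first by move=> p _; exact: coord_continuous.
by move=> j; exists (fun=> (i == j)%:R); [move=> p _; exact: isd_coord|exact: Ck_cst].
Qed.

End Smooth.

(** * Mean value arguments on coordinate cubes *)

Section Cubes.
Context {R : realType} {n : nat}.
Implicit Types (D : set 'rV[R]_n) (f : 'rV[R]_n -> R) (i j : 'I_n).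
Implicit Types (p q : 'rV[R]_n) (r t : R).

Local Notation e_ := (delta_mx 0).

(** The ball of the sup norm, spelled out by coordinates so that points can be moved along one axis
    at a time. *)
Definition cube p r : set 'rV[R]_n := [set q | forall k, `|q 0 k - p 0 k| < r].

Lemma cube_center p r : 0 < r -> cube p r p.
Proof. by move=> r0 k; rewrite subrr normr0. Qed.

Lemma nbhs_cube p (A : set 'rV[R]_n) :
  nbhs p A <-> exists2 r, 0 < r & cube p r `<=` A.
Proof.
split.
  move=> /nbhs_ballP[r r0 rA]; exists r => // q qr; apply: rA.
  by split => // a b; rewrite ord1 /ball /= distrC; exact: qr.
move=> [r r0 rA]; apply/nbhs_ballP; exists r => // q [_ qr]; apply: rA => k.
by have := qr 0 k; rewrite /ball /= distrC.
Qed.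

Lemma open_cube D p : open D -> D p -> exists2 r, 0 < r & cube p r `<=` D.
Proof. by move=> oD Dp; apply/nbhs_cube; exact: open_nbhs_nbhs. Qed.

Lemma near_cube p (A : set 'rV[R]_n) : (\near p, A p) ->
  exists2 r, 0 < r & cube p r `<=` A.
Proof. by move/nbhs_cube. Qed.

Lemma cube_open p r : open (cube p r).
Proof.
rewrite openE => q qr; rewrite /interior /=; apply/nbhs_cube.
(* The least slack over all coordinates; the default 1 covers n = 0. *)
pose s := \big[Order.min/1]_k (r - `|q 0 k - p 0 k|).
have s0 : 0 < s.
  by apply: lt_bigmin => // k _; rewrite subr_gt0.
exists s => // x xs k.
have := ler_distD (q 0 k) (x 0 k) (p 0 k); have := xs k => h1 h2.
have : s <= r - `|q 0 k - p 0 k| by exact: bigmin_le_cond.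
move: h1 h2; lra.
Qed.

Lemma shiftE t i p k : (t *: e_ i + p : 'rV[R]_n) 0 k = t *+ (k == i) + p 0 k.
Proof. by rewrite !mxE eqxx /= mulr_natr. Qed.

Lemma shift_cube p r q i t c : 0 <= c <= 1 -> cube p r q ->
  cube p r (t *: e_ i + q) -> cube p r ((c * t) *: e_ i + q).
Proof.
move=> /andP[c0 c1] h1 h2 k; have := h1 k; have := h2 k.
rewrite !shiftE; case: eqP => _; rewrite ?mulr0n ?mulr1n ?add0r //.
move: c0; rewrite le_eqVlt => /predU1P[<-|c0]; first by rewrite mul0r add0r.
rewrite !ltr_norml => /andP[a1 a2] /andP[b1 b2].
have x1 : 0 < c * (r - (t + q 0 k - p 0 k)) by rewrite mulr_gt0 // subr_gt0.
have x2 : 0 < c * (r + (t + q 0 k - p 0 k)) by rewrite mulr_gt0 //; lra.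
have y1 : 0 <= (1 - c) * (r - (q 0 k - p 0 k)) by rewrite mulr_ge0 //; lra.
have y2 : 0 <= (1 - c) * (r + (q 0 k - p 0 k)) by rewrite mulr_ge0 //; lra.
by apply/andP; split; nra.
Qed.

Lemma isd_line p (v : 'rV[R]_n) f t a : is_derive (t *: v + p) v f a ->
  is_derive t 1 (fun s : R => f (s *: v + p)) a.
Proof.
move=> [fd fv]; have E : (fun h : R => h^-1 *: ((f \o shift (t *: v + p))
    (h *: v) - f (t *: v + p))) =
  (fun h : R => h^-1 *: (((fun s : R => f (s *: v + p)) \o shift t)
    (h *: 1) - f (t *: v + p))).
  by apply/funext => h /=; rewrite [h%:A]mulr1 scalerDl addrA.
by split; [rewrite /derivable -E|rewrite -fv /derive E].
Qed.

Lemma isd_shift p (v c : 'rV[R]_n) f a : is_derive (c + p) v f a ->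
  is_derive p v (fun q => f (c + q)) a.
Proof.
move=> [fd fv]; have E : (fun h : R => h^-1 *: ((f \o shift (c + p))
    (h *: v) - f (c + p))) =
  (fun h : R => h^-1 *: (((fun q => f (c + q)) \o shift p)
    (h *: v) - f (c + p))).
  by apply/funext => h /=; rewrite addrCA.
by split; [rewrite /derivable -E|rewrite -fv /derive E].
Qed.

(** The strict bounds on c matter in the second derivative test, where the sign of the intermediate
    increment is used. *)
Lemma axis_MVT_oo f (df : 'rV[R]_n -> R) p i t :
  (forall c : R, 0 <= c <= 1 ->
     is_derive ((c * t) *: e_ i + p) (e_ i) f (df ((c * t) *: e_ i + p))) ->
  exists2 c, 0 < c < 1 &
    f (t *: e_ i + p) - f p = df ((c * t) *: e_ i + p) * t.
Proof.
move=> fd.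
pose g (s : R) := f ((s * t) *: e_ i + p).
have gd (s : R) : 0 <= s <= 1 -> is_derive s 1 g (df ((s * t) *: e_ i + p) * t).
  move=> s01; rewrite /g.
  have h : is_derive s (1 : R) (fun x : R => x * t) t.
    apply: (is_derive_eq (isd_mul (is_derive_id _ _) (isd_cst _ _ _))).
    by rewrite mulr0 addr0 mul1r.
  exact: (isd_comp h (isd_line (fd _ s01))).
have gd' (x : R) : x \in `]0, 1[ ->
    is_derive x 1 g (df ((x * t) *: e_ i + p) * t).
  by rewrite in_itv /= => /andP[/ltW x0 /ltW x1]; apply: gd; rewrite x0.
have [|c c01] := MVT ltr01 gd'.
  apply: continuous_in_subspaceT => x; rewrite inE /= in_itv /= => x01.
  have [+ _] := gd _ x01.
  by move=> /derivable1_diffP /differentiable_continuous.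
rewrite /g mul1r mul0r scale0r add0r subr0 mulr1 => E.
by exists c; rewrite // -in_itv.
Qed.

Lemma axis_MVT f (df : 'rV[R]_n -> R) p i t :
  (forall c : R, 0 <= c <= 1 ->
     is_derive ((c * t) *: e_ i + p) (e_ i) f (df ((c * t) *: e_ i + p))) ->
  exists2 c, 0 <= c <= 1 &
    f (t *: e_ i + p) - f p = df ((c * t) *: e_ i + p) * t.
Proof.
by move=> /axis_MVT_oo[c /andP[/ltW c0 /ltW c1] E]; exists c; rewrite ?c0.
Qed.

(** Were the second derivative positive at [p], it would be so nearby; two mean value steps write f
    (t e_i + p) - f p as a product of positive factors, against maximality. *)
Lemma max_second_derivative D f i p r : open D -> smooth D f -> 0 < r ->
  (forall t, `|t| < r -> D (t *: e_ i + p) /\ f (t *: e_ i + p) <= f p) ->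
  partial i f p = 0 /\ partial i (partial i f) p <= 0.
Proof.
move=> oD fs r0 fmax.
have Dp : D p by have [] := fmax 0; rewrite ?normr0 // scale0r add0r.
have line g t : smooth D g -> `|t| < r ->
    is_derive t 1 (fun s : R => g (s *: e_ i + p)) (partial i g (t *: e_ i + p)).
  by move=> gs tr; apply: isd_line; apply: (smooth_isd i gs); case: (fmax t).
have d0 : partial i f p = 0.
  have rr : - r <= r by move: r0; clear; lra.
  have [|||_ E] := @derive1_at_max R (fun s : R => f (s *: e_ i + p)) (- r) r 0 rr.
  - by move=> t; rewrite in_itv /= -ltr_norml => tr; case: (line f t fs tr).
  - by rewrite in_itv /= oppr_lt0 r0.
  - move=> t; rewrite in_itv /= -ltr_norml scale0r add0r => tr.
    by case: (fmax t tr).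
  have := line f 0 fs; rewrite normr0 => /(_ r0)[_].
  by rewrite E scale0r add0r.
split=> //; rewrite leNgt; apply/negP => pos.
have := smooth_cont (smooth_partial i (smooth_partial i fs)) Dp.
move=> /cvgr_gt /(_ _ pos) /near_cube[r1 r10 r1P].
pose t := Order.min r r1 / 2.
have m0 : 0 < Order.min r r1 by rewrite lt_min r0.
have mr : Order.min r r1 <= r by rewrite ge_min lexx.
have mr1 : Order.min r r1 <= r1 by rewrite ge_min lexx orbT.
have t0 : 0 < t by rewrite divr_gt0.
have tr (c : R) : 0 <= c <= 1 -> `|c * t| < r /\ `|c * t| < r1.
  move=> /andP[c0 c1]; have ct : c * t <= t by rewrite ler_piMl // ltW.
  rewrite ger0_norm ?mulr_ge0 //; last exact: ltW.
  by move: ct m0 mr mr1; rewrite /t; clear; lra.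
have [|c /andP[c0 c1] E1] := @axis_MVT_oo f (partial i f) p i t.
  by move=> c /tr[cr _]; apply: (smooth_isd i fs); case: (fmax (c * t)).
have c01 : 0 <= c <= 1 by rewrite !ltW.
have [|d /andP[d0' d1] E2] := @axis_MVT_oo (partial i f) (partial i (partial i f))
    p i (c * t).
  move=> d d01; apply: (smooth_isd i (smooth_partial i fs)).
  have [+ _] := tr c c01; move=> ctr; apply: (fmax _ _).1.
  move: d01 => /andP[d0' d1]; rewrite normrM (ger0_norm d0').
  by apply: le_lt_trans ctr; rewrite ler_piMl.
have pos2 : 0 < partial i (partial i f) ((d * (c * t)) *: e_ i + p).
  apply: r1P => k; rewrite shiftE addrK.
  have [_ ctr] := tr c c01.
  case: eqP => _; last by rewrite mulr0n normr0.
  rewrite mulr1n normrM (gtr0_norm d0'); apply: le_lt_trans ctr.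
  by rewrite ler_piMl // ltW.
have t1 : `|t| < r by have := (tr 1); rewrite ler01 lexx mul1r => /(_ isT)[].
have [_] := fmax t t1.
rewrite -subr_le0 E1 leNgt => /negP; apply; move: E2; rewrite d0 subr0 => ->.
by rewrite !mulr_gt0.
Qed.

(** The second difference over a square of side h is symmetric in the two directions and equals h^2
    times either mixed derivative at some point of the cube; continuity makes both close to their
    values at [p]. *)
Lemma schwarz D f i j p : open D -> smooth D f -> D p ->
  partial i (partial j f) p = partial j (partial i f) p.
Proof.
move=> oD fs Dp.
apply/eqP; apply/negPn/negP => neq.
pose eps := `|partial i (partial j f) p - partial j (partial i f) p| / 2.
have eps0 : 0 < eps by rewrite divr_gt0 // normr_gt0 subr_eq0.
have cont a b : exists2 r, 0 < r & forall q, cube p r q ->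
    D q /\ `|partial a (partial b f) q - partial a (partial b f) p| < eps.
  have [r0 r0p r0D] := open_cube oD Dp.
  have := smooth_cont (smooth_partial a (smooth_partial b fs)) Dp.
  move=> /cvgr_dist_lt /(_ _ eps0) /near_cube[r1 r1p r1E].
  exists (Order.min r0 r1); first by rewrite lt_min r0p.
  move=> q qr; split.
    by apply: r0D => k; have := qr k; rewrite lt_min => /andP[].
  rewrite distrC; apply: r1E => k.
  by have := qr k; rewrite lt_min => /andP[].
have [r1 r1p h1] := cont i j; have [r2 r2p h2] := cont j i.
(* A third leaves room for both increments to fall on the same axis, which happens when i = j. *)
pose r := Order.min r1 r2; pose h := r / 3.
have rp : 0 < r by rewrite lt_min r1p.
have hp : 0 < h by rewrite divr_gt0.
have hr : r = 3 * h by rewrite mulrC divfK.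
have incube a b (c d : R) : 0 <= c <= 1 -> 0 <= d <= 1 ->
    cube p r ((c * h) *: e_ a + ((d * h) *: e_ b + p)).
  move=> /andP[c0 c1] /andP[d0 d1] k; rewrite !shiftE addrA addrK hr.
  have bnd (x : R) (e : bool) : 0 <= x -> x <= 1 -> 0 <= (x * h) *+ e <= h.
    move=> x0 x1; have h0 := ltW hp.
    case: e; last by rewrite mulr0n lexx.
    by rewrite mulr1n mulr_ge0 //= ler_piMl.
  have := bnd _ (k == a) c0 c1; have := bnd _ (k == b) d0 d1.
  move: (c * h *+ (k == a)) (d * h *+ (k == b)) => x y.
  move=> /andP[x1 x2] /andP[y1 y2]; rewrite ger0_norm; last exact: addr_ge0.
  by clear - x2 y2 hp; lra.
have cubeD q : cube p r q -> D q.
  move=> qr; apply: (h1 _ _).1 => k.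
  by have := qr k; rewrite lt_min => /andP[].
have o01 : 0 <= (1 : R) <= 1 by rewrite ler01 lexx.
have z01 : 0 <= (0 : R) <= 1 by rewrite ler01 lexx.
have main a b : exists2 q, cube p r q &
   f (h *: e_ a + (h *: e_ b + p)) - f (h *: e_ b + p) - f (h *: e_ a + p) + f p
     = partial a (partial b f) q * h * h.
  have [|c c01] := @axis_MVT (fun q => f (h *: e_ a + q) - f q)
    (fun q => partial b f (h *: e_ a + q) - partial b f q) p b h.
    move=> c c01; apply: isd_add.
      apply: isd_shift; apply: (smooth_isd b fs); apply: cubeD.
      by rewrite -{1}[h]mul1r; exact: incube.
    apply: isd_opp; apply: (smooth_isd b fs); apply: cubeD.
    by have := incube a b 0 c z01 c01; rewrite mul0r scale0r add0r.
  have [|d d01] := @axis_MVT (partial b f) (partial a (partial b f))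
    ((c * h) *: e_ b + p) a h.
    move=> d d01; apply: (smooth_isd a (smooth_partial b fs)).
    by apply: cubeD; exact: incube.
  move=> -> E; exists ((d * h) *: e_ a + ((c * h) *: e_ b + p)).
    exact: incube.
  by rewrite -E; ring.
have [q1 q1r E1] := main i j; have [q2 q2r E2] := main j i.
have E : partial i (partial j f) q1 = partial j (partial i f) q2.
  apply: (mulIf (lt0r_neq0 hp)); apply: (mulIf (lt0r_neq0 hp)).
  apply: (etrans (esym E1)); apply: (etrans _ E2).
  have -> : f (h *: e_ i + (h *: e_ j + p)) = f (h *: e_ j + (h *: e_ i + p)).
    by congr f; exact: addrCA.
  by congr (_ + _); exact: addrAC.
have := (h1 q1 _).2; have := (h2 q2 _).2; rewrite E.
move=> /(_ _)/[swap] /(_ _).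
have c1 : cube p r1 q1 by move=> k; have := q1r k; rewrite lt_min => /andP[].
have c2 : cube p r2 q2 by move=> k; have := q2r k; rewrite lt_min => /andP[].
move=> /(_ c1) l1 /(_ c2) l2; move: l1 l2; rewrite /eps.
move: (partial i (partial j f) p) (partial j (partial i f) p)
  (partial j (partial i f) q2) => y z x; rewrite (distrC x) => l1 l2.
by have := ler_distD x y z; move: l1 l2; clear; lra.
Qed.

Lemma const_axis D f i p r q t : smooth D f -> cube p r `<=` D ->
  (forall x, cube p r x -> partial i f x = 0) ->
  cube p r q -> cube p r (t *: e_ i + q) -> f (t *: e_ i + q) = f q.
Proof.
move=> fs rD f0 qr tqr.
have [|c c01] := @axis_MVT f (partial i f) q i t.
  by move=> c c01; apply: (smooth_isd i fs); apply: rD; exact: shift_cube.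
rewrite f0 ?mul0r; last exact: shift_cube.
by move/eqP; rewrite subr_eq0 => /eqP.
Qed.

Lemma const_cube D f p r q : smooth D f -> cube p r `<=` D -> 0 < r ->
  (forall i x, cube p r x -> partial i f x = 0) -> cube p r q -> f q = f p.
Proof.
move=> fs rD r0 f0 qr.
(* A staircase from [p] to [q] inside the cube: [m k] has already taken its first k coordinates from
   [q]. *)
pose m k : 'rV[R]_n := \row_j (if (j < k)%N then q 0 j else p 0 j).
have mr k : cube p r (m k).
  by move=> j; rewrite mxE; case: ifP => _; [exact: qr|rewrite subrr normr0].
have step (k : 'I_n) : f (m k.+1) = f (m k).
  have E : m k.+1 = (q 0 k - p 0 k) *: e_ k + m k.
    apply/rowP => j; rewrite shiftE !mxE ltnS leq_eqVlt.
    have [->|jk] := eqVneq j k; first by rewrite eqxx ltnn mulr1n subrK.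
    by rewrite -val_eqE in jk; rewrite (negbTE jk) mulr0n add0r.
  rewrite E; apply: (const_axis fs rD (f0 k)) => //.
  by rewrite -E.
have m0 : m 0%N = p by apply/rowP => j; rewrite mxE.
have mn : m n = q by apply/rowP => j; rewrite mxE ltn_ord.
suff H k : (k <= n)%N -> f (m k) = f (m 0%N) by rewrite -mn H // m0.
elim: k => // k IHk kn; rewrite -IHk; last exact: ltnW.
exact: (step (Ordinal kn)).
Qed.

End Cubes.

(** * Propagation of properties along connected sets *)

(** The local alternative makes [A] both relatively open and relatively closed in [V]. *)
Lemma connected_ind (T : topologicalType) (V A : set T) :
  connected V -> (exists2 p, V p & A p) ->
  (forall p, V p -> nbhs p [set q | V q -> A q] \/ nbhs p [set q | V q -> ~ A q])
  -> forall p, V p -> A p.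
Proof.
move=> cV [p0 Vp0 Ap0] loc.
suff E : V `&` A = V by move=> p; rewrite -{1}E => -[].
apply: cV; first by exists p0.
- exists ([set q | V q -> A q])°; first exact: open_interior.
  apply/seteqP; split => p [Vp Ap]; split => //.
    by case: (loc _ Vp) => // /nbhs_singleton /(_ Vp).
  by move: Ap => /nbhs_singleton /(_ Vp).
- exists (~` ([set q | V q -> ~ A q])°).
    by apply: open_closedC; exact: open_interior.
  apply/seteqP; split => p [Vp Ap]; split => //.
    by move=> /nbhs_singleton /(_ Vp).
  by case: (loc _ Vp) => [/nbhs_singleton /(_ Vp)//|h]; case: Ap.
Qed.

Lemma path_connected_connected (R : realType) (T : topologicalType)
  (V : set T) : @path_connected R T V -> connected V.
Proof.
move=> [[p0 Vp0] pc].
(* [V] is the union of its connected subsets through p0, since images of paths are among them. *)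
have -> : V = \bigcup_(A in [set A : set T | [/\ A p0, connected A & A `<=` V]]) A.
  apply/seteqP; split => p; last by move=> [A [_ _ AV] /AV].
  move=> Vp; have [c [[cc cV] c0 c1]] := pc _ _ Vp0 Vp.
  exists (c @` `[0, 1]); last by exists 1 => //=; rewrite in_itv /= ler01 lexx.
  split.
  - by exists 0 => //=; rewrite in_itv /= ler01 lexx.
  - by apply: connected_continuous_connected => //; exact: segment_connected.
  - by move=> _ [s s01 <-]; exact: cV.
apply: bigcup_connected; last by move=> A [].
by exists p0 => A [].
Qed.

Lemma const_connected (R : realType) (n : nat) (V : set 'rV[R]_n)
    (f : 'rV[R]_n -> R) : open V -> connected V -> smooth V f ->
  (forall q, V q -> forall i, partial i f q = 0) -> constant_on V f.
Proof.
move=> oV cV fs f0.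
have [->|/set0P[p0 Vp0]] := eqVneq V set0; first by exists 0.
exists (f p0); apply: (@connected_ind _ V [set q | f q = f p0]) => //.
  by exists p0.
move=> p Vp; have [r r0 rV] := open_cube oV Vp.
have h q : cube p r q -> f q = f p.
  by apply: (const_cube fs rV r0) => i x /rV Vx; exact: f0.
have [E|E] := pselect (f p = f p0); [left|right]; apply/nbhs_cube; exists r => //.
  by move=> q /h Eq _ /=; rewrite Eq.
by move=> q /h Eq _ /=; rewrite Eq.
Qed.

(** * Curvature and integrability in a moving frame *)

Lemma mx_addE (R : realType) a b (A B : 'M[R]_(a, b)) i j :
  (A + B) i j = A i j + B i j.
Proof. by rewrite mxE. Qed.

Lemma mx_oppE (R : realType) a b (A : 'M[R]_(a, b)) i j : (- A) i j = - A i j.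
Proof. by rewrite mxE. Qed.

Lemma mx_mulE (R : realType) a b c (A : 'M[R]_(a, b)) (B : 'M[R]_(b, c)) i k :
  (A *m B) i k = \sum_j A i j * B j k.
Proof. by rewrite mxE. Qed.

Lemma mx_scaleE (R : realType) a b x (A : 'M[R]_(a, b)) i j :
  (x *: A) i j = x * A i j.
Proof. by rewrite mxE. Qed.

Lemma mx_constE (R : realType) a b i j : (0 : 'M[R]_(a, b)) i j = 0.
Proof. by rewrite mxE. Qed.

Lemma mx_trE (R : realType) a b (A : 'M[R]_(a, b)) i j : A^T i j = A j i.
Proof. by rewrite mxE. Qed.

(* Sealed: unification would otherwise unfold it to a limit when rewriting
   with the entrywise rules above. *)
HB.lock Definition partial_mx (R : realType) (n a b : nat) (i : 'I_n)
    (A : 'rV[R]_n -> 'M[R]_(a, b)) (p : 'rV[R]_n) : 'M[R]_(a, b) :=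
  \matrix_(k, l) partial i (fun q => A q k l) p.

Section MatrixFields.
Context {R : realType} {n : nat}.
Implicit Types (D M : set 'rV[R]_n) (i j : 'I_n) (p : 'rV[R]_n).

Local Notation e_ := (delta_mx 0).

Definition isd_mx a b i p (A : 'rV[R]_n -> 'M[R]_(a, b)) (dA : 'M[R]_(a, b)) :=
  forall k l, is_derive p (e_ i) (fun q => A q k l) (dA k l).

Lemma partial_mxE a b i p (A : 'rV[R]_n -> 'M[R]_(a, b)) k l :
  partial_mx i A p k l = partial i (fun q => A q k l) p.
Proof. by rewrite partial_mx.unlock mxE. Qed.

Lemma isd_mx_val a b i p (A : 'rV[R]_n -> 'M[R]_(a, b)) dA :
  isd_mx i p A dA -> partial_mx i A p = dA.
Proof. by move=> dAE; apply/matrixP => k l; rewrite partial_mxE (partial_val (dAE k l)). Qed.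

Lemma isd_mx_add a b i p (A B : 'rV[R]_n -> 'M[R]_(a, b)) dA dB :
  isd_mx i p A dA -> isd_mx i p B dB ->
  isd_mx i p (fun q => A q + B q) (dA + dB).
Proof.
move=> hA hB k l; rewrite mxE; under eq_fun do rewrite mxE.
exact: isd_add.
Qed.

Lemma isd_mx_mul a b c i p (A : 'rV[R]_n -> 'M[R]_(a, b))
    (B : 'rV[R]_n -> 'M[R]_(b, c)) dA dB :
  isd_mx i p A dA -> isd_mx i p B dB ->
  isd_mx i p (fun q => A q *m B q) (dA *m B p + A p *m dB).
Proof.
move=> hA hB k l; rewrite mx_addE !mx_mulE -big_split /=; under eq_fun do rewrite mx_mulE.
by apply: isd_sum => m; exact: isd_mul.
Qed.

Lemma isd_mx_tr a b i p (A : 'rV[R]_n -> 'M[R]_(a, b)) dA :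
  isd_mx i p A dA -> isd_mx i p (fun q => (A q)^T) dA^T.
Proof. by move=> hA k l; rewrite mxE; under eq_fun do rewrite mxE. Qed.

Lemma isd_mx_near a b D i p (A B : 'rV[R]_n -> 'M[R]_(a, b)) dA :
  open D -> D p -> (forall q, D q -> A q = B q) ->
  isd_mx i p A dA -> isd_mx i p B dA.
Proof.
move=> oD Dp AB hA k l; apply: (isd_near _ (hA k l)).
by apply: (eq_on_near oD) => // q Dq; rewrite AB.
Qed.

Lemma smooth_mx_isd D i p (A : 'rV[R]_n -> 'M[R]_n) :
  smooth_mx D A -> D p -> isd_mx i p A (partial_mx i A p).
Proof. by move=> hA Dp k l; rewrite partial_mxE; exact: (smooth_isd i (hA k l)). Qed.

Lemma smooth_mx_mul D (A B : 'rV[R]_n -> 'M[R]_n) : open D ->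
  smooth_mx D A -> smooth_mx D B -> smooth_mx D (fun q => A q *m B q).
Proof.
move=> oD hA hB k l; under eq_fun do rewrite mxE.
by apply: smooth_sum => // m; exact: smooth_mul.
Qed.

Lemma smooth_mx_tr D (A : 'rV[R]_n -> 'M[R]_n) :
  smooth_mx D A -> smooth_mx D (fun q => (A q)^T).
Proof. by move=> hA k l; under eq_fun do rewrite mxE; exact: hA. Qed.

Lemma partial_mx_sym D i j p (A : 'rV[R]_n -> 'M[R]_n) : open D ->
  smooth_mx D A -> D p ->
  partial_mx i (partial_mx j A) p = partial_mx j (partial_mx i A) p.
Proof.
move=> oD hA Dp; apply/matrixP => k l; rewrite !partial_mxE.
have E a : (fun q => partial_mx a A q k l) = partial a (fun q => A q k l).
  by apply/funext => q; rewrite partial_mxE.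
exact: (etrans (congr1 (fun f => partial i f p) (E j))
  (etrans (schwarz i j oD (hA k l) Dp)
          (esym (congr1 (fun f => partial j f p) (E i))))).
Qed.

Lemma smooth_mx_partial D i (A : 'rV[R]_n -> 'M[R]_n) :
  smooth_mx D A -> smooth_mx D (partial_mx i A).
Proof.
move=> hA k l; under eq_fun do rewrite partial_mxE; exact: smooth_partial.
Qed.

End MatrixFields.

(** * Torsion-free connections and the Nijenhuis tensor *)

Section CovariantDerivative.
Context {R : realType} {n : nat}.
Variables (M : set 'rV[R]_n) (p : 'rV[R]_n) (Gam : 'I_n -> 'M[R]_n).
Implicit Types (X Y : 'rV[R]_n -> 'rV[R]_n).
Hypothesis Gam_sym : forall i j k, Gam i j k = Gam j i k.

Definition cov i Y : 'rV[R]_n := partial_mx i Y p + Y p *m Gam i.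

Definition nabla (v : 'rV[R]_n) Y : 'rV[R]_n := \sum_i v 0 i *: cov i Y.

Lemma lie_bracket_nabla X Y :
  lie_bracket X Y p = nabla (X p) Y - nabla (Y p) X.
Proof.
apply/rowP => k; rewrite mxE mx_addE mx_oppE /nabla !summxE.
have swap : \sum_i X p 0 i * (Y p *m Gam i) 0 k =
    \sum_i Y p 0 i * (X p *m Gam i) 0 k.
  transitivity (\sum_i \sum_j X p 0 i * Y p 0 j * Gam i j k).
    apply: eq_bigr => i _; rewrite mx_mulE big_distrr /=.
    by apply: eq_bigr => j _; rewrite mulrA.
  rewrite exchange_big; apply: eq_bigr => i _; rewrite mx_mulE big_distrr /=.
  by apply: eq_bigr => j _; rewrite (Gam_sym j); ring.
have split X1 Y1 : \sum_i (X1 p 0 i *: cov i Y1) 0 k =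
    \sum_i X1 p 0 i * partial i (fun q => Y1 q 0 k) p
    + \sum_i X1 p 0 i * (Y1 p *m Gam i) 0 k.
  rewrite -big_split; apply: eq_bigr => i _.
  by rewrite mx_scaleE /cov mx_addE partial_mxE mulrDr.
by rewrite !split swap opprD addrACA subrr addr0 sumrB.
Qed.

Lemma smooth_vec_isd i X : smooth_vec M X -> M p ->
  isd_mx i p X (partial_mx i X p).
Proof.
by move=> Xs Mp k l; rewrite partial_mxE ord1; exact: (smooth_isd i (Xs l) Mp).
Qed.

Lemma cov_parallel J i Y : M p -> smooth_mx M J -> smooth_vec M Y ->
  partial_mx i J p = Gam i *m J p - J p *m Gam i ->
  cov i (fun q => Y q *m J q) = cov i Y *m J p.
Proof.
move=> Mp Js Ys dJ; rewrite /cov.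
rewrite (isd_mx_val (isd_mx_mul (smooth_vec_isd i Ys Mp) (smooth_mx_isd i Js Mp))).
by rewrite dJ mulmxBr mulmxDl !mulmxA -addrA subrK.
Qed.

(** A torsion-free connection turns every bracket into a difference of covariant derivatives; if J
    is parallel it moves out of them, and the eight terms cancel in pairs. The hypothesis on
    [partial_mx i J p] is parallelism for matrices acting on rows from the right. *)
Lemma nijenhuis_parallel J X Y : M p -> smooth_mx M J -> J p *m J p = - 1%:M ->
  (forall i, partial_mx i J p = Gam i *m J p - J p *m Gam i) ->
  smooth_vec M X -> smooth_vec M Y -> nijenhuis J X Y p = 0.
Proof.
move=> Mp Js JJ dJ Xs Ys.
have nablaJ v Z : smooth_vec M Z -> nabla v (fun q => Z q *m J q) = nabla v Z *m J p.
  move=> Zs; rewrite /nabla mulmx_suml; apply: eq_bigr => i _.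
  by rewrite cov_parallel // scalemxAl.
rewrite /nijenhuis !lie_bracket_nabla !nablaJ // !mulmxBl -!mulmxA JJ.
rewrite !mulmxN !mulmx1.
move: (nabla (X p *m J p) Y *m J p) (nabla (Y p *m J p) X *m J p)
  (nabla (X p) Y) (nabla (Y p) X) => a b c d.
by apply/matrixP => k l; rewrite !(mx_addE, mx_oppE) mx_constE; ring.
Qed.

End CovariantDerivative.

(* The columns of Q are the coframe, F is its inverse and B c is the matrix of
   nabla along the c-th frame vector, in the frame. The coordinate connection
   satisfies conn_i Q = Q frame_conn_i + d_i Q; as it is symmetric and metric it is
   the Levi-Civita one, and its curvature is conjugate by Q to that of frame_conn. *)
Section Frame.
Context {R : realType} {n : nat}.
Variables (M : set 'rV[R]_n) (Q F G g : 'rV[R]_n -> 'M[R]_n).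
Variables (B : 'I_n -> 'rV[R]_n -> 'M[R]_n).
Variables (EB : 'I_n -> 'I_n -> 'rV[R]_n -> 'M[R]_n).
Implicit Types (i j k l c d : 'I_n) (p : 'rV[R]_n).

Hypotheses (oM : open M) (Qs : smooth_mx M Q) (Fs : smooth_mx M F).
Hypotheses (Gs : smooth_mx M G) (Bs : forall c, smooth_mx M (B c)).
Hypothesis gE : forall p, M p -> g p = Q p *m G p *m (Q p)^T.
Hypothesis FQ : forall p, M p -> F p *m Q p = 1%:M.
Hypothesis Gsym : forall p, M p -> (G p)^T = G p.
Hypothesis Gunit : forall p, M p -> G p \in unitmx.

Definition frame_conn i p := \sum_c Q p i c *: B c p.

Hypothesis metricB : forall i p, M p ->
  partial_mx i G p = frame_conn i p *m G p + G p *m (frame_conn i p)^T.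

(** Cartan's first structure equation: the left side is the exterior derivative of the b-th coframe
    form, and torsion-freeness expresses it by the frame connection. *)
Hypothesis torsionB : forall i j b p, M p ->
  partial_mx i Q p j b - partial_mx j Q p i b
  = \sum_c \sum_d Q p i c * Q p j d * (B d p c b - B c p d b).

Hypothesis EBE : forall i d p, M p ->
  partial_mx i (B d) p = \sum_c Q p i c *: EB c d p.

Definition connQ i p := Q p *m frame_conn i p + partial_mx i Q p.
Definition conn i p := connQ i p *m F p.

(** R(e_c, e_d) as an endomorphism in the frame. The products appear in reversed order because
    matrices act on the right, and the last sum is minus the covariant derivative along [e_c, e_d],
    whose components torsion-freeness gives as B c d b - B d c b. *)
Definition frame_curv c d p : 'M[R]_n :=
  EB c d p - EB d c p + (B d p *m B c p - B c p *m B d p)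
  + \sum_b (B d p c b - B c p d b) *: B b p.

Lemma connQE i p : M p -> conn i p *m Q p = connQ i p.
Proof. by move=> Mp; rewrite /conn -mulmxA FQ // mulmx1. Qed.

Lemma connQ_sym i j b p : M p -> connQ i p j b = connQ j p i b.
Proof.
move=> Mp; have := torsionB i j b Mp; rewrite /connQ !mx_addE !mx_mulE.
move/eqP; rewrite subr_eq => /eqP ->; rewrite addrA; congr (_ + _).
have -> : \sum_c Q p j c * frame_conn i p c b =
  \sum_c \sum_d Q p i c * Q p j d * B c p d b.
  rewrite exchange_big; apply: eq_bigr => c _; rewrite /frame_conn summxE.
  by rewrite big_distrr /=; apply: eq_bigr => d _; rewrite mx_scaleE; ring.
have -> : \sum_c Q p i c * frame_conn j p c b =
  \sum_c \sum_d Q p i c * Q p j d * B d p c b.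
  apply: eq_bigr => c _; rewrite /frame_conn summxE.
  by rewrite big_distrr /=; apply: eq_bigr => d _; rewrite mx_scaleE; ring.
rewrite -big_split /=; apply: eq_bigr => c _; rewrite -big_split /=.
by apply: eq_bigr => d _; ring.
Qed.

Lemma conn_sym i j k p : M p -> conn i p j k = conn j p i k.
Proof.
move=> Mp; rewrite /conn !mx_mulE; apply: eq_bigr => b _.
by rewrite (connQ_sym i j).
Qed.

Lemma Q_unit p : M p -> Q p \in unitmx.
Proof. by move=> /FQ /mulmx1_unit[]. Qed.

Lemma g_sym p : M p -> (g p)^T = g p.
Proof. by move=> Mp; rewrite gE // !trmx_mul trmxK Gsym // mulmxA. Qed.

Lemma g_unit p : M p -> g p \in unitmx.
Proof.
move=> Mp; rewrite gE // !unitmx_mul unitmx_tr Q_unit //= andbT.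
exact: Gunit.
Qed.

Lemma g_parallel i p : M p ->
  isd_mx i p g (conn i p *m g p + g p *m (conn i p)^T).
Proof.
move=> Mp.
apply: (isd_mx_near oM Mp (A := fun q => Q q *m G q *m (Q q)^T)).
  by move=> q Mq; rewrite gE.
have h := isd_mx_mul (isd_mx_mul (smooth_mx_isd i Qs Mp) (smooth_mx_isd i Gs Mp))
  (isd_mx_tr (smooth_mx_isd i Qs Mp)).
suff <- : (partial_mx i Q p *m G p + Q p *m partial_mx i G p) *m (Q p)^T +
  Q p *m G p *m (partial_mx i Q p)^T =
  conn i p *m g p + g p *m (conn i p)^T by [].
have -> : conn i p *m g p = connQ i p *m G p *m (Q p)^T.
  by rewrite gE // !mulmxA connQE.
have -> : g p *m (conn i p)^T = Q p *m G p *m (connQ i p)^T.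
  by rewrite gE // -!mulmxA -trmx_mul connQE.
have -> : (connQ i p)^T = (frame_conn i p)^T *m (Q p)^T + (partial_mx i Q p)^T.
  by rewrite /connQ -trmx_mul; apply/matrixP => k l; rewrite !(mx_trE, mx_addE).
rewrite metricB // /connQ !(mulmxDl, mulmxDr) !mulmxA !addrA.
by congr (_ + _ + _); exact: addrC.
Qed.

(** Koszul's argument: for a symmetric metric connection the three derivatives of g in the
    Christoffel symbol collapse to twice the (j, l) entry of [conn i p *m g p]. *)
Lemma christoffelE i j k p : M p -> christoffel g i j k p = conn i p j k.
Proof.
move=> Mp; rewrite /christoffel.
have dg a b c : partial a (fun q => g q b c) p =
    (conn a p *m g p) b c + (conn c p *m g p) a b.
  rewrite (partial_val (g_parallel a Mp b c)) mx_addE; congr (_ + _).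
  rewrite !mx_mulE; apply: eq_bigr => m _; rewrite mx_trE mulrC.
  by rewrite (conn_sym a c) // -[in LHS](g_sym Mp) mx_trE.
have gs a b c : (conn a p *m g p) b c = (conn b p *m g p) a c.
  by rewrite !mx_mulE; apply: eq_bigr => m _; rewrite (conn_sym a b).
have -> : \sum_l invmx (g p) k l * (partial i (fun q => g q j l) p +
   partial j (fun q => g q i l) p - partial l (fun q => g q i j) p) =
   \sum_l 2 * ((conn i p *m g p) j l * (invmx (g p))^T l k).
  apply: eq_bigr => l _; rewrite !dg (gs j i l) (gs l j i) (gs l i j) mx_trE.
  by ring.
rewrite -big_distrr /= mulrA mulVf ?pnatr_eq0 // mul1r.
transitivity ((conn i p *m g p *m (invmx (g p))^T) j k); first by rewrite [RHS]mx_mulE.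
by rewrite trmx_inv g_sym // mulmxK // g_unit.
Qed.

Lemma conn_smooth i : smooth_mx M (conn i).
Proof.
apply: (smooth_mx_mul oM) Fs => k l; under eq_fun do rewrite mx_addE.
apply: (smooth_add oM); last exact: (smooth_mx_partial i Qs).
apply: (smooth_mx_mul oM Qs) => {}k {}l.
have -> : (fun q => frame_conn i q k l) = fun q => \sum_c Q q i c * B c q k l.
  by apply/funext => q; rewrite /frame_conn summxE; under eq_bigr do rewrite mx_scaleE.
by apply: (@smooth_sum _ _ _ _ M (fun c q => Q q i c * B c q k l) oM) => c;
  exact: (smooth_mul oM (Qs i c) (Bs c k l)).
Qed.

Definition curv_mx i j p : 'M[R]_n := \matrix_(k, l) curvature g i j k l p.

Lemma curv_mxE i j p : M p -> curv_mx i j p =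
  partial_mx i (conn j) p - partial_mx j (conn i) p
  + (conn j p *m conn i p - conn i p *m conn j p).
Proof.
move=> Mp; apply/matrixP => k l; rewrite mxE /curvature.
have part a b c d : partial a (christoffel g b c d) p = partial_mx a (conn b) p c d.
  rewrite partial_mxE; apply: (partial_eq _ oM Mp) => q Mq.
  exact: christoffelE.
rewrite !part !(mx_addE, mx_oppE, mx_mulE) -sumrB; congr (_ + _).
by apply: eq_bigr => m _; rewrite !christoffelE // [X in X - _]mulrC
  [X in _ - X]mulrC.
Qed.

Lemma frame_conn_isd i j p : M p -> isd_mx i p (frame_conn j)
  (\sum_d (partial_mx i Q p j d *: B d p
           + Q p j d *: \sum_c Q p i c *: EB c d p)).
Proof.
move=> Mp k l; rewrite summxE; under eq_fun do rewrite summxE.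
apply: isd_sum => d; under eq_fun do rewrite mx_scaleE.
rewrite mx_addE !mx_scaleE -EBE //.
exact: (isd_mul (smooth_mx_isd i Qs Mp j d) (smooth_mx_isd i (Bs d) Mp k l)).
Qed.

(** Gauge covariance of curvature. Everything is kept multiplied by [Q] on the right, so that the
    inverse [F] is never differentiated. *)
Lemma curv_frame i j p : M p -> curv_mx i j p *m Q p =
  Q p *m (partial_mx i (frame_conn j) p - partial_mx j (frame_conn i) p
          + (frame_conn j p *m frame_conn i p - frame_conn i p *m frame_conn j p)).
Proof.
move=> Mp; rewrite curv_mxE //.
(* On the right only [Q *m partial_mx a (frame_conn b)] and the last product fail to be symmetric in
   a and b; antisymmetrising leaves just these, second derivatives of [Q] cancelling by equality of
   mixed partials. *)
have half a b : partial_mx a (conn b) p *m Q p + conn b p *m conn a p *m Q p =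
    partial_mx a Q p *m frame_conn b p + partial_mx b Q p *m frame_conn a p
    + Q p *m partial_mx a (frame_conn b) p + partial_mx a (partial_mx b Q) p
    + Q p *m frame_conn b p *m frame_conn a p.
  have dQ := smooth_mx_isd a Qs Mp.
  have h1 := isd_mx_mul (smooth_mx_isd a (conn_smooth b) Mp) dQ.
  have dA : isd_mx a p (frame_conn b) (partial_mx a (frame_conn b) p).
    by rewrite (isd_mx_val (frame_conn_isd a b Mp)); exact: frame_conn_isd.
  have h2 := isd_mx_add (isd_mx_mul dQ dA)
    (smooth_mx_isd a (smooth_mx_partial b Qs) Mp).
  have E : partial_mx a (conn b) p *m Q p + conn b p *m partial_mx a Q p =
     partial_mx a Q p *m frame_conn b p + Q p *m partial_mx a (frame_conn b) p
     + partial_mx a (partial_mx b Q) p.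
    rewrite -(isd_mx_val h2) -(isd_mx_val h1); apply/matrixP => k l; rewrite !partial_mxE.
    by apply: (partial_eq _ oM Mp) => q Mq; rewrite connQE.
  have -> : conn b p *m conn a p *m Q p =
      connQ b p *m frame_conn a p + conn b p *m partial_mx a Q p.
    by rewrite -mulmxA connQE // [connQ a p]/connQ mulmxDr mulmxA connQE.
  rewrite [connQ b p *m _ + _]addrC addrA E /connQ mulmxDl.
  move: (partial_mx a Q p *m _) (partial_mx b Q p *m _)
    (Q p *m partial_mx a _ p) (partial_mx a (partial_mx b Q) p)
    (Q p *m _ *m _) => t1 t2 t3 t4 t5.
  by apply/matrixP => k l; rewrite !mx_addE; ring.
have := half i j; have := half j i.
rewrite (partial_mx_sym j i oM Qs Mp).
set a1 := partial_mx j (conn i) p; set a2 := partial_mx i (conn j) p.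
move=> h1 h2; rewrite !mulmxDl !mulNmx.
rewrite addrACA h2 -opprD h1 !mulmxDr !mulmxN !mulmxA.
move: (partial_mx i Q p *m _) (partial_mx j Q p *m _)
  (partial_mx i (partial_mx j Q) p)
  (Q p *m partial_mx i _ p) (Q p *m partial_mx j _ p)
  (Q p *m frame_conn j p *m _) (Q p *m frame_conn i p *m _)
  => x1 x2 y1 z1 z2 t1 t2.
by apply/matrixP => k l; rewrite !(mx_addE, mx_oppE); ring.
Qed.

Lemma frame_curvE i j p : M p ->
  partial_mx i (frame_conn j) p - partial_mx j (frame_conn i) p
  + (frame_conn j p *m frame_conn i p - frame_conn i p *m frame_conn j p)
  = \sum_c \sum_d (Q p i c * Q p j d) *: frame_curv c d p.
Proof.
move=> Mp; rewrite (isd_mx_val (frame_conn_isd i j Mp)).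
rewrite (isd_mx_val (frame_conn_isd j i Mp)).
rewrite !big_split /=.
have e1 : \sum_c Q p j c *: (\sum_d Q p i d *: EB d c p) =
    \sum_c \sum_d (Q p i c * Q p j d) *: EB c d p.
  rewrite exchange_big /=; apply: eq_bigr => c _; rewrite scaler_sumr.
  by apply: eq_bigr => d _; rewrite scalerA mulrC.
have e2 : \sum_c Q p i c *: (\sum_d Q p j d *: EB d c p) =
    \sum_c \sum_d (Q p i c * Q p j d) *: EB d c p.
  apply: eq_bigr => c _; rewrite scaler_sumr.
  by apply: eq_bigr => d _; rewrite scalerA.
have e3 : frame_conn j p *m frame_conn i p =
    \sum_c \sum_d (Q p i c * Q p j d) *: (B d p *m B c p).
  rewrite /frame_conn mulmx_sumr; apply: eq_bigr => c _.
  rewrite mulmx_suml; apply: eq_bigr => d _.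
  by rewrite -scalemxAl -scalemxAr scalerA mulrC.
have e4 : frame_conn i p *m frame_conn j p =
    \sum_c \sum_d (Q p i c * Q p j d) *: (B c p *m B d p).
  rewrite /frame_conn mulmx_suml; apply: eq_bigr => c _.
  rewrite mulmx_sumr; apply: eq_bigr => d _.
  by rewrite -scalemxAl -scalemxAr scalerA.
(* Derivatives falling on the coframe coefficients combine into the exterior derivative of the
   coframe, which [torsionB] turns into the bracket term of [frame_curv]. *)
have e5 : \sum_b partial_mx i Q p j b *: B b p - \sum_b partial_mx j Q p i b *: B b p
  = \sum_c \sum_d (Q p i c * Q p j d) *:
     (\sum_b (B d p c b - B c p d b) *: B b p).
  rewrite -sumrB.
  transitivity (\sum_b \sum_c \sum_d (Q p i c * Q p j d) *:
     ((B d p c b - B c p d b) *: B b p)).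
    apply: eq_bigr => b _; rewrite -scalerBl torsionB // scaler_suml.
    apply: eq_bigr => c _; rewrite scaler_suml.
    by apply: eq_bigr => d _; rewrite scalerA.
  rewrite exchange_big; apply: eq_bigr => c _.
  rewrite exchange_big; apply: eq_bigr => d _.
  by rewrite scaler_sumr.
transitivity ((\sum_b partial_mx i Q p j b *: B b p
    - \sum_b partial_mx j Q p i b *: B b p) +
   (\sum_c Q p j c *: (\sum_d Q p i d *: EB d c p)
   - \sum_c Q p i c *: (\sum_d Q p j d *: EB d c p))
   + (frame_conn j p *m frame_conn i p - frame_conn i p *m frame_conn j p)).
  by congr (_ + _); rewrite opprD addrACA.
rewrite e1 e2 e3 e4 e5 addrAC -addrA addrCA -!sumrB -!big_split /=.
apply: eq_bigr => c _; rewrite -!sumrB -!big_split /=.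
apply: eq_bigr => d _; rewrite -!scalerBr -!scalerDr; congr (_ *: _).
rewrite /frame_curv; move: (EB c d p) (EB d c p) (B d p *m B c p)
  (B c p *m B d p) (\sum_b _) => a1 a2 a3 a4 a5.
by apply/matrixP => k l; rewrite !(mx_addE, mx_oppE); ring.
Qed.

Lemma riemann_frame p (X Y Z W : 'rV[R]_n) : M p ->
  riemann g p X Y Z W = \sum_c \sum_d (X *m Q p) 0 c * (Y *m Q p) 0 d *
    (Z *m Q p *m frame_curv c d p *m G p *m (W *m Q p)^T) 0 0.
Proof.
move=> Mp.
have -> : riemann g p X Y Z W = \sum_i \sum_j X 0 i * Y 0 j *
    (Z *m curv_mx i j p *m g p *m W^T) 0 0.
  rewrite /riemann; apply: eq_bigr => i _; apply: eq_bigr => j _.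
  rewrite -!mulmxA mx_mulE big_distrr; apply: eq_bigr => k _.
  rewrite mulmxA mx_mulE !big_distrr /=; apply: eq_bigr => l _.
  rewrite [(_ *m _) k l]mx_mulE mx_trE big_distrl /= !big_distrr /=.
  by apply: eq_bigr => m _; rewrite [curv_mx i j p k m]mxE; ring.
pose T c d : R :=
  (Z *m Q p *m frame_curv c d p *m G p *m (W *m Q p)^T) 0 0.
have tens i j : (Z *m curv_mx i j p *m g p *m W^T) 0 0 =
    \sum_c \sum_d (Q p i c * Q p j d) * T c d.
  rewrite gE // -!mulmxA -trmx_mul !mulmxA -(mulmxA Z) curv_frame //.
  rewrite frame_curvE // mulmxA mulmx_sumr !mulmx_suml summxE.
  apply: eq_bigr => c _; rewrite mulmx_sumr !mulmx_suml summxE.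
  by apply: eq_bigr => d _; rewrite -scalemxAr -!scalemxAl mx_scaleE.
under eq_bigr do under eq_bigr do rewrite tens.
under [RHS]eq_bigr do under eq_bigr do rewrite -[(_ *m _^T) 0 0]/(T _ _).
move: T {tens} => T.
transitivity (\sum_i \sum_j \sum_c \sum_d
   X 0 i * Q p i c * (Y 0 j * Q p j d) * T c d).
  apply: eq_bigr => i _; apply: eq_bigr => j _; rewrite big_distrr /=.
  apply: eq_bigr => c _; rewrite big_distrr /=; apply: eq_bigr => d _.
  by ring.
apply: etrans; first by apply: eq_bigr => i _; exact: exchange_big.
rewrite exchange_big; apply: eq_bigr => c _.
apply: etrans; first by apply: eq_bigr => i _; exact: exchange_big.
rewrite exchange_big; apply: eq_bigr => d _.
rewrite !mx_mulE big_distrl /= big_distrl /=.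
apply: eq_bigr => i _; rewrite big_distrr /= big_distrl /=.
by apply: eq_bigr => j _.
Qed.

(** The Lie bracket of two fields with constant frame components: only the connection terms
    survive. *)
Definition frame_bracket p (xi eta : 'rV[R]_n) : 'rV[R]_n :=
  \sum_c (xi 0 c *: (eta *m B c p) - eta 0 c *: (xi *m B c p)).

Lemma lie_bracket_frame p X Y xi eta : M p -> smooth_vec M X ->
  smooth_vec M Y -> (forall q, M q -> X q *m Q q = xi) ->
  (forall q, M q -> Y q *m Q q = eta) ->
  lie_bracket X Y p *m Q p = frame_bracket p xi eta.
Proof.
move=> Mp Xs Ys XQ YQ.
rewrite (@lie_bracket_nabla _ _ p (conn ^~ p)) => [|i j k]; last exact: conn_sym.
have nablaQ (v : 'rV[R]_n) Z zeta : smooth_vec M Z ->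
    (forall q, M q -> Z q *m Q q = zeta) ->
    nabla p (conn ^~ p) v Z *m Q p = \sum_c (v *m Q p) 0 c *: (zeta *m B c p).
  move=> Zs ZQ; rewrite /nabla mulmx_suml.
  have covQ i : cov p (conn ^~ p) i Z *m Q p = zeta *m frame_conn i p.
    rewrite /cov mulmxDl -mulmxA connQE // /connQ mulmxDr mulmxA ZQ //.
    (* The other two terms make up the derivative of Z Q, which is the constant [zeta] on [M]. *)
    rewrite addrCA [X in _ + X](_ : _ = 0) ?addr0 //.
    have h := isd_mx_mul (smooth_vec_isd i Zs Mp) (smooth_mx_isd i Qs Mp).
    rewrite -(isd_mx_val h); apply/matrixP => k l.
    rewrite partial_mxE mx_constE.
    rewrite (partial_eq _ oM Mp (g := fun=> zeta k l)) => [|q Mq].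
      by apply: partial_val; exact: isd_cst.
    by rewrite ZQ.
  under eq_bigr do rewrite -scalemxAl covQ /frame_conn mulmx_sumr scaler_sumr.
  rewrite exchange_big; apply: eq_bigr => c _.
  rewrite mx_mulE scaler_suml; apply: eq_bigr => i _.
  by rewrite -scalemxAr scalerA.
by rewrite mulmxBl (nablaQ _ _ _ Ys YQ) (nablaQ _ _ _ Xs XQ) XQ // YQ // -sumrB.
Qed.

Section ComplexStructure.
Variables (J : 'rV[R]_n -> 'M[R]_n) (J0 : 'M[R]_n).
Hypotheses (Js : smooth_mx M J) (JQ : forall q, M q -> J q *m Q q = Q q *m J0).

Lemma smooth_vec_mul X : smooth_vec M X -> smooth_vec M (fun q => X q *m J q).
Proof.
move=> Xs k; under eq_fun do rewrite mx_mulE.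
by apply: (@smooth_sum _ _ _ _ M (fun m q => X q 0 m * J q m k) oM) => m;
  exact: (smooth_mul oM (Xs m) (Js m k)).
Qed.

Lemma nijenhuis_frame p X Y xi eta : M p -> smooth_vec M X ->
  smooth_vec M Y -> (forall q, M q -> X q *m Q q = xi) ->
  (forall q, M q -> Y q *m Q q = eta) ->
  nijenhuis J X Y p *m Q p =
    frame_bracket p (xi *m J0) (eta *m J0)
    - frame_bracket p (xi *m J0) eta *m J0
    - frame_bracket p xi (eta *m J0) *m J0 - frame_bracket p xi eta.
Proof.
move=> Mp Xs Ys XQ YQ.
have XJQ q : M q -> X q *m J q *m Q q = xi *m J0.
  by move=> Mq; rewrite -mulmxA JQ // mulmxA XQ.
have YJQ q : M q -> Y q *m J q *m Q q = eta *m J0.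
  by move=> Mq; rewrite -mulmxA JQ // mulmxA YQ.
have XJs := smooth_vec_mul Xs; have YJs := smooth_vec_mul Ys.
rewrite /nijenhuis !mulmxBl -!(mulmxA _ (J p)) JQ // !mulmxA.
rewrite (lie_bracket_frame Mp XJs YJs XJQ YJQ) (lie_bracket_frame Mp XJs Ys XJQ YQ).
by rewrite (lie_bracket_frame Mp Xs YJs XQ YJQ) (lie_bracket_frame Mp Xs Ys XQ YQ).
Qed.

(** J has constant matrix [J0] in the frame, so commuting with the connection matrices makes it
    parallel. *)
Lemma nijenhuis_commute p X Y : M p -> J p *m J p = - 1%:M ->
  (forall c, B c p *m J0 = J0 *m B c p) ->
  smooth_vec M X -> smooth_vec M Y -> nijenhuis J X Y p = 0.
Proof.
move=> Mp JJ BJ Xs Ys.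
apply: (@nijenhuis_parallel _ _ M p (conn ^~ p)) => // [i j k|i].
  exact: conn_sym.
have AJ : frame_conn i p *m J0 = J0 *m frame_conn i p.
  rewrite /frame_conn mulmx_suml mulmx_sumr; apply: eq_bigr => c _.
  by rewrite -scalemxAl BJ scalemxAr.
have dQ := smooth_mx_isd i Qs Mp.
have E : partial_mx i J p *m Q p + J p *m partial_mx i Q p
    = partial_mx i Q p *m J0.
  rewrite -(isd_mx_val (isd_mx_mul (smooth_mx_isd i Js Mp) dQ)).
  have h : isd_mx i p (fun q => Q q *m J0) (partial_mx i Q p *m J0).
    move=> k l; rewrite mx_mulE; under eq_fun do rewrite mx_mulE.
    apply: isd_sum => m; have := isd_mul (dQ k m) (isd_cst p (delta_mx 0 i) (J0 m l)).
    by move=> h; apply: (is_derive_eq h); rewrite mulr0 addr0.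
  rewrite -(isd_mx_val h); apply/matrixP => k l; rewrite !partial_mxE.
  by apply: (partial_eq _ oM Mp) => q Mq; rewrite JQ.
apply: (can_inj (mulmxK (Q_unit Mp))).
rewrite mulmxBl -[conn i p *m J p *m _]mulmxA JQ // mulmxA connQE //.
rewrite -[J p *m _ *m _]mulmxA connQE // /connQ mulmxDl mulmxDr.
rewrite -[Q p *m _ *m J0]mulmxA AJ [Q p *m _]mulmxA -JQ // -[_ *m _ *m frame_conn i p]mulmxA.
by rewrite opprD addrACA subrr add0r -E addrK.
Qed.

End ComplexStructure.

End Frame.

Lemma smooth_sub_set (R : realType) n (D D' : set 'rV[R]_n) f :
  D' `<=` D -> smooth D f -> smooth D' f.
Proof.
move=> sub fs k; have := fs k; elim: k f {fs} => [|k IHk] f.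
  by move=> [cf _]; split => // p; rewrite inE => /sub Dp; apply: cf; rewrite inE.
move=> [cf h]; split => [p|i]; first by rewrite inE => /sub ?; apply: cf; rewrite inE.
have [fd fk] := h i; split; last exact: IHk.
by move=> p; rewrite inE => /sub ?; apply: fd; rewrite inE.
Qed.

(** * Unique continuation for harmonic functions *)

Section UniqueContinuation.
Context {R : realType}.
Implicit Types (V D K : set 'rV[R]_3) (p q : 'rV[R]_3).

Local Notation e_ := (delta_mx 0).

Lemma partials_mul_exp D S L i q : open D -> smooth D S -> smooth D L -> D q ->
  let F := fun x => S x * expR (L x) in
  partial i F q = expR (L q) * (partial i S q + S q * partial i L q) /\
  partial i (partial i F) q = expR (L q) *
    (partial i (partial i S) q + 2 * partial i S q * partial i L q
     + S q * partial i (partial i L) q + S q * partial i L q ^+ 2).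
Proof.
move=> oD Ss Ls Dq F.
have F1 x : D x ->
    partial i F x = expR (L x) * (partial i S x + S x * partial i L x).
  move=> Dx; apply: partial_val.
  have := isd_mul (smooth_isd i Ss Dx) (isd_exp (smooth_isd i Ls Dx)).
  by move=> h; apply: (is_derive_eq h); ring.
split; first exact: F1.
rewrite (partial_eq i oD Dq F1); apply: partial_val.
have dS := smooth_isd i Ss Dq; have dL := smooth_isd i Ls Dq.
have dS2 := smooth_isd i (smooth_partial i Ss) Dq.
have dL2 := smooth_isd i (smooth_partial i Ls) Dq.
have := isd_mul (isd_exp dL) (isd_add dS2 (isd_mul dS dL2)).
move=> h; apply: (is_derive_eq h).
move: (partial i (partial i S) q) (partial i (partial i L) q)
  (partial i S q) (partial i L q) (S q) (expR (L q)) => *.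
by ring.
Qed.

Lemma ord3_xy (i : 'I_3) : i != iz -> i = ix \/ i = iy.
Proof. by case: i => [[|[|[|//]]]] lt // _; [left|right]; exact: val_inj. Qed.

(* rho is squared: all radii below are squares of Euclidean ones. *)
Definition rho p q : R := (q 0 ix - p 0 ix) ^+ 2 + (q 0 iy - p 0 iy) ^+ 2.

Lemma smooth_rho D p : open D -> smooth D (rho p).
Proof.
move=> oD; rewrite /rho; under eq_fun do rewrite !expr2.
by apply: smooth_add => //; apply: smooth_mul => //; apply: smooth_add;
  do ?[exact: smooth_coord|exact: smooth_cst].
Qed.

Lemma isd_rho p q i : i != iz ->
  is_derive q (e_ i) (rho p) (2 * (q 0 i - p 0 i)).
Proof.
move=> iNz.
have dc j := isd_add (isd_coord i j q) (isd_opp (isd_cst q (e_ i) (p 0 j))).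
apply: (is_derive_eq (isd_add (isd_exprn 1 (dc ix)) (isd_exprn 1 (dc iy)))).
rewrite oppr0 !addr0 !expr1; case: (ord3_xy iNz) => ->.
  by rewrite (_ : (ix == ix) = true) // (_ : (iy == ix) = false) // mulr1n mulr0n; ring.
by rewrite (_ : (iy == iy) = true) // (_ : (ix == iy) = false) // mulr1n mulr0n; ring.
Qed.

Lemma partials_inv_rho D p (k : R) i q : open D ->
  (forall x, D x -> rho p x != 0) -> D q -> i != iz ->
  partial i (fun x => k / rho p x) q = - k * 2 * (q 0 i - p 0 i) / rho p q ^+ 2 /\
  partial i (partial i (fun x => k / rho p x)) q =
    - k * 2 / rho p q ^+ 2 + 8 * k * (q 0 i - p 0 i) ^+ 2 / rho p q ^+ 3.
Proof.
move=> oD rho0 Dq iNz.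
have L1 x : D x -> partial i (fun x => k / rho p x) x =
    - k * 2 * (x 0 i - p 0 i) / rho p x ^+ 2.
  move=> Dx; apply: partial_val.
  have h := isd_mul (isd_cst x (e_ i) k) (isd_inv (rho0 _ Dx) (isd_rho p x iNz)).
  by apply: (is_derive_eq h); rewrite mul0r add0r; ring.
split; first exact: L1.
rewrite (partial_eq i oD Dq L1); apply: partial_val.
have dr := isd_rho p q iNz; have r0 := rho0 _ Dq.
have dc := isd_add (isd_coord i i q) (isd_opp (isd_cst q (e_ i) (p 0 i))).
have r20 : rho p q ^+ 2 != 0 by rewrite expf_neq0.
have h := isd_mul (isd_mul (isd_cst q (e_ i) (- k * 2)) dc)
  (isd_inv (f := fun x => rho p x ^+ 2) r20 (isd_exprn 1 dr)).
apply: (is_derive_eq h); rewrite eqxx mulr1n; move: r0.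
by move: (rho p q) (q 0 i) (p 0 i) => r a b r0; field.
Qed.

Lemma compact_annulus p (r0 r1 : R) :
  compact [set q : 'rV[R]_3 | q 0 iz = p 0 iz /\ r0 <= rho p q <= r1].
Proof.
(* The half-side 1 + |r1| avoids a square root: x^2 <= b forces |x| <= 1 + b. *)
have cbox : compact [set v : 'rV[R]_3 | forall i,
    v ord0 i \in `[p 0 i - (1 + `|r1|), p 0 i + (1 + `|r1|)]].
  apply: (@rV_compact _ _
    (fun i => `[p 0 i - (1 + `|r1|), p 0 i + (1 + `|r1|)]%classic)).
  by move=> i; exact: segment_compact.
have cont : continuous (rho p : 'rV[R]_3 -> R).
  by move=> q; exact: (smooth_cont (smooth_rho p openT)).
apply: (subclosed_compact _ cbox).
- have -> : [set q : 'rV[R]_3 | q 0 iz = p 0 iz /\ r0 <= rho p q <= r1] =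
     (fun q : 'rV[R]_3 => q 0 iz) @^-1` [set p 0 iz] `&` rho p @^-1` `[r0, r1].
    by apply/seteqP; split => q /=; rewrite in_itv.
  apply: closedI.
    by apply: closed_comp => [q _|]; [exact: coord_continuous|exact: closed_eq].
  by apply: closed_comp => [q _|]; [exact: cont|exact: interval_closed].
- move=> q /= [qz /andP[_ qr]] i.
  have r10 : 0 <= `|r1| by [].
  have r1n : r1 <= `|r1| by exact: ler_norm.
  have key : `|q 0 i - p 0 i| <= 1 + `|r1|.
    have [->|iNz] := eqVneq i iz; first by rewrite qz subrr normr0 addr_ge0.
    have : (q 0 i - p 0 i) ^+ 2 <= `|r1|.
      apply: le_trans r1n; apply: le_trans qr; rewrite /rho.
      by case: (ord3_xy iNz) => ->; rewrite ?lerDl ?lerDr sqr_ge0.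
    rewrite -[_ ^+ 2]ger0_norm ?sqr_ge0 // normrX.
    move: r10 (normr_ge0 (q 0 i - p 0 i)); move: `|r1| `|_ - _| => b x b0 x0 h.
    by rewrite leNgt; apply/negP => lt; nra.
  by rewrite in_itv /=; move: key; rewrite ler_norml => /andP[]; clear; lra.
Qed.

(** The second hypothesis says that ln S is harmonic, so ln S + L has positive Laplacian and S e^L
    has no maximum. The remaining hypotheses are the first and second order conditions at a maximum
    of S e^L, divided by e^L. *)
Lemma log_subharmonic_no_max (S Sx Sy Sxx Syy Lx Ly Lxx Lyy : R) : 0 < S ->
  S * (Sxx + Syy) = Sx ^+ 2 + Sy ^+ 2 -> 0 < Lxx + Lyy ->
  Sx + S * Lx = 0 -> Sy + S * Ly = 0 ->
  Sxx + 2 * Sx * Lx + S * Lxx + S * Lx ^+ 2 <= 0 ->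
  Syy + 2 * Sy * Ly + S * Lyy + S * Ly ^+ 2 <= 0 -> False.
Proof.
move=> S0 dS dL ex ey; have -> : Sx = - (S * Lx) by apply/eqP; rewrite -addr_eq0 ex.
have Ey : Sy = - (S * Ly) by apply/eqP; rewrite -addr_eq0 ey.
have Ex : Sx = - (S * Lx) by apply/eqP; rewrite -addr_eq0 ex.
rewrite Ey => h1 h2; rewrite Ex Ey in dS.
have h3 : S * (Sxx + Syy - S * (Lx ^+ 2 + Ly ^+ 2) + S * (Lxx + Lyy)) <= 0.
  by rewrite pmulr_rle0 //; move: h1 h2; clear; lra.
have h4 : 0 < S * (S * (Lxx + Lyy)) by rewrite !mulr_gt0.
by move: h3 h4 dS; clear; rewrite !mulrDr => h3 h4 dS; lra.
Qed.

(** * Continuation of zeros for a Cauchy-Riemann pair *)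

Section CauchyRiemann.
Variables (V : set 'rV[R]_3) (P Q : 'rV[R]_3 -> R).
Hypotheses (oV : open V) (Ps : smooth V P) (Qs : smooth V Q).
Hypothesis CR1 : forall q, V q -> partial ix P q + partial iy Q q = 0.
Hypothesis CR2 : forall q, V q -> partial iy P q = partial ix Q q.

Definition sqn q : R := P q * P q + Q q * Q q.

Lemma smooth_sqn : smooth V sqn.
Proof. by apply: smooth_add => //; exact: smooth_mul. Qed.

Lemma sqn_ge0 q : 0 <= sqn q.
Proof. by rewrite /sqn -!expr2 addr_ge0 ?sqr_ge0. Qed.

Lemma sqn_eq0 q : (sqn q == 0) = (P q == 0) && (Q q == 0).
Proof. by rewrite /sqn -!expr2 paddr_eq0 ?sqr_ge0 // !sqrf_eq0. Qed.

(* sqn is |f|^2 for the holomorphic f = P - i Q, and log |f| is harmonic. *)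
Lemma log_sqn_harmonic q : V q ->
  sqn q * (partial ix (partial ix sqn) q + partial iy (partial iy sqn) q) =
  partial ix sqn q ^+ 2 + partial iy sqn q ^+ 2.
Proof.
move=> Vq.
have d1 i x : V x -> partial i sqn x = 2 * (P x * partial i P x + Q x * partial i Q x).
  move=> Vx; apply: partial_val.
  have dP := smooth_isd i Ps Vx; have dQ := smooth_isd i Qs Vx.
  by apply: (is_derive_eq (isd_add (isd_mul dP dP) (isd_mul dQ dQ))); ring.
have d2 i : partial i (partial i sqn) q =
    2 * (partial i P q ^+ 2 + P q * partial i (partial i P) q
         + partial i Q q ^+ 2 + Q q * partial i (partial i Q) q).
  rewrite (partial_eq i oV Vq (d1 i)); apply: partial_val.
  have dP := smooth_isd i Ps Vq; have dQ := smooth_isd i Qs Vq.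
  have dP2 := smooth_isd i (smooth_partial i Ps) Vq.
  have dQ2 := smooth_isd i (smooth_partial i Qs) Vq.
  apply: (is_derive_eq (isd_mul (isd_cst q (e_ i) 2)
    (isd_add (isd_mul dP dP2) (isd_mul dQ dQ2)))).
  by move: (P q) (Q q) (partial i P q) (partial i Q q) (partial i (partial i P) q)
    (partial i (partial i Q) q) => *; ring.
have y1 x : V x -> partial iy Q x = - partial ix P x.
  by move=> Vx; apply/eqP; rewrite -addr_eq0 addrC CR1.
have hP : partial ix (partial ix P) q + partial iy (partial iy P) q = 0.
  rewrite (partial_eq iy oV Vq CR2) (schwarz iy ix oV Qs Vq).
  rewrite (partial_eq ix oV Vq y1).
  have := isd_opp (smooth_isd ix (smooth_partial ix Ps) Vq).
  by move=> /partial_val ->; rewrite subrr.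
have hQ : partial ix (partial ix Q) q + partial iy (partial iy Q) q = 0.
  rewrite (partial_eq iy oV Vq y1).
  have := isd_opp (smooth_isd iy (smooth_partial ix Ps) Vq).
  move=> /partial_val ->; rewrite (schwarz iy ix oV Ps Vq).
  by rewrite (partial_eq ix oV Vq CR2) subrr.
rewrite !d1 // !d2 y1 // CR2 // /sqn.
have {hP}-> : partial iy (partial iy P) q = - partial ix (partial ix P) q.
  by apply/eqP; rewrite -addr_eq0 addrC hP.
have {hQ}-> : partial iy (partial iy Q) q = - partial ix (partial ix Q) q.
  by apply/eqP; rewrite -addr_eq0 addrC hQ.
move: (P q) (Q q) (partial ix P q) (partial ix Q q) (partial ix (partial ix P) q)
  (partial ix (partial ix Q) q) => *.
by ring.
Qed.

(* The weights exp (k / rho) decrease outwards and k / rho is strictly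
   subharmonic, so sqn * exp (k / rho) has no interior maximum on the annulus;
   let k tend to infinity. *)
Lemma slice_continuation p (r0 r1 : R) : 0 < r0 ->
  (forall q, q 0 iz = p 0 iz -> rho p q <= r1 -> V q) ->
  (forall q, q 0 iz = p 0 iz -> rho p q <= r0 -> sqn q = 0) ->
  forall q, q 0 iz = p 0 iz -> rho p q < r1 -> sqn q = 0.
Proof.
move=> r00 inV S0 q qz qr1.
have [qr0|qr0] := leP (rho p q) r0; first exact: S0.
pose K := [set x : 'rV[R]_3 | x 0 iz = p 0 iz /\ r0 <= rho p x <= r1].
have cK : compact K := @compact_annulus p r0 r1.
have KV x : K x -> V x by move=> [xz /andP[_ xr]]; exact: inV.
have Kq : K q by split; rewrite // !ltW.
have r10 : 0 < r1 by apply: lt_trans qr1; apply: lt_trans qr0.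
(* The weight is singular on the axis through [p]; the annulus avoids it. *)
pose D := V `&` [set x | rho p x != 0].
have oD : open D.
  apply: openI => //.
  have -> : [set x | rho p x != 0] = rho p @^-1` [set~ 0].
    by apply/seteqP; split => x /=; move/eqP.
  apply: open_comp; last by rewrite openC; exact: closed_eq.
  by move=> x _; exact: (smooth_cont (smooth_rho p openT)).
have KD x : K x -> D x.
  move=> Kx; split; first exact: KV.
  by case: Kx => _ /andP[xr _] /=; rewrite gt_eqF // (lt_le_trans r00).
have DV : D `<=` V by move=> x [].
have Ss : smooth D sqn := smooth_sub_set DV smooth_sqn.
have rho0 x : D x -> rho p x != 0 by move=> [].
have Ls (k : R) : smooth D (fun x => k / rho p x).
  apply: smooth_mul => //; first exact: smooth_cst.
  by apply: smooth_inv => //; exact: smooth_rho.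
have [M [M0 MP]] : exists M, 0 <= M /\ forall x, K x -> sqn x <= M.
  have cS : {within K, continuous sqn}.
    apply: continuous_in_subspaceT => x; rewrite inE => Kx.
    exact: (smooth_cont Ss (KD _ Kx)).
  have [c cinK cmax] := EVT_max_rV (ex_intro _ q Kq) cK cS.
  exists (sqn c); split; first exact: sqn_ge0.
  by move=> x Kx; apply: cmax; rewrite inE.
(* A maximum of the weighted function on the annulus is a zero of [sqn], where the bound is trivial,
   or lies on the outer circle, where the weight is exp (k / r1). The inner circle carries only
   zeros, and the interior is excluded by subharmonicity. *)
have main (k : R) : 0 < k -> sqn q * expR (k / rho p q) <= M * expR (k / r1).
  move=> k0; pose F x := sqn x * expR (k / rho p x).
  have Fs : smooth D F by apply: smooth_mul => //; apply: smooth_exp.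
  have cF : {within K, continuous F}.
    apply: continuous_in_subspaceT => x; rewrite inE => Kx.
    exact: (smooth_cont Fs (KD _ Kx)).
  have [c cinK cmax] := EVT_max_rV (ex_intro _ q Kq) cK cF.
  have Kc : K c by rewrite inE in cinK.
  have Fqc : F q <= F c by apply: cmax; rewrite inE.
  rewrite -/(F q); apply: le_trans Fqc _.
  have [Sc0|Sc0] := eqVneq (sqn c) 0.
    by rewrite /F Sc0 mul0r mulr_ge0 // expR_ge0.
  have {}Sc0 : 0 < sqn c by rewrite lt_def Sc0 sqn_ge0.
  have [cz /andP[cr0 cr1]] := Kc.
  have {}cr0 : r0 < rho p c.
    by rewrite lt_def cr0 andbT; apply: contraTneq Sc0 => E; rewrite S0 ?ltxx // E.
  have [cr|cr] := leP r1 (rho p c).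
    have -> : F c = sqn c * expR (k / r1).
      by rewrite /F (_ : rho p c = r1) //; apply/eqP; rewrite eq_le cr1.
    by rewrite ler_pM2r ?expR_gt0 // MP.
  exfalso.
  have Dc := KD _ Kc.
  have local i : i != iz -> partial i F c = 0 /\ partial i (partial i F) c <= 0.
    move=> iNz.
    have oA : open (rho p @^-1` `]r0, r1[ : set 'rV[R]_3).
      apply: open_comp; last exact: interval_open.
      by move=> x _; exact: (smooth_cont (smooth_rho p openT)).
    have [|r rp rA] := open_cube oA (p := c) _.
      by rewrite /= in_itv /= cr0.
    apply: (max_second_derivative oD Fs rp) => t tr.
    have Kt : K (t *: e_ i + c).
      split; first by rewrite shiftE eq_sym (negbTE iNz) mulr0n add0r.
      have : cube c r (t *: e_ i + c).
        move=> j; rewrite shiftE addrK; case: eqP => _; rewrite ?mulr1n //.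
        by rewrite mulr0n normr0.
      by move=> /rA /=; rewrite in_itv /= => /andP[a b]; rewrite !ltW.
    by split; [exact: KD|apply: cmax; rewrite inE].
  have [fx fxx] := local ix isT; have [fy fyy] := local iy isT.
  have [gx gxx] := partials_mul_exp ix oD Ss (Ls k) Dc.
  have [gy gyy] := partials_mul_exp iy oD Ss (Ls k) Dc.
  have [lx lxx] := partials_inv_rho k oD rho0 Dc (isT : ix != iz).
  have [ly lyy] := partials_inv_rho k oD rho0 Dc (isT : iy != iz).
  move: gx gxx gy gyy; rewrite -/F fx fy => gx gxx gy gyy.
  have E0 := expR_gt0 (k / rho p c).
  pose L x := k / rho p x.
  apply: (log_subharmonic_no_max (Lx := partial ix L c) (Ly := partial iy L c)
    (Lxx := partial ix (partial ix L) c) (Lyy := partial iy (partial iy L) c)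
    Sc0 (log_sqn_harmonic (KV _ Kc))).
  - rewrite /L lxx lyy.
    (* In the plane k / r^2 has Laplacian 4 k / r^4, and [rho] is r^2. *)
    have -> : - k * 2 / rho p c ^+ 2 + 8 * k * (c 0 ix - p 0 ix) ^+ 2 / rho p c ^+ 3
      + (- k * 2 / rho p c ^+ 2 + 8 * k * (c 0 iy - p 0 iy) ^+ 2 / rho p c ^+ 3)
      = 4 * k / rho p c ^+ 2.
      transitivity (- k * 4 / rho p c ^+ 2 + 8 * k * rho p c / rho p c ^+ 3).
        by rewrite /rho; move: ((_ + _) ^+ 2)^-1 ((_ + _) ^+ 3)^-1 => s t; ring.
      by have := rho0 _ Dc; move: (rho p c) => s s0; field.
    by apply: divr_gt0; [exact: mulr_gt0|apply: exprn_gt0; exact: lt_trans cr0].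
  - by apply/eqP; move/esym/eqP: gx; rewrite mulf_eq0 gt_eqF.
  - by apply/eqP; move/esym/eqP: gy; rewrite mulf_eq0 gt_eqF.
  - by move: fxx; rewrite gxx pmulr_rle0.
  - by move: fyy; rewrite gyy pmulr_rle0.
apply/eqP; rewrite eq_le sqn_ge0 andbT leNgt; apply/negP => Sq.
pose d := (rho p q)^-1 - r1^-1.
have qr00 : 0 < rho p q := lt_trans r00 qr0.
have d0 : 0 < d by rewrite subr_gt0 ltf_pV2 // ?posrE.
(* After division by exp (k / r1) the weight at [q] is exp (k d), bounded below by 1 + k d. *)
have bound (k : R) : 0 < k -> sqn q * (1 + k * d) <= M.
  move=> k0; have := main k k0.
  have -> : k / rho p q = k * d + k / r1 by rewrite /d mulrBr subrK.
  rewrite expRD mulrA ler_pM2r ?expR_gt0 //; apply: le_trans.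
  by rewrite ler_pM2l // expR_ge1Dx.
(* This k makes the left side of [bound] equal to [sqn q] + M + 1, which exceeds M. *)
have k0 : 0 < (M + 1) / (sqn q * d) by rewrite divr_gt0 ?mulr_gt0 // ltr_wpDl.
have := bound _ k0; rewrite mulrDr mulr1.
have -> : sqn q * ((M + 1) / (sqn q * d) * d) = M + 1.
  have gen (a b e : R) : a != 0 -> b != 0 -> a * (e / (a * b) * b) = e.
    by move=> a0 b0; field; apply/andP.
  by apply: gen; exact: lt0r_neq0.
by move: Sq; move: (sqn q) => a a0 h; lra.
Qed.

Hypothesis cV : connected V.
Hypothesis Pz : forall q, V q -> partial iz P q = 0.
Hypothesis Qz : forall q, V q -> partial iz Q q = 0.

(** The points near which [sqn] vanishes form an open set; the cubes below show that it is also
    closed in [V]. Independence of z lets a point move vertically inside a cube to the slice where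
    [slice_continuation] applies. *)
Lemma unique_continuation : (exists2 p, V p & \near p, sqn p = 0) ->
  forall q, V q -> sqn q = 0.
Proof.
move=> [p0 Vp0 Sp0] q Vq.
suff : \near q, sqn q = 0 by move/nbhs_singleton.
move: q Vq; apply: (connected_ind cV (A := [set q | \near q, sqn q = 0])).
  by exists p0.
move=> p Vp; have [s s0 sV] := open_cube oV Vp.
(* A horizontal disc of radius 3r about a point of the cube of half-side r stays in the cube of
   half-side 4r, and it covers the slice of the small cube because (2r)^2 + (2r)^2 < (3r)^2. *)
pose r := s / 4; have r0 : 0 < r by rewrite divr_gt0.
have sE : s = 4 * r by rewrite /r mulrC divfK.
have rs x : cube p r x -> cube p s x.
  by move=> xr k; apply: lt_trans (xr k) _; rewrite sE; lra.
have [|none] := pselect (exists2 x, cube p r x & \near x, sqn x = 0); last first.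
  right; apply/nbhs_cube; exists r => // x xr _ /= xS.
  by apply: none; exists x.
move=> [x xr /near_cube[t t0 tS]]; left; apply/nbhs_cube; exists r => // y yr _.
suff S0 z : cube p r z -> sqn z = 0.
  apply: (filterS S0); apply: open_nbhs_nbhs.
  by split; [exact: cube_open|].
move=> zr.
(* The point [z] moved to the height of [x]; it remains in the small cube, and [sqn] does not
   change. *)
pose z' := (x 0 iz - z 0 iz) *: e_ iz + z : 'rV[R]_3.
have z'E i : z' 0 i = if i == iz then x 0 iz else z 0 i.
  rewrite shiftE; case: eqP => [->|_]; first by rewrite mulr1n subrK.
  by rewrite mulr0n add0r.
have z'r : cube p r z' by move=> i; rewrite z'E; case: eqP => [->|_].
have -> : sqn z = sqn z'.
  rewrite /sqn (const_axis Ps (D := V) _ _ zr z'r) => [|a /rs/sV|a /rs/sV Va];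
    [|by []|exact: Pz].
  by rewrite (const_axis Qs (D := V) _ _ zr z'r) => [|a /rs/sV|a /rs/sV Va];
    [|by []|exact: Qz].
have sqb (a b : R) : 0 < b -> a ^+ 2 <= b ^+ 2 -> `|a| <= b.
  move=> b0; rewrite -[a ^+ 2]ger0_norm ?sqr_ge0 // normrX.
  by rewrite ler_pXn2r ?nnegrE // ltW.
have rho_b (a : 'rV[R]_3) (b : R) : 0 < b -> a 0 iz = x 0 iz -> rho x a <= b ^+ 2 -> forall k,
    `|a 0 k - x 0 k| <= b.
  move=> b0 az ab k; have [->|kz] := eqVneq k iz.
    by rewrite az subrr normr0 ltW.
  apply: (sqb _ _ b0); apply: le_trans ab; rewrite /rho.
  by case: (ord3_xy kz) => ->; rewrite ?lerDl ?lerDr sqr_ge0.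
have t20 : 0 < t / 2 by rewrite divr_gt0.
have r30 : 0 < 3 * r by rewrite mulr_gt0.
apply: (@slice_continuation x ((t / 2) ^+ 2) ((3 * r) ^+ 2)).
- by rewrite exprn_gt0.
- move=> a az ar; apply: sV => k; have := rho_b a _ r30 az ar k; have := xr k.
  have := ler_distD (x 0 k) (a 0 k) (p 0 k); rewrite sE.
  by move: `|_| `|_| `|_| => *; lra.
- move=> a az ar; apply: tS => k; apply: le_lt_trans (rho_b a _ t20 az ar k) _.
  by lra.
- by rewrite z'E eqxx.
- have sq_le i : i != iz -> (z' 0 i - x 0 i) ^+ 2 <= (2 * r) ^+ 2.
    move=> iNz; rewrite -[leLHS]ger0_norm ?sqr_ge0 // normrX.
    rewrite ler_pXn2r ?nnegrE //; last by rewrite mulr_ge0 // ltW.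
    have := zr i; have := xr i; rewrite z'E (negbTE iNz).
    have := ler_distD (p 0 i) (z 0 i) (x 0 i); rewrite (distrC (p 0 i)).
    by move: `|_| `|_| `|_| => *; lra.
  have := sq_le ix isT; have := sq_le iy isT; rewrite /rho.
  have : 0 < r ^+ 2 by rewrite exprn_gt0.
  by rewrite !exprMn; move: (r ^+ 2) ((_ - _) ^+ 2) ((_ - _) ^+ 2) => *; lra.
Qed.

End CauchyRiemann.

End UniqueContinuation.

(** * Scalar consequences of the curvature conditions *)

(* Sealed copy of [partial]: comparing two different partial derivatives would
   otherwise make unification unfold both to limits. *)
HB.lock Definition pd (R : realType) (n : nat) (i : 'I_n)
  (f : 'rV[R]_n -> R) : 'rV[R]_n -> R := partial i f.

Section SealedPartial.
Context {R : realType} {n : nat}.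
Implicit Types (D : set 'rV[R]_n) (f g : 'rV[R]_n -> R) (i j : 'I_n).

Lemma pdE : @pd R n = @partial R n.
Proof. by rewrite pd.unlock. Qed.

Lemma pd_smooth D f i : smooth D f -> smooth D (pd i f).
Proof. by rewrite pdE; exact: smooth_partial. Qed.

Lemma pd_isd D f i p : smooth D f -> D p ->
  is_derive p (delta_mx 0 i) f (pd i f p).
Proof. by rewrite pdE; exact: smooth_isd. Qed.

Lemma pd_val i f p a : is_derive p (delta_mx 0 i) f a -> pd i f p = a.
Proof. by rewrite pdE; exact: partial_val. Qed.

Lemma pd_eq D i f g p : open D -> D p -> (forall q, D q -> f q = g q) ->
  pd i f p = pd i g p.
Proof. by rewrite pdE; exact: partial_eq. Qed.

Lemma pd_sym D f i j p : open D -> smooth D f -> D p ->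
  pd i (pd j f) p = pd j (pd i f) p.
Proof. by rewrite pdE; exact: schwarz. Qed.

Lemma const_connected_pd D f : open D -> connected D -> smooth D f ->
  (forall q, D q -> forall i, pd i f q = 0) -> constant_on D f.
Proof. by rewrite pdE; exact: const_connected. Qed.

End SealedPartial.

Lemma unique_continuation_pd (R : realType) (V : set 'rV[R]_3)
    (P Q : 'rV[R]_3 -> R) :
  open V -> smooth V P -> smooth V Q ->
  (forall q, V q -> pd ix P q + pd iy Q q = 0) ->
  (forall q, V q -> pd iy P q = pd ix Q q) -> connected V ->
  (forall q, V q -> pd iz P q = 0) -> (forall q, V q -> pd iz Q q = 0) ->
  (exists2 p, V p & \near p, sqn P Q p = 0) ->
  forall q, V q -> sqn P Q q = 0.
Proof. by rewrite pdE; exact: unique_continuation. Qed.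

Section ScalarConditions.
Context {R : realType}.
Variables (V : set 'rV[R]_3) (u w : 'rV[R]_3 -> R).
Implicit Types (q : 'rV[R]_3).
Hypotheses (oV : open V) (cV : connected V).
Hypotheses (us : smooth V u) (ws : smooth V w).
Hypothesis w_pos : forall q, V q -> 0 < w q.
Hypothesis w_harm : forall q, V q ->
  pd ix (pd ix w) q + pd iy (pd iy w) q = 0.

Local Notation wx := (pd ix w).
Local Notation wy := (pd iy w).
Local Notation wz := (pd iz w).

Lemma gradient_sqn_eq0 q : sqn wx wy q = 0 <-> wx q = 0 /\ wy q = 0.
Proof.
split; first by move/eqP; rewrite sqn_eq0 => /andP[/eqP -> /eqP ->].
by move=> [h1 h2]; rewrite /sqn h1 h2 mulr0 addr0.
Qed.

Let wxs : smooth V wx := pd_smooth ix ws.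
Let wys : smooth V wy := pd_smooth iy ws.
Let wzs : smooth V wz := pd_smooth iz ws.

(** Here a is w, the other letters are its derivatives, and e5 is the x-derivative of e1 plus the
    y-derivative of e2. Harmonicity removes the Laplacian terms and leaves x xz + y yz = 0;
    multiplied by a, this is the claim up to a factor 2. *)
Lemma dichotomy_algebra (a x y z xx yy xz yz xxz yyz : R) : 0 < a ->
  a * xz = 2 * (x * z) -> a * yz = 2 * (y * z) -> xx + yy = 0 ->
  xxz + yyz = 0 ->
  x * xz + a * xxz + (y * yz + a * yyz)
    = 2 * (xx * z + x * xz) + 2 * (yy * z + y * yz) ->
  z * (x * x + y * y) = 0.
Proof.
move=> a0 e1 e2 e3 e4 e5.
have e6 : x * xz + y * yz = 0.
  have : a * (xxz + yyz) = 0 by rewrite e4 mulr0.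
  have : (xx + yy) * z = 0 by rewrite e3 mul0r.
  by move: e5; lra.
have : a * (x * xz + y * yz) = 2 * (z * (x * x + y * y)).
  by rewrite mulrDr !(mulrCA a) e1 e2; ring.
by rewrite e6 mulr0; lra.
Qed.

Hypothesis Exz : forall q, V q -> w q * pd iz wx q = 2 * (wx q * wz q).
Hypothesis Eyz : forall q, V q -> w q * pd iz wy q = 2 * (wy q * wz q).

(* Exz and Eyz say that grad (1/w) does not depend on z. Taking the divergence
   of grad w_z = 2 w_z grad w / w, harmonicity leaves w_z |grad w|^2 = 0. *)
Lemma wz_sqn q : V q -> wz q * sqn wx wy q = 0.
Proof.
move=> Vq.
have dE i (h : 'rV[R]_3 -> R) : smooth V h ->
    (forall x, V x -> w x * pd iz h x = 2 * (h x * wz x)) ->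
    pd i w q * pd iz h q + w q * pd i (pd iz h) q =
    2 * (pd i h q * wz q + h q * pd i wz q).
  move=> hs E.
  have dl := isd_mul (pd_isd i ws Vq) (pd_isd i (pd_smooth iz hs) Vq).
  have dr := isd_mul (isd_cst q (delta_mx 0 i) 2)
    (isd_mul (pd_isd i hs Vq) (pd_isd i wzs Vq)).
  rewrite -(pd_val dl) (pd_eq i oV Vq E) (pd_val dr).
  by rewrite mul0r add0r.
have := dE ix wx wxs Exz; have := dE iy wy wys Eyz.
rewrite (pd_sym ix iz oV wxs Vq) (pd_sym iy iz oV wys Vq).
rewrite (pd_sym ix iz oV ws Vq) (pd_sym iy iz oV ws Vq) => dy dx.
have harm_z : pd iz (pd ix wx) q + pd iz (pd iy wy) q = 0.
  have h := isd_add (pd_isd iz (pd_smooth ix wxs) Vq)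
    (pd_isd iz (pd_smooth iy wys) Vq).
  rewrite -(pd_val h) (pd_eq iz oV Vq w_harm).
  exact: (pd_val (isd_cst _ _ _)).
apply: (dichotomy_algebra (w_pos Vq) (Exz Vq) (Eyz Vq) (w_harm Vq) harm_z).
exact: (congr2 +%R dx dy).
Qed.

(** By [wz_sqn] one of w_z and the horizontal gradient vanishes at each point, and each of them is a
    factor on the right of [Exz] and [Eyz]. *)
Lemma gradient_z_eq0 q : V q -> pd iz wx q = 0 /\ pd iz wy q = 0.
Proof.
move=> Vq; have w0 : w q != 0 by rewrite gt_eqF ?w_pos.
have /eqP := wz_sqn Vq; rewrite mulf_eq0 => /orP[/eqP z0|/eqP/gradient_sqn_eq0[x0 y0]].
  by split; apply: (mulfI w0); [rewrite Exz|rewrite Eyz]; rewrite // z0 !mulr0.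
by split; apply: (mulfI w0); [rewrite Exz // x0|rewrite Eyz // y0];
  rewrite mul0r !mulr0.
Qed.

Lemma wz_eq0 : ~ (forall q, V q -> wx q = 0 /\ wy q = 0) ->
  forall q, V q -> wz q = 0.
Proof.
move=> nK p Vp; apply/eqP; apply/negPn/negP => wzp; apply: nK => q Vq.
apply/gradient_sqn_eq0.
have cr x : V x -> pd iy wx x = pd ix wy x := pd_sym iy ix oV ws.
have xz x : V x -> pd iz wx x = 0 by case/gradient_z_eq0.
have yz x : V x -> pd iz wy x = 0 by case/gradient_z_eq0.
apply: (unique_continuation_pd oV wxs wys w_harm cr cV xz yz _ Vq).
exists p => //.
have near_ne : \near p, wz p != 0.
  have := smooth_cont wzs Vp => /cvgr_neq0; exact.
have near_V : \near p, V p by exact: open_nbhs_nbhs.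
near=> x.
have Vx : V x by near: x.
have zx : wz x != 0 by near: x.
by apply/eqP; have /eqP := wz_sqn Vx; rewrite mulf_eq0 (negbTE zx).
Unshelve. all: by end_near. Qed.

End ScalarConditions.

(** * Integration of the AK2 equations for u *)

Section ExplicitU.
Context {R : realType}.
Variables (V : set 'rV[R]_3) (u w : 'rV[R]_3 -> R).
Implicit Types (q : 'rV[R]_3).
Hypotheses (oV : open V) (us : smooth V u) (ws : smooth V w).
Hypothesis w_pos : forall q, V q -> 0 < w q.
Hypothesis w_harm : forall q, V q ->
  pd ix (pd ix w) q + pd iy (pd iy w) q = 0.
Hypothesis w_z : forall q, V q -> pd iz w q = 0.
Hypothesis u_z : forall q, V q -> pd iz u q = 0.

Local Notation wx := (pd ix w).
Local Notation wy := (pd iy w).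
Local Notation ux := (pd ix u).
Local Notation uy := (pd iy u).

(** With f = w_x - i w_y and D = d_x - i d_y, the two equations are, up to sign, the real and
    imaginary parts of 2 f' = f D(u + 3 ln w). Where f does not vanish, 2 f' / f is D ln |f|^2;
    hence the exponent 3 of w in the solution. *)
Definition hessian_eq1 q := 2 * pd ix wx q =
  wx q * ux q - wy q * uy q + 3 * (wx q ^+ 2 - wy q ^+ 2) / w q.
Definition hessian_eq2 q := 2 * pd iy wx q =
  wx q * uy q + wy q * ux q + 6 * wx q * wy q / w q.

Let wxs : smooth V wx := pd_smooth ix ws.
Let wys : smooth V wy := pd_smooth iy ws.

Lemma sqn_partial i q : V q -> pd i (sqn wx wy) q =
  2 * (wx q * pd i wx q + wy q * pd i wy q).
Proof.
move=> Vq; have dx := pd_isd i wxs Vq; have dy := pd_isd i wys Vq.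
rewrite (pd_val (isd_add (isd_mul dx dx) (isd_mul dy dy))).
by move: (wx q) (wy q) (pd i wx q) (pd i wy q) => *; ring.
Qed.

Lemma wyy q : V q -> pd iy wy q = - pd ix wx q.
Proof. by move=> Vq; apply/eqP; rewrite -addr_eq0 addrC w_harm. Qed.

Lemma mixed_z_eq0 i q : V q -> pd iz (pd i w) q = 0.
Proof.
move=> Vq; rewrite (pd_sym iz i oV ws Vq) (pd_eq i oV Vq w_z).
exact: (pd_val (isd_cst _ _ _)).
Qed.

Lemma sqn_partialsP q : V q ->
  [/\ pd ix (sqn wx wy) q = 2 * (wx q * pd ix wx q + wy q * pd iy wx q),
      pd iy (sqn wx wy) q = 2 * (wx q * pd iy wx q - wy q * pd ix wx q)
    & pd iz (sqn wx wy) q = 0].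
Proof.
move=> Vq; split; rewrite sqn_partial //.
- by rewrite (pd_sym ix iy oV ws Vq).
- by rewrite wyy // mulrN.
- by rewrite !mixed_z_eq0 // !mulr0 addr0 mulr0.
Qed.

(* The Hessian equations say exactly that this function is constant. *)
Definition invariant q := sqn wx wy q * expR (- u q) * (w q ^+ 3)^-1.

Lemma invariant_partial i q : V q -> pd i invariant q =
  expR (- u q) * (w q ^+ 3)^-1 *
    (pd i (sqn wx wy) q - sqn wx wy q * (pd i u q + 3 * pd i w q / w q)).
Proof.
move=> Vq; have w0 : w q != 0 by rewrite gt_eqF ?w_pos.
have w30 : w q ^+ 3 != 0 by rewrite expf_neq0.
have dS := pd_isd i (smooth_sqn oV wxs wys) Vq.
have h := isd_mul (isd_mul dS (isd_exp (isd_opp (pd_isd i us Vq))))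
  (isd_inv (f := fun x => w x ^+ 3) w30 (isd_exprn 2 (pd_isd i ws Vq))).
rewrite (pd_val h); move: (pd i (sqn wx wy) q) (sqn wx wy q) => s' s.
move: w0; move: (expR (- u q)) (pd i u q) (w q) (pd i w q).
by move=> a b c d c0; field.
Qed.

Lemma invariant_smooth : smooth V invariant.
Proof.
apply: smooth_mul => //.
  by apply: smooth_mul => //; [exact: smooth_sqn|apply: smooth_exp => //; exact: smooth_opp].
apply: smooth_inv => //; first by move=> q Vq; rewrite expf_neq0 // gt_eqF ?w_pos.
rewrite (_ : (fun q => w q ^+ 3) = fun q => w q * (w q * w q)).
  by apply: smooth_mul => //; exact: smooth_mul.
by apply/funext => q; ring.
Qed.

Definition explicit_log : Prop :=
  (forall q, V q -> ~ (wx q = 0 /\ wy q = 0)) /\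
  exists C, forall q, V q -> u q = ln (wx q ^+ 2 + wy q ^+ 2) - 3 * ln (w q) + C.

Lemma explicit_u_of_hessian : connected V ->
  ~ (forall q, V q -> wx q = 0 /\ wy q = 0) ->
  (forall q, V q -> hessian_eq1 q /\ hessian_eq2 q) -> explicit_log.
Proof.
move=> cV nK H.
have [c cE] : constant_on V invariant.
  apply: (const_connected_pd oV cV invariant_smooth) => q Vq i.
  rewrite invariant_partial //; have [h1 h2] := H _ Vq.
  have [sx sy sz] := sqn_partialsP Vq.
  have w0 : w q != 0 by rewrite gt_eqF ?w_pos.
  suff -> : pd i (sqn wx wy) q
      - sqn wx wy q * (pd i u q + 3 * pd i w q / w q) = 0 by rewrite mulr0.
  have [->|iNz] := eqVneq i iz.
    by rewrite sz u_z // w_z // mulr0 mul0r addr0 mulr0 subr0.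
  move: h1 h2 {sz}; rewrite /hessian_eq1 /hessian_eq2 /sqn.
  case: (ord3_xy iNz) => ->; rewrite ?sx ?sy {sx sy}; move: w0.
    move: (wx q) (wy q) (ux q) (uy q) (pd ix wx q) (pd iy wx q) (w q).
    move=> x y a b xx xy c0 c00 e1 e2.
    have -> : 2 * (x * xx + y * xy) = x * (2 * xx) + y * (2 * xy) by ring.
    by rewrite e1 e2; field.
  move: (wx q) (wy q) (ux q) (uy q) (pd ix wx q) (pd iy wx q) (w q).
  move=> x y a b xx xy c0 c00 e1 e2.
  have -> : 2 * (x * xy - y * xx) = x * (2 * xy) - y * (2 * xx) by ring.
  by rewrite e1 e2; field.
have sqnE q : V q -> sqn wx wy q = c * (expR (u q) * w q ^+ 3).
  move=> Vq; rewrite -(cE _ Vq) /invariant expRN.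
  have := w_pos Vq; have := expR_gt0 (u q).
  move: (expR _) (sqn _ _ _) (w q) => a b d /lt0r_neq0 a0 /lt0r_neq0 d0.
  by field; apply/andP.
(* |grad w|^2 is c times a positive function: a nonpositive c would make the gradient vanish
   everywhere, a positive one excludes critical points. *)
have cpos : 0 < c.
  rewrite ltNge; apply/negP => c0; apply: nK => q Vq; apply/gradient_sqn_eq0.
  apply/eqP; rewrite eq_le sqn_ge0 andbT sqnE // mulr_le0_ge0 //.
  by rewrite mulr_ge0 ?expR_ge0 // exprn_ge0 // ltW // w_pos.
have spos q : V q -> 0 < sqn wx wy q.
  by move=> Vq; rewrite sqnE // mulr_gt0 // mulr_gt0 ?expR_gt0 // exprn_gt0 // w_pos.
split=> [q Vq /gradient_sqn_eq0 E|]; first by have := spos _ Vq; rewrite E ltxx.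
exists (- ln c) => q Vq; have w0 := w_pos Vq.
have -> : wx q ^+ 2 + wy q ^+ 2 = c * (expR (u q) * w q ^+ 3).
  by rewrite -sqnE // /sqn !expr2.
rewrite lnM ?posrE // ?mulr_gt0 ?expR_gt0 ?exprn_gt0 // lnM ?posrE ?expR_gt0 ?exprn_gt0 //.
rewrite expRK lnXn // -mulr_natl.
by move: (ln c) (ln (w q)) => a b; ring.
Qed.

Lemma hessian_of_explicit_u : explicit_log ->
  forall q, V q -> hessian_eq1 q /\ hessian_eq2 q.
Proof.
move=> [S0 [C uE]] q Vq.
have spos x : V x -> 0 < sqn wx wy x.
  move=> Vx; rewrite lt_def sqn_ge0 andbT; apply/eqP => /gradient_sqn_eq0.
  exact: S0.
have {}uE x : V x -> ln (sqn wx wy x) + - (3 * ln (w x)) + C = u x.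
  by move=> Vx; rewrite uE // /sqn !expr2.
have ui i : pd i u q = pd i (sqn wx wy) q / sqn wx wy q - 3 * (pd i w q / w q).
  rewrite -(pd_eq i oV Vq uE).
  have dS := isd_ln (spos _ Vq) (pd_isd i (smooth_sqn oV wxs wys) Vq).
  have dw := isd_ln (w_pos Vq) (pd_isd i ws Vq).
  rewrite (pd_val (isd_add (isd_add dS (isd_opp (isd_mul (isd_cst q _ 3) dw)))
    (isd_cst q _ C))).
  by move: (pd i (sqn wx wy) q) (_^-1) (pd i w q) (_^-1) (ln _) => *; ring.
have [sx sy _] := sqn_partialsP Vq.
have w0 : w q != 0 by rewrite gt_eqF ?w_pos.
have s0 := lt0r_neq0 (spos _ Vq).
rewrite /hessian_eq1 /hessian_eq2 !ui sx sy; move: w0 s0; rewrite /sqn.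
move: (wx q) (wy q) (pd ix wx q) (pd iy wx q) (w q) => x y xx xy c c0 s0.
by split; field; apply/andP.
Qed.

End ExplicitU.

(** * The connection and curvature of the ansatz *)

Section Coordinates4.
Context {R : realType}.

Definition o0 : 'I_4 := @Ordinal 4 0 isT.
Definition o1 : 'I_4 := @Ordinal 4 1 isT.
Definition o2 : 'I_4 := @Ordinal 4 2 isT.
Definition o3 : 'I_4 := @Ordinal 4 3 isT.

Lemma ord4_ind (P : 'I_4 -> Prop) : P o0 -> P o1 -> P o2 -> P o3 -> forall i, P i.
Proof.
move=> h0 h1 h2 h3 [[|[|[|[|//]]]] lt].
- by rewrite (_ : Ordinal lt = o0) //; exact: val_inj.
- by rewrite (_ : Ordinal lt = o1) //; exact: val_inj.
- by rewrite (_ : Ordinal lt = o2) //; exact: val_inj.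
- by rewrite (_ : Ordinal lt = o3) //; exact: val_inj.
Qed.

Lemma sum4 (f : 'I_4 -> R) : \sum_i f i = f o0 + f o1 + f o2 + f o3.
Proof.
rewrite !big_ord_recl big_ord0 addr0 !addrA.
by congr (f _ + f _ + f _ + f _); exact: val_inj.
Qed.

Lemma lift_x : lift ord0 ix = o1. Proof. exact: val_inj. Qed.
Lemma lift_y : lift ord0 iy = o2. Proof. exact: val_inj. Qed.
Lemma lift_z : lift ord0 iz = o3. Proof. exact: val_inj. Qed.

End Coordinates4.

(** * Functions pulled back from the base *)

Section PullBack.
Context {R : realType}.
Variables (V : set 'rV[R]_3).
Hypothesis oV : open V.
Implicit Types (f : 'rV[R]_3 -> R) (p : 'rV[R]_4).

Local Notation M := (R_times V).

Lemma base_cube p r x : cube p r x -> cube (base p) r (base x).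
Proof. by move=> xr k; rewrite !mxE; exact: xr. Qed.

Lemma base_continuous p : base x @[x --> p] --> base p.
Proof.
move=> A /nbhs_cube[r r0 rA]; apply/nbhs_cube; exists r => // x /base_cube.
exact: rA.
Qed.

Lemma R_times_open : open M.
Proof.
rewrite openE => p Mp; have [r r0 rV] := open_cube oV Mp.
by apply/nbhs_cube; exists r => // x /base_cube /rV.
Qed.

Lemma base_shift0 t p : base (t *: delta_mx 0 ord0 + p) = base p.
Proof.
apply/rowP => k; rewrite [LHS]mxE shiftE [RHS]mxE.
by rewrite eq_sym (negbTE (neq_lift _ _)) mulr0n add0r.
Qed.

Lemma base_shift t i p : base (t *: delta_mx 0 (lift ord0 i) + p) =
  t *: delta_mx 0 i + base p.
Proof.
apply/rowP => k; rewrite [LHS]mxE !shiftE [base p 0 k]mxE.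
by rewrite (inj_eq lift_inj).
Qed.

Lemma isd_pull0 f p : is_derive p (delta_mx 0 ord0) (fun x => f (base x)) 0.
Proof.
have E : (fun h : R => h^-1 *: (((fun x => f (base x)) \o shift p)
    (h *: delta_mx 0 ord0) - f (base p))) = fun=> 0.
  by apply/funext => h /=; rewrite base_shift0 subrr scaler0.
by split; rewrite /derivable /derive E; [exact: is_cvg_cst|exact: lim_cst].
Qed.

Lemma isd_pull f p i a : is_derive (base p) (delta_mx 0 i) f a ->
  is_derive p (delta_mx 0 (lift ord0 i)) (fun x => f (base x)) a.
Proof.
move=> [fd fv].
have E : (fun h : R => h^-1 *: ((f \o shift (base p)) (h *: delta_mx 0 i) - f (base p)))
  = (fun h : R => h^-1 *: (((fun x => f (base x)) \o shift p)
    (h *: delta_mx 0 (lift ord0 i)) - f (base p))).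
  by apply/funext => h /=; rewrite base_shift.
by split; [rewrite /derivable -E|rewrite -fv /derive E].
Qed.

Definition dpull (g : 'I_3 -> R) (i : 'I_4) : R :=
  if unlift ord0 i is Some j then g j else 0.

Lemma isd_pull_smooth f p i : smooth V f -> M p ->
  is_derive p (delta_mx 0 i) (fun x => f (base x)) (dpull (fun j => pd j f (base p)) i).
Proof.
move=> fs Mp; rewrite /dpull; case: unliftP => [j ->|->].
  by apply: isd_pull; exact: (pd_isd j fs).
exact: isd_pull0.
Qed.

Lemma smooth_pull f : smooth V f -> smooth M (fun x => f (base x)).
Proof.
move=> fs k; elim: k f fs => [|k IHk] f fs.
all: have cf : {in M, continuous (fun x => f (base x))}
  by move=> p; rewrite inE => Mp;
    exact: (continuous_comp (base_continuous (p := p)) (smooth_cont fs Mp)).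
  by split.
apply: CkS => //; first exact: R_times_open.
move=> i; exists (fun x => dpull (fun j => pd j f (base x)) i).
  by move=> p Mp; exact: isd_pull_smooth.
rewrite /dpull; case: unliftP => [j _|_]; last exact: (Ck_cst _ _ R_times_open).
by apply: IHk; exact: pd_smooth.
Qed.

End PullBack.

(* The connection coefficients of the frame dual to (omega / w, dx, dy, dz) for
   the metric diag (w, a, a, w) on it, a = e^u w, when a_z = 0: each is c * n / d
   with n, d among w, a and their first derivatives. *)
Inductive jet := W | A | Wx | Wy | Wz | Ax | Ay.

Section ConnectionTable.
Context {R : realType}.

Definition conn_table : seq (seq (seq (R * jet * jet))) :=
  let h := 2^-1 in let Z := (0, W, W) in
  [:: [:: [:: Z; (h, Wx, A); (h, Wy, A); (h, Wz, W)];
          [:: (- h, Wx, W); Z; Z; (- h, Wy, W)];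
          [:: (- h, Wy, W); Z; Z; (h, Wx, W)];
          [:: (- h, Wz, W); (h, Wy, A); (- h, Wx, A); Z]];
      [:: [:: (h, Wx, W); Z; Z; (- h, Wy, W)];
          [:: Z; (h, Ax, A); (- h, Ay, A); Z];
          [:: Z; (h, Ay, A); (h, Ax, A); Z];
          [:: (h, Wy, W); Z; Z; (h, Wx, W)]];
      [:: [:: (h, Wy, W); Z; Z; (h, Wx, W)];
          [:: Z; (h, Ay, A); (h, Ax, A); Z];
          [:: Z; (- h, Ax, A); (h, Ay, A); Z];
          [:: (- h, Wx, W); Z; Z; (h, Wy, W)]];
      [:: [:: (h, Wz, W); (h, Wy, A); (- h, Wx, A); Z];
          [:: (- h, Wy, W); Z; Z; (h, Wx, W)];
          [:: (h, Wx, W); Z; Z; (h, Wy, W)];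
          [:: Z; (- h, Wx, A); (- h, Wy, A); (h, Wz, W)]]].

Definition conn_entry (c a b : nat) : R * jet * jet :=
  nth (0, W, W) (nth [::] (nth [::] conn_table c) a) b.

Definition frame_metric (b : nat) : jet := nth W [:: W; A; A; W] b.

Variables (v : jet -> R) (dv : nat -> jet -> R).

Definition Bv c a b : R := let t := conn_entry c a b in t.1.1 * v t.1.2 / v t.2.

Definition dBv (i : nat) c a b : R := let t := conn_entry c a b in
  t.1.1 * (dv i t.1.2 / v t.2 - v t.1.2 * dv i t.2 / v t.2 ^+ 2).

(** An entry of the frame curvature computed from the table, with natural numbers as indices so that
    lookups reduce. *)
Definition curv_entry c d a b : R :=
  dBv c d a b - dBv d c a b
  + \sum_(m < 4) (Bv d a m * Bv c m b - Bv c a m * Bv d m b)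
  + \sum_(m < 4) (Bv d c m - Bv c d m) * Bv m a b.

(** The (i, j) Pluecker coordinate of the 2-vector e_c wedge e_d. *)
Definition pl (i j c d : nat) : R :=
  if (c == i) && (d == j) then 1 else if (c == j) && (d == i) then -1 else 0.

(** These are the values of [curv_coef] at the indices in their names. In [R0202] harmonicity has
    replaced w_yy by - w_xx. *)
Definition R0101 : R := - (dv 1 Wx) / 2 + (v Wx * v Ax - v Wy * v Ay) / (4 * v A)
  + (3 * v Wx ^+ 2 - v Wy ^+ 2) / (4 * v W).
Definition R0202 : R := dv 1 Wx / 2 - (v Wx * v Ax - v Wy * v Ay) / (4 * v A)
  + (3 * v Wy ^+ 2 - v Wx ^+ 2) / (4 * v W).
Definition R0102 : R := - (dv 2 Wx) / 2 + (v Wx * v Ay + v Wy * v Ax) / (4 * v A)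
  + v Wx * v Wy / v W.
Definition R0103 : R := - (dv 3 Wx) / 2 + v Wx * v Wz / v W.
Definition R0203 : R := - (dv 3 Wy) / 2 + v Wy * v Wz / v W.
Definition R0303 : R := - (dv 3 Wz) / 2 - (v Wx ^+ 2 + v Wy ^+ 2) / (2 * v A)
  + v Wz ^+ 2 / v W.
Definition R0312 : R := - (v Wx ^+ 2 + v Wy ^+ 2) / (2 * v W).
Definition R1212 : R := (dv 1 Ax + dv 2 Ay) / 2 - (v Ax ^+ 2 + v Ay ^+ 2) / (2 * v A).

(* A quadratic form on 2-vectors: U = p01 + p23 and V = p02 - p13 span the
   J-anti-invariant ones, p03 and p12 are J-invariant. *)
Definition curv_form (U1 V1 x1 y1 U2 V2 x2 y2 : R) : R :=
  R0101 * (U1 * U2) + R0202 * (V1 * V2) + R0102 * (U1 * V2 + V1 * U2)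
  + R0103 * (U1 * x2 + x1 * U2) + R0203 * (V1 * x2 + x1 * V2)
  + R0303 * (x1 * x2) + R0312 * (x1 * y2 + y1 * x2) + R1212 * (y1 * y2).

Definition curv_coef c d a b : R :=
  curv_form (pl 0 1 c d + pl 2 3 c d) (pl 0 2 c d - pl 1 3 c d)
    (pl 0 3 c d) (pl 1 2 c d)
    (pl 0 1 a b + pl 2 3 a b) (pl 0 2 a b - pl 1 3 a b)
    (pl 0 3 a b) (pl 1 2 a b).

(** The frame components of d(omega / w) = d omega / w - (dw / w) wedge (omega / w) when a_z = 0. No
    other coframe form contributes torsion terms, as dx, dy and dz are closed. *)
Definition torsion_coef (c d : nat) : R :=
  v Wx / v W * (pl 2 3 c d - pl 1 0 c d) + v Wy / v W * (pl 3 1 c d - pl 2 0 c d)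
  - v Wz / v W * pl 3 0 c d.

Hypotheses (w0 : v W != 0) (a0 : v A != 0).

Lemma torsion_table (c d b : 'I_4) :
  Bv d c b - Bv c d b = if b == o0 then torsion_coef c d else 0.
Proof.
move: w0 a0; rewrite /Bv /torsion_coef /pl.
elim/ord4_ind: c; elim/ord4_ind: d; elim/ord4_ind: b => /=;
  move: (v W) (v A) (v Wx) (v Wy) (v Wz) (v Ax) (v Ay) => b1 b2 *; field;
  apply/and3P || apply/andP || idtac; by [].
Qed.

Hypothesis dv0 : forall j, dv 0 j = 0.
Hypotheses (dW1 : dv 1 W = v Wx) (dW2 : dv 2 W = v Wy) (dW3 : dv 3 W = v Wz).
Hypotheses (dA1 : dv 1 A = v Ax) (dA2 : dv 2 A = v Ay) (dA3 : dv 3 A = 0).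
Hypotheses (dWyy : dv 2 Wy = - dv 1 Wx) (dWxy : dv 1 Wy = dv 2 Wx).
Hypotheses (dWxz : dv 1 Wz = dv 3 Wx) (dWyz : dv 2 Wz = dv 3 Wy).
Hypotheses (dAxy : dv 1 Ay = dv 2 Ax) (dAxz : dv 3 Ax = 0) (dAyz : dv 3 Ay = 0).

Lemma metric_table (c a b : 'I_4) :
  (a == b)%:R * dv c (frame_metric a) =
  Bv c a b * v (frame_metric b) + v (frame_metric a) * Bv c b a.
Proof.
move: w0 a0; rewrite /Bv.
elim/ord4_ind: c; elim/ord4_ind: a; elim/ord4_ind: b => /=;
  rewrite ?dv0 ?dW1 ?dW2 ?dW3 ?dA1 ?dA2 ?dA3 ?mul1r ?mul0r;
  move: (v W) (v A) (v Wx) (v Wy) (v Wz) (v Ax) (v Ay) => b1 b2 *; field;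
  apply/and3P || apply/andP || idtac; by [].
Qed.

Lemma curv_entryC c d a b : curv_entry d c a b = - curv_entry c d a b.
Proof.
rewrite /curv_entry !opprD opprK -!sumrN; congr (_ + _ + _).
- by rewrite addrC.
- by apply: eq_bigr => m _; move: (Bv d a m) (Bv c m b) (Bv c a m) (Bv d m b) => *; ring.
- by apply: eq_bigr => m _; move: (Bv d c m) (Bv c d m) (Bv m a b) => *; ring.
Qed.

Lemma plC i j c d : i != j -> pl i j d c = - pl i j c d.
Proof.
move=> ij; rewrite /pl [(d == i) && _]andbC [(d == j) && _]andbC.
case: (boolP ((c == j) && (d == i))) => [/andP[/eqP -> /eqP ->]|_].
  by rewrite (eq_sym j) (negbTE ij) /= opprK.
by case: ifP => _; rewrite ?oppr0.
Qed.

Lemma curv_coefC c d a b : curv_coef d c a b = - curv_coef c d a b.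
Proof.
rewrite /curv_coef !(plC c d) // /curv_form.
move: (pl 0 1 c d) (pl 2 3 c d) (pl 0 2 c d) (pl 1 3 c d) (pl 0 3 c d) (pl 1 2 c d).
move: (pl 0 1 a b) (pl 2 3 a b) (pl 0 2 a b) (pl 1 3 a b) (pl 0 3 a b) (pl 1 2 a b).
move: R0101 R0202 R0102 R0103 R0203 R0303 R0312 R1212 => *; ring.
Qed.

(** Lowering the last index exposes the symmetry between the two index pairs, which lets all entries
    fit one quadratic form. *)
Lemma curv_table (c d a b : 'I_4) :
  curv_entry c d a b * v (frame_metric b) = curv_coef c d a b.
Proof.
(* Antisymmetry in the first pair leaves six pairs out of sixteen for the case analysis. *)
wlog : c d / (c < d)%N.
  move=> h; have [cd|dc|/val_inj ->] := ltngtP c d; first exact: h.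
    by rewrite curv_entryC curv_coefC mulNr h.
  have z (x : R) : x = - x -> x = 0 by move=> e; lra.
  by rewrite (z _ (curv_entryC d d a b)) (z _ (curv_coefC d d a b)) mul0r.
rewrite /curv_entry !sum4 /dBv /Bv /curv_coef /curv_form /pl.
move: w0 a0.
elim/ord4_ind: c; elim/ord4_ind: d => //= => w0' a0' _;
elim/ord4_ind: a; elim/ord4_ind: b => /=;
  rewrite /R0101 /R0202 /R0102 /R0103 /R0203 /R0303 /R0312 /R1212
    ?dv0 ?dWyy ?dWxy ?dWxz ?dWyz ?dAxy ?dAxz ?dAyz ?dW1 ?dW2 ?dW3 ?dA1 ?dA2 ?dA3;
  move: w0' a0';
  move: (v W) (v A) (v Wx) (v Wy) (v Wz) (v Ax) (v Ay) (dv 1 Wx) (dv 2 Wx)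
   (dv 3 Wx) (dv 3 Wy) (dv 3 Wz) (dv 1 Ax) (dv 2 Ax) (dv 2 Ay) => b1 b2 *; field;
  apply/and3P || apply/andP || idtac; by [].
Qed.

End ConnectionTable.

(** * The frame of the ansatz satisfies the structure equations *)

Section AnsatzFrame.
Context {R : realType}.
Variables (V : set 'rV[R]_3) (u w : 'rV[R]_3 -> R) (omega : 'rV[R]_4 -> 'rV[R]_4).
Hypotheses (oV : open V) (us : smooth V u) (ws : smooth V w).
Hypothesis w_pos : forall q, V q -> 0 < w q.
Hypothesis omegas : smooth_vec (R_times V) omega.
Hypothesis omega0 : forall p, R_times V p -> omega p 0 ord0 != 0.
Hypothesis d_omega : forall p, R_times V p ->
  ext_d omega p = curvature_form u w (base p).

Local Notation M := (R_times V).
Implicit Types (p : 'rV[R]_4) (q : 'rV[R]_3) (j : jet).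

Definition jetf j : 'rV[R]_3 -> R :=
  match j with
  | W => w | A => euw u w | Wx => pd ix w | Wy => pd iy w | Wz => pd iz w
  | Ax => pd ix (euw u w) | Ay => pd iy (euw u w)
  end.

Definition jetv q j : R := jetf j q.
(** The index is that of a frame vector. The vector e_0 is tangent to the R-factor and kills
    functions of the base point; e_1, e_2 and e_3 project to the coordinate fields. *)
Definition djetv q (i : nat) j : R :=
  match i with
  | 1 => pd ix (jetf j) q | 2 => pd iy (jetf j) q | 3 => pd iz (jetf j) q
  | _ => 0
  end.

Arguments jetv : simpl never.
Arguments djetv : simpl never.

Lemma dpullE j q (i : 'I_4) : dpull (fun k => pd k (jetf j) q) i = djetv q i j.
Proof.
rewrite /dpull /djetv; elim/ord4_ind: i => /=.
- by case: unliftP => // k /(congr1 val).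
- by rewrite -lift_x liftK.
- by rewrite -lift_y liftK.
- by rewrite -lift_z liftK.
Qed.

Lemma a_smooth : smooth V (euw u w).
Proof. by apply: smooth_mul => //; exact: smooth_exp. Qed.

Lemma jet_smooth j : smooth V (jetf j).
Proof. by case: j => //=; do ?apply: pd_smooth; do ?exact: a_smooth. Qed.

Lemma a_pos q : V q -> 0 < euw u w q.
Proof. by move=> Vq; rewrite mulr_gt0 ?expR_gt0 ?w_pos. Qed.

Lemma jetW0 q : V q -> jetv q W != 0.
Proof. by move=> /w_pos/lt0r_neq0. Qed.

Lemma jetA0 q : V q -> jetv q A != 0.
Proof. by move=> /a_pos/lt0r_neq0. Qed.

Let oM : open M := R_times_open oV.

Lemma isd_jet j (i : 'I_4) p : M p ->
  is_derive p (delta_mx 0 i) (fun x => jetv (base x) j) (djetv (base p) i j).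
Proof.
by move=> Mp; rewrite -dpullE; exact: (isd_pull_smooth i (jet_smooth j) Mp).
Qed.

Lemma jet_pull_smooth j : smooth M (fun x => jetv (base x) j).
Proof. exact: (smooth_pull oV (jet_smooth j)). Qed.

Definition Qf p : 'M[R]_4 := \matrix_(k, b)
  if b == o0 then omega p 0 k / jetv (base p) W else (k == b)%:R.
(** The rows are the frame: the vertical vector (w / omega_0) d_0 and the horizontal lifts d_a -
    (omega_a / omega_0) d_0, which exist because [omega] does not vanish on the R-factor. *)
Definition Ff p : 'M[R]_4 := \matrix_(a, k)
  if a == o0 then (if k == o0 then jetv (base p) W / omega p 0 o0 else 0)
  else if k == o0 then - (omega p 0 a / omega p 0 o0) else (a == k)%:R.
Definition Gf p : 'M[R]_4 := \matrix_(a, b)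
  ((a == b)%:R * jetv (base p) (frame_metric a)).
Definition Bf (c : 'I_4) p : 'M[R]_4 := \matrix_(a, b) Bv (jetv (base p)) c a b.
Definition EBf (c d : 'I_4) p : 'M[R]_4 :=
  \matrix_(a, b) dBv (jetv (base p)) (djetv (base p)) c d a b.
(** The fundamental form is w (omega / w) wedge dz + a dx wedge dy, and the frame metric is diag (w,
    a, a, w); hence e_0 goes to e_3 and e_1 to e_2. *)
Definition J0 : 'M[R]_4 :=
  \matrix_(a, b) (pl 0 3 a b + pl 1 2 a b).

Lemma QfE p k b : Qf p k b =
  if b == o0 then omega p 0 k / jetv (base p) W else (k == b)%:R.
Proof. by rewrite mxE. Qed.
Lemma GfE p a b : Gf p a b = (a == b)%:R * jetv (base p) (frame_metric a).
Proof. by rewrite mxE. Qed.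
Lemma BfE c p a b : Bf c p a b = Bv (jetv (base p)) c a b.
Proof. by rewrite mxE. Qed.
Lemma EBfE c d p a b : EBf c d p a b = dBv (jetv (base p)) (djetv (base p)) c d a b.
Proof. by rewrite mxE. Qed.

Lemma omega_o0 p : M p -> omega p 0 o0 != 0.
Proof. by move=> /omega0; rewrite (_ : ord0 = o0) //; exact: val_inj. Qed.

Lemma isd_Qf0 i k p : M p -> is_derive p (delta_mx 0 i) (fun x => Qf x k o0)
  (partial i (fun x => omega x 0 k) p / jetv (base p) W
   - omega p 0 k * djetv (base p) i W / jetv (base p) W ^+ 2).
Proof.
move=> Mp; under eq_fun do rewrite QfE eqxx.
have h := isd_mul (smooth_isd i (omegas k) Mp)
  (isd_inv (f := fun x => jetv (base x) W) (jetW0 Mp) (isd_jet W i Mp)).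
by apply: (is_derive_eq h); rewrite mulNr mulrN mulrA.
Qed.

Lemma Qf_smooth : smooth_mx M Qf.
Proof.
move=> k b; under eq_fun do rewrite QfE; case: eqP => _; last exact: smooth_cst.
apply: smooth_mul => //; apply: smooth_inv => //; last exact: jet_pull_smooth.
by move=> p; exact: jetW0.
Qed.

Lemma inv_omega_smooth : smooth M (fun p => (omega p 0 o0)^-1).
Proof. by apply: smooth_inv => // p; exact: omega_o0. Qed.

Lemma Ff_smooth : smooth_mx M Ff.
Proof.
move=> a k; rewrite /Ff; under eq_fun do rewrite mxE.
case: eqP => _; case: eqP => _; do ?exact: smooth_cst.
  by apply: smooth_mul => //; [exact: jet_pull_smooth|exact: inv_omega_smooth].
by apply: smooth_opp => //; apply: smooth_mul => //; exact: inv_omega_smooth.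
Qed.

Lemma FQf p : M p -> Ff p *m Qf p = 1%:M.
Proof.
move=> Mp; have w0 := jetW0 Mp; have o00 := omega_o0 Mp.
apply/matrixP => a b; rewrite mx_mulE sum4 !QfE /Ff !mxE.
move: w0 o00; elim/ord4_ind: a; elim/ord4_ind: b => /=;
  move: (jetv _ _) (omega p 0 o0) (omega p 0 o1) (omega p 0 o2) (omega p 0 o3);
  move=> d x0 x1 x2 x3 d0 x00; rewrite ?mulr1n ?mulr0n; field;
  apply/andP || idtac; by [].
Qed.

Lemma Gf_smooth : smooth_mx M Gf.
Proof.
move=> a b; under eq_fun do rewrite GfE.
by apply: smooth_mul => //; [exact: smooth_cst|exact: jet_pull_smooth].
Qed.

Lemma entry_den c a b : (conn_entry c a b : R * jet * jet).2 = W \/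
  (conn_entry c a b : R * jet * jet).2 = A.
Proof.
by case: c => [|[|[|[|c]]]]; case: a => [|[|[|[|a]]]]; case: b => [|[|[|[|b]]]];
  rewrite /conn_entry /= ?nth_nil; auto.
Qed.

Lemma entry_den_neq0 q c a b : V q ->
  jetv q (conn_entry c a b : R * jet * jet).2 != 0.
Proof.
by move=> Vq; case: (entry_den c a b) => ->; [exact: jetW0|exact: jetA0].
Qed.

Lemma Bf_smooth c : smooth_mx M (Bf c).
Proof.
move=> a b; under eq_fun do rewrite BfE; rewrite /Bv.
apply: smooth_mul => //; last first.
  apply: smooth_inv => //; last exact: jet_pull_smooth.
  by move=> p; exact: entry_den_neq0.
by apply: smooth_mul => //; [exact: smooth_cst|exact: jet_pull_smooth].
Qed.

Lemma Gf_sym p : M p -> (Gf p)^T = Gf p.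
Proof.
move=> _; apply/matrixP => a b; rewrite mx_trE !GfE eq_sym.
by case: eqP => [->|_] //; rewrite !mul0r.
Qed.

Lemma Gf_unit p : M p -> Gf p \in unitmx.
Proof.
move=> Mp; have [w0 a0] := (jetW0 Mp, jetA0 Mp).
pose G' : 'M[R]_4 := \matrix_(a, b) ((a == b)%:R / jetv (base p) (frame_metric a)).
suff /mulmx1_unit[] : Gf p *m G' = 1%:M by [].
apply/matrixP => a b; rewrite mx_mulE sum4 !GfE /G' !mxE.
elim/ord4_ind: a; elim/ord4_ind: b => /=; rewrite ?(mul0r, mulr0, addr0, add0r, mul1r, div1r) //;
  exact: mulfV.
Qed.

(** This passes from frame to coordinate derivatives of functions of the base point: the
    coefficients of [omega] sit in column 0, which multiplies a zero derivative. *)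
Lemma sum_Qf p (h : nat -> R) (i : 'I_4) : h 0%N = 0 ->
  \sum_c Qf p i c * h c = h i.
Proof.
move=> h0; rewrite sum4 !QfE /= h0 mulr0 add0r.
by elim/ord4_ind: i => /=; rewrite ?h0 !(mul0r, mul1r) ?addr0 ?add0r.
Qed.

Lemma djetv0 q j : djetv q 0 j = 0. Proof. by []. Qed.

Lemma EBf_E i d p : M p -> partial_mx i (Bf d) p = \sum_c Qf p i c *: EBf c d p.
Proof.
move=> Mp; apply/matrixP => a b; rewrite partial_mxE summxE.
under [RHS]eq_bigr do rewrite mx_scaleE EBfE.
rewrite (sum_Qf p (h := fun c => dBv (jetv (base p)) (djetv (base p)) c d a b)).
  under eq_fun do rewrite BfE; rewrite /Bv /dBv.
  have den0 := entry_den_neq0 d a b (Mp : V (base p)).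
  move: (conn_entry _ _ _) den0 => [[c m] n] /= den0.
  have h := isd_mul (isd_mul (isd_cst p (delta_mx 0 i) c) (isd_jet m i Mp))
    (isd_inv (f := fun x => jetv (base x) n) den0 (isd_jet n i Mp)).
  rewrite (partial_val h); move: den0.
  move: (jetv _ n) (jetv _ m) (djetv _ _ n) (djetv _ _ m) => *; field.
  by [].
by rewrite /dBv !djetv0 !(mul0r, mulr0) subrr mulr0.
Qed.

Lemma d_omegaE p i k : M p ->
  partial i (fun x => omega x 0 k) p - partial k (fun x => omega x 0 i) p =
  jetv (base p) Wx * pl 2 3 i k + jetv (base p) Wy * pl 3 1 i k
  + pd iz (euw u w) (base p) * pl 1 2 i k.
Proof.
move=> Mp; have := d_omega Mp => /matrixP /(_ i k); rewrite mxE => ->.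
rewrite /curvature_form -pdE !(mx_addE, mx_scaleE) /wedge.
rewrite -[pd ix w _]/(jetv (base p) Wx) -[pd iy w _]/(jetv (base p) Wy).
move: (jetv _ _) (jetv _ _) (pd _ _ _) => x y z.
rewrite !mxE /= !lift_x !lift_y !lift_z /pl.
by elim/ord4_ind: i; elim/ord4_ind: k => /=; ring.
Qed.

Section AlmostKaehler.
Hypothesis az : forall q, V q -> pd iz (euw u w) q = 0.
Hypothesis harm : forall q, V q -> pd ix (pd ix w) q + pd iy (pd iy w) q = 0.

Lemma torsion_f i k b p : M p ->
  partial_mx i Qf p k b - partial_mx k Qf p i b
  = \sum_c \sum_d Qf p i c * Qf p k d * (Bf d p c b - Bf c p d b).
Proof.
move=> Mp; have Vp : V (base p) := Mp.
under [RHS]eq_bigr => c _ do under eq_bigr => d _ do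
  rewrite !BfE (torsion_table (jetW0 Vp) (jetA0 Vp)).
rewrite !partial_mxE; case: eqP => [->|bN0]; last first.
  rewrite big1 => [|c _]; last by rewrite big1 // => d _; rewrite mulr0.
  have cst m l : partial m (fun x => Qf x l b) p = 0.
    apply: partial_val; under eq_fun do rewrite QfE (introF eqP bN0).
    exact: isd_cst.
  by rewrite !cst subrr.
rewrite (partial_val (isd_Qf0 i k Mp)) (partial_val (isd_Qf0 k i Mp)).
have -> (x y x' y' : R) : x / jetv (base p) W - y - (x' / jetv (base p) W - y')
   = (x - x') / jetv (base p) W - (y - y') by ring.
rewrite d_omegaE // az // mul0r addr0 !sum4 !QfE.
have W1 i' : djetv (base p) i' W = match i' with 1 => jetv (base p) Wx
  | 2 => jetv (base p) Wy | 3 => jetv (base p) Wz | _ => 0 end.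
  by case: i' => [|[|[|[|]]]].
rewrite !W1 /torsion_coef /pl; move: (jetW0 Vp).
move: (jetv _ W) (jetv _ Wx) (jetv _ Wy) (jetv _ Wz) => d x y z d0.
elim/ord4_ind: i; elim/ord4_ind: k => /=;
  move: (omega p 0 o0) (omega p 0 o1) (omega p 0 o2) (omega p 0 o3) => x0 x1 x2 x3;
  field; by [].
Qed.

Lemma mul_Gf m (X : 'M[R]_(m, 4)) p a b :
  (X *m Gf p) a b = X a b * jetv (base p) (frame_metric b).
Proof.
rewrite mx_mulE sum4 !GfE.
by elim/ord4_ind: b => /=; rewrite ?mulr1n ?mulr0n ?(mul1r, mul0r, mulr0, addr0, add0r).
Qed.

Lemma frame_connE i p a b : frame_conn Qf Bf i p a b =
  \sum_c Qf p i c * Bv (jetv (base p)) c a b.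
Proof.
by rewrite summxE; apply: eq_bigr => c _; rewrite mx_scaleE BfE.
Qed.

Section Jets.
Variables (q : 'rV[R]_3).
Hypothesis Vq : V q.

Lemma djet_A3 : djetv q 3 A = 0.
Proof. exact: az. Qed.
Lemma djet_Wyy : djetv q 2 Wy = - djetv q 1 Wx.
Proof. by apply/eqP; rewrite -addr_eq0 addrC; apply/eqP; exact: harm. Qed.
Lemma djet_Wxy : djetv q 1 Wy = djetv q 2 Wx.
Proof. exact: (pd_sym ix iy oV ws Vq). Qed.
Lemma djet_Wxz : djetv q 1 Wz = djetv q 3 Wx.
Proof. exact: (pd_sym ix iz oV ws Vq). Qed.
Lemma djet_Wyz : djetv q 2 Wz = djetv q 3 Wy.
Proof. exact: (pd_sym iy iz oV ws Vq). Qed.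
Lemma djet_Axy : djetv q 1 Ay = djetv q 2 Ax.
Proof. exact: (pd_sym ix iy oV a_smooth Vq). Qed.
Lemma mixed_az k : pd iz (pd k (euw u w)) q = 0.
Proof.
rewrite (pd_sym iz k oV a_smooth Vq) (pd_eq k oV Vq az).
exact: (pd_val (isd_cst _ _ _)).
Qed.
Lemma djet_Axz : djetv q 3 Ax = 0.
Proof. exact: mixed_az. Qed.
Lemma djet_Ayz : djetv q 3 Ay = 0.
Proof. exact: mixed_az. Qed.

End Jets.

Lemma metric_f i p : M p -> partial_mx i Gf p =
  frame_conn Qf Bf i p *m Gf p + Gf p *m (frame_conn Qf Bf i p)^T.
Proof.
move=> Mp; have Vp : V (base p) := Mp; apply/matrixP => a b.
rewrite mx_addE -{2}(Gf_sym Mp) -trmx_mul mx_trE !mul_Gf !frame_connE partial_mxE.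
under eq_fun do rewrite GfE.
have h := isd_mul (isd_cst p (delta_mx 0 i) ((a == b)%:R : R))
  (isd_jet (frame_metric a) i Mp).
rewrite (partial_val h) mul0r add0r !big_distrl -big_split /=.
rewrite -(sum_Qf p (h := fun c => (a == b)%:R * djetv (base p) c (frame_metric a)));
  last by rewrite djetv0 mulr0.
apply: eq_bigr => c _.
rewrite (metric_table (jetW0 Vp) (jetA0 Vp) (djetv0 _) erefl erefl erefl erefl erefl
  (djet_A3 Vp)) mulrDr; congr (_ + _); first by rewrite mulrA.
by rewrite [_ * Bv _ c b a]mulrC mulrA.
Qed.

End AlmostKaehler.

Lemma metric_frame p : M p -> metric u w omega p = Qf p *m Gf p *m (Qf p)^T.
Proof.
move=> Mp; have w0 := jetW0 Mp; apply/matrixP => i k.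
rewrite mx_mulE sum4 !mx_trE !mul_Gf !QfE /metric !(mx_addE, mx_scaleE).
rewrite -[euw u w _]/(jetv (base p) A) -[w _]/(jetv (base p) W) /sq !mx_mulE.
rewrite !big_ord1 !mx_trE /dx /dy /dz /dcoord lift_x lift_y lift_z.
move: w0; rewrite !mxE eqxx /=; move: (jetv _ W) (jetv _ A) => d a d0.
by elim/ord4_ind: i; elim/ord4_ind: k => /=; rewrite ?mulr1n ?mulr0n;
  move: (omega p 0 o0) (omega p 0 o1) (omega p 0 o2) (omega p 0 o3) => x0 x1 x2 x3;
  field.
Qed.

Lemma Omega_frame p : M p ->
  Omega_J u w omega p = Qf p *m (J0 *m Gf p) *m (Qf p)^T.
Proof.
move=> Mp; have w0 := jetW0 Mp; apply/matrixP => i k.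
rewrite mx_mulE sum4 !mx_trE !mx_mulE !sum4 !mul_Gf !QfE /Omega_J.
rewrite mx_addE mx_oppE mx_scaleE /wedge /dx /dy /dz /dcoord lift_x lift_y lift_z.
rewrite -[euw u w _]/(jetv (base p) A) /J0 /pl.
move: w0; rewrite !mxE eqxx /=; move: (jetv _ W) (jetv _ A) => d a d0.
by elim/ord4_ind: i; elim/ord4_ind: k => /=; rewrite ?mulr1n ?mulr0n;
  move: (omega p 0 o0) (omega p 0 o1) (omega p 0 o2) (omega p 0 o3) => x0 x1 x2 x3;
  field.
Qed.

Lemma metric_smooth : smooth_mx M (metric u w omega).
Proof.
move=> i k; apply: (smooth_eq oM (f := fun x => (Qf x *m Gf x *m (Qf x)^T) i k)).
  by move=> p Mp; rewrite metric_frame.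
apply: (smooth_mx_mul oM (smooth_mx_mul oM Qf_smooth Gf_smooth)).
exact: smooth_mx_tr Qf_smooth.
Qed.

Lemma metric_riemannian : riemannian M (metric u w omega).
Proof.
split; first exact: metric_smooth.
move=> p; rewrite inE => Mp; split.
  by rewrite metric_frame // !trmx_mul trmxK Gf_sym // mulmxA.
move=> X X0; rewrite /inner metric_frame // !mulmxA -(mulmxA _ _ X^T) -trmx_mul.
have xi0 : X *m Qf p != 0.
  apply: contraNneq X0 => E.
  have := mulmx1C (FQf Mp) => QF.
  by rewrite -[X]mulmx1 -QF mulmxA E mul0mx.
move: (X *m Qf p) xi0 => xi xi0; rewrite mx_mulE sum4 !mx_trE !mul_Gf /frame_metric /=.
have w0 : 0 < jetv (base p) W by exact: (w_pos Mp).
have a0 : 0 < jetv (base p) A by exact: (a_pos Mp).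
have [i xii] : exists i, xi 0 i != 0 by apply/existsP; apply: contraNT xi0 => /existsPn h;
  apply/eqP/rowP => i; rewrite mx_constE; apply/eqP/negPn; exact: h.
have nn (c x : R) : 0 < c -> 0 <= x * c * x.
  by move=> c0; rewrite mulrAC -expr2 mulr_ge0 ?sqr_ge0 // ltW.
have pos (c x : R) : 0 < c -> x != 0 -> 0 < x * c * x.
  by move=> c0 x0; rewrite lt_def nn // andbT !mulf_neq0 // gt_eqF.
move: xii; elim/ord4_ind: i => h.
- by rewrite !ltr_wpDr ?nn // pos.
- by rewrite ltr_wpDr ?nn // ltr_wpDr ?nn // ltr_wpDl ?nn // pos.
- by rewrite ltr_wpDr ?nn // ltr_wpDl ?addr_ge0 ?nn // pos.
- by rewrite ltr_wpDl ?addr_ge0 ?nn // pos.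
Qed.

Definition p2 (i k : 'I_4) (xi eta : 'rV[R]_4) : R :=
  xi 0 i * eta 0 k - xi 0 k * eta 0 i.

Definition riem_form q (xi eta zeta om : 'rV[R]_4) : R :=
  curv_form (jetv q) (djetv q)
    (p2 o0 o1 xi eta + p2 o2 o3 xi eta) (p2 o0 o2 xi eta - p2 o1 o3 xi eta)
    (p2 o0 o3 xi eta) (p2 o1 o2 xi eta)
    (p2 o0 o1 zeta om + p2 o2 o3 zeta om) (p2 o0 o2 zeta om - p2 o1 o3 zeta om)
    (p2 o0 o3 zeta om) (p2 o1 o2 zeta om).

Section Curvature.
Hypothesis az : forall q, V q -> pd iz (euw u w) q = 0.
Hypothesis harm : forall q, V q -> pd ix (pd ix w) q + pd iy (pd iy w) q = 0.

Lemma frame_curv_table p c d a b : M p ->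
  (frame_curv Bf EBf c d p *m Gf p) a b = curv_coef (jetv (base p)) (djetv (base p)) c d a b.
Proof.
move=> Mp; have Vp : V (base p) := Mp.
rewrite mul_Gf /frame_curv !(mx_addE, mx_oppE) !mx_mulE summxE !EBfE.
under [X in _ + (X - _) + _]eq_bigr do rewrite !BfE.
under [X in _ + (_ - X) + _]eq_bigr do rewrite !BfE.
under [X in _ + _ + X]eq_bigr do rewrite mx_scaleE !BfE.
rewrite -sumrB.
exact: (curv_table (jetW0 Vp) (jetA0 Vp) (djetv0 _) erefl erefl erefl erefl
  erefl (djet_A3 az Vp) (djet_Wyy harm Vp) (djet_Wxy Vp) (djet_Wxz Vp) (djet_Wyz Vp)
  (djet_Axy Vp) (djet_Axz az Vp) (djet_Ayz az Vp)).
Qed.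

Lemma riemann_form p (X Y Z T : 'rV[R]_4) : M p ->
  riemann (metric u w omega) p X Y Z T =
  riem_form (base p) (X *m Qf p) (Y *m Qf p) (Z *m Qf p) (T *m Qf p).
Proof.
move=> Mp.
rewrite (riemann_frame oM Qf_smooth Ff_smooth Gf_smooth Bf_smooth metric_frame
  FQf Gf_sym Gf_unit (metric_f az) (torsion_f az) EBf_E) //.
move: (X *m _) (Y *m _) (Z *m _) (T *m _) => xi eta zeta om {X Y Z T}.
have quad c d : (zeta *m frame_curv Bf EBf c d p *m Gf p *m om^T) 0 0 =
    \sum_a \sum_b zeta 0 a * om 0 b *
      curv_coef (jetv (base p)) (djetv (base p)) c d a b.
  rewrite -(mulmxA zeta) mx_mulE exchange_big /=; apply: eq_bigr => b _.
  rewrite mx_mulE big_distrl; apply: eq_bigr => a _.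
  by rewrite frame_curv_table // mx_trE /=; ring.
under eq_bigr do under eq_bigr do rewrite quad.
have inner c d : \sum_a \sum_b zeta 0 a * om 0 b *
      curv_coef (jetv (base p)) (djetv (base p)) c d a b =
    curv_form (jetv (base p)) (djetv (base p))
      (pl 0 1 c d + pl 2 3 c d) (pl 0 2 c d - pl 1 3 c d)
      (pl 0 3 c d) (pl 1 2 c d)
    (p2 o0 o1 zeta om + p2 o2 o3 zeta om) (p2 o0 o2 zeta om - p2 o1 o3 zeta om)
    (p2 o0 o3 zeta om) (p2 o1 o2 zeta om).
  rewrite /curv_coef; move: (_ + _) (_ - _) (pl 0 3 c d) (pl 1 2 c d) => U1 V1 x1 y1.
  rewrite !sum4 /curv_form /pl /p2 /=.
  move: (R0101 _ _) (R0202 _ _) (R0102 _ _) (R0103 _ _) (R0203 _ _) (R0303 _ _) (R0312 _) (R1212 _ _).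
  move: (zeta 0 o0) (zeta 0 o1) (zeta 0 o2) (zeta 0 o3).
  move: (om 0 o0) (om 0 o1) (om 0 o2) (om 0 o3) => *; ring.
under eq_bigr do under eq_bigr do rewrite inner.
rewrite /riem_form.
move: (p2 o0 o1 zeta om + p2 o2 o3 zeta om) (p2 o0 o2 zeta om - p2 o1 o3 zeta om)
    (p2 o0 o3 zeta om) (p2 o1 o2 zeta om) => U2 V2 x2 y2.
rewrite !sum4 /curv_form /pl /p2 /=.
move: (R0101 _ _) (R0202 _ _) (R0102 _ _) (R0103 _ _) (R0203 _ _) (R0303 _ _) (R0312 _) (R1212 _ _).
move: (xi 0 o0) (xi 0 o1) (xi 0 o2) (xi 0 o3).
move: (eta 0 o0) (eta 0 o1) (eta 0 o2) (eta 0 o3) => *; ring.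
Qed.

End Curvature.

Lemma R_times_surj q : V q -> exists2 p, M p & base p = q.
Proof.
move=> Vq; pose p : 'rV[R]_4 := \row_i (if unlift ord0 i is Some k then q 0 k else 0).
have bp : base p = q by apply/rowP => k; rewrite !mxE liftK.
by exists p => //; rewrite /R_times /= bp.
Qed.

Section WithJ.
Variables (J : 'rV[R]_4 -> 'M[R]_4).
Hypotheses (J_acs : almost_complex M J) (J_orth : orthogonal_for M (metric u w omega) J).
Hypothesis J_form : forall p, M p ->
  fundamental_form (metric u w omega) J p = Omega_J u w omega p.

(** The fundamental form determines J because the metric is nondegenerate. *)
Lemma JQf p : M p -> J p *m Qf p = Qf p *m J0.
Proof.
move=> Mp; have := J_form Mp; rewrite /fundamental_form metric_frame // Omega_frame //.
rewrite !mulmxA => /(can_inj (mulmxK _)) E.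
have Qu := Q_unit FQf Mp.
have /E{}E : (Qf p)^T \in unitmx by rewrite unitmx_tr.
by apply: (can_inj (mulmxK (Gf_unit Mp))); rewrite E.
Qed.

Lemma isd_Omega (i j k : 'I_4) p : M p ->
  is_derive p (delta_mx 0 i) (fun x => Omega_J u w omega x j k)
    (- ((j == o3)%:R * partial i (fun x => omega x 0 k) p
        - (k == o3)%:R * partial i (fun x => omega x 0 j) p)
     + djetv (base p) i A * pl 1 2 j k).
Proof.
move=> Mp.
have -> : (fun x => Omega_J u w omega x j k) = fun x =>
    - ((j == o3)%:R * omega x 0 k + - ((k == o3)%:R * omega x 0 j))
    + jetv (base x) A * pl 1 2 j k.
  apply/funext => x; rewrite /Omega_J mx_addE mx_oppE mx_scaleE /wedge !mxE.
  rewrite lift_x lift_y lift_z -[euw u w _]/(jetv (base x) A) /pl.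
  by elim/ord4_ind: j; elim/ord4_ind: k => /=; rewrite ?mulr1n ?mulr0n; ring.
have c0 := isd_cst p (delta_mx 0 i).
have dom l := smooth_isd i (omegas l) Mp.
have h := isd_add (isd_opp (isd_add (isd_mul (c0 (j == o3)%:R) (dom k))
   (isd_opp (isd_mul (c0 (k == o3)%:R) (dom j)))))
   (isd_mul (isd_jet A i Mp) (c0 (pl 1 2 j k))).
by apply: (is_derive_eq h); rewrite !mul0r !add0r mulr0 addr0.
Qed.

(** The factor 2 arises because dz wedge d omega and da wedge dx wedge dy contribute one a_z
    each. *)
Lemma d_Omega p (i j k : 'I_4) : M p ->
  partial i (fun x => Omega_J u w omega x j k) p
  + partial j (fun x => Omega_J u w omega x k i) p
  + partial k (fun x => Omega_J u w omega x i j) p =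
  2 * pd iz (euw u w) (base p) *
    (pl 1 2 j k * (i == o3)%:R + pl 1 2 k i * (j == o3)%:R + pl 1 2 i j * (k == o3)%:R).
Proof.
move=> Mp; rewrite !(partial_val (isd_Omega _ _ _ Mp)).
have e1 := d_omegaE i k Mp; have e2 := d_omegaE j i Mp; have e3 := d_omegaE k j Mp.
have -> : djetv (base p) i A = match val i with 1 => jetv (base p) Ax
    | 2 => jetv (base p) Ay | 3 => pd iz (euw u w) (base p) | _ => 0 end by elim/ord4_ind: i {e1 e2}.
have -> : djetv (base p) j A = match val j with 1 => jetv (base p) Ax
    | 2 => jetv (base p) Ay | 3 => pd iz (euw u w) (base p) | _ => 0 end by elim/ord4_ind: j {e2 e3}.
have -> : djetv (base p) k A = match val k with 1 => jetv (base p) Ax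
    | 2 => jetv (base p) Ay | 3 => pd iz (euw u w) (base p) | _ => 0 end by elim/ord4_ind: k {e1 e3}.
pose D a b := partial a (fun x => omega x 0 b) p.
rewrite -!/(D _ _) in e1 e2 e3 *.
(* Derivatives of [omega] are regrouped into antisymmetric differences, the only combinations that
   [d_omega] determines. *)
transitivity (- ((j == o3)%:R * (D i k - D k i) + (k == o3)%:R * (D j i - D i j)
   + (i == o3)%:R * (D k j - D j k))
   + (match val i with 1 => jetv (base p) Ax
    | 2 => jetv (base p) Ay | 3 => pd iz (euw u w) (base p) | _ => 0 end * pl 1 2 j k
    + match val j with 1 => jetv (base p) Ax
    | 2 => jetv (base p) Ay | 3 => pd iz (euw u w) (base p) | _ => 0 end * pl 1 2 k i
    + match val k with 1 => jetv (base p) Ax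
    | 2 => jetv (base p) Ay | 3 => pd iz (euw u w) (base p) | _ => 0 end * pl 1 2 i j)).
  move: (D i k) (D k i) (D j i) (D i j) (D k j) (D j k).
  move: (i == o3)%:R (j == o3)%:R (k == o3)%:R.
  by move: (_ * pl 1 2 j k) (_ * pl 1 2 k i) (_ * pl 1 2 i j) => *; ring.
rewrite e1 e2 e3 {e1 e2 e3 D} /pl.
move: (jetv _ Wx) (jetv _ Wy) (jetv _ Ax) (jetv _ Ay) (pd iz _ _) => x y a b z.
by elim/ord4_ind: i; elim/ord4_ind: j; elim/ord4_ind: k => /=;
  rewrite ?mulr1n ?mulr0n; ring.
Qed.

Lemma almost_kahler_iff : almost_kahler M (metric u w omega) J <->
  forall q, V q -> pd iz (euw u w) q = 0.
Proof.
have Omega_eq p (i j k : 'I_4) : M p ->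
    partial i (fun x => fundamental_form (metric u w omega) J x j k) p =
    partial i (fun x => Omega_J u w omega x j k) p.
  by move=> Mp; apply: (partial_eq i oM Mp) => x Mx; rewrite J_form.
split=> [[_ R0312] q Vq|az].
  have [p Mp bp] := R_times_surj Vq.
  have := R0312 p; rewrite inE => /(_ Mp o1 o2 o3).
  rewrite !Omega_eq // d_Omega // bp /pl /= mulr1n mulr0n.
  by move: (pd _ _ _) => z; lra.
split; first by split=> //; exact: metric_riemannian.
move=> p; rewrite inE => Mp i j k.
by rewrite !Omega_eq // d_Omega // az // mulr0 mul0r.
Qed.

Section AK.
Hypothesis az : forall q, V q -> pd iz (euw u w) q = 0.
Hypothesis harm : forall q, V q -> pd ix (pd ix w) q + pd iy (pd iy w) q = 0.

Lemma mul_J0 (xi : 'rV[R]_4) : [/\ (xi *m J0) 0 o0 = - xi 0 o3,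
  (xi *m J0) 0 o1 = - xi 0 o2, (xi *m J0) 0 o2 = xi 0 o1 & (xi *m J0) 0 o3 = xi 0 o0].
Proof.
by split; rewrite mx_mulE sum4 /J0 !mxE /pl /=; ring.
Qed.

Lemma row_Ff p (c : 'I_4) : M p -> row c (Ff p) *m Qf p = delta_mx 0 c.
Proof. by move=> Mp; rewrite -row_mul FQf // row1. Qed.

(** Applying J to both vectors changes the sign of U and V and fixes p03 and p12. Invariance
    therefore kills the coefficients pairing the two kinds, which in [curv_form] are [R0103] and
    [R0203]. *)
Lemma AK3_iff : AK3 M (metric u w omega) J <->
  (forall q, V q -> R0103 (jetv q) (djetv q) = 0 /\ R0203 (jetv q) (djetv q) = 0).
Proof.
have XJ p (X : 'rV[R]_4) : M p -> X *m J p *m Qf p = X *m Qf p *m J0.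
  by move=> Mp; rewrite -!mulmxA JQf.
split=> [[_ H] q Vq|H].
  have [p Mp bp] := R_times_surj Vq.
  have := H p; rewrite inE => /(_ Mp) {}H.
  have K (c d a b : 'I_4) := H (row c (Ff p)) (row d (Ff p)) (row a (Ff p)) (row b (Ff p)).
  have {H}K (c d a b : 'I_4) : riem_form q (delta_mx 0 c) (delta_mx 0 d) (delta_mx 0 a) (delta_mx 0 b)
    = riem_form q (delta_mx 0 c *m J0) (delta_mx 0 d *m J0) (delta_mx 0 a *m J0)
        (delta_mx 0 b *m J0).
    by have := K c d a b; rewrite !(riemann_form az harm) // !XJ // !row_Ff // bp.
  have J0d (c : 'I_4) := mul_J0 (delta_mx 0 c).
  have [a0 a1 a2 a3] := J0d o0; have [b0 b1 b2 b3] := J0d o1.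
  have [c0 c1 c2 c3] := J0d o2; have [d0 d1 d2 d3] := J0d o3.
  have := K o0 o1 o0 o3; have := K o0 o2 o0 o3.
  rewrite /riem_form /p2 a0 a1 a2 a3 b0 b1 b2 b3 c0 c1 c2 c3 d0 d1 d2 d3 !mxE /=.
  rewrite /curv_form ?mulr1n ?mulr0n.
  move: (R0101 _ _) (R0202 _ _) (R0102 _ _) (R0103 _ _) (R0203 _ _) (R0303 _ _) (R0312 _) (R1212 _ _).
  by move=> ? ? ? r t ? ? ? h1 h2; split; [move: h2|move: h1]; lra.
split; first exact/almost_kahler_iff.
move=> p; rewrite inE => Mp X Y Z T; rewrite !(riemann_form az harm) // !XJ //.
move: (X *m _) (Y *m _) (Z *m _) (T *m _) => xi eta zeta om.
rewrite /riem_form /p2; have [-> -> -> ->] := mul_J0 xi.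
have [-> -> -> ->] := mul_J0 eta; have [-> -> -> ->] := mul_J0 zeta.
have [-> -> -> ->] := mul_J0 om; rewrite /curv_form.
have [-> ->] := H _ (Mp : V (base p)).
move: (R0101 _ _) (R0202 _ _) (R0102 _ _) (R0303 _ _) (R0312 _) (R1212 _ _).
move: (xi 0 o0) (xi 0 o1) (xi 0 o2) (xi 0 o3).
move: (eta 0 o0) (eta 0 o1) (eta 0 o2) (eta 0 o3).
move: (zeta 0 o0) (zeta 0 o1) (zeta 0 o2) (zeta 0 o3).
by move: (om 0 o0) (om 0 o1) (om 0 o2) (om 0 o3) => *; ring.
Qed.

(** Applying J to one vector only sends (U, V) to (-V, U). The identity thus also asks the form on
    the (U, V)-plane to be invariant under this rotation, that is, to be a multiple of the
    identity. *)
Lemma AK2_iff : AK2 M (metric u w omega) J <->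
  (forall q, V q -> [/\ R0103 (jetv q) (djetv q) = 0, R0203 (jetv q) (djetv q) = 0,
    R0102 (jetv q) (djetv q) = 0 & R0101 (jetv q) (djetv q) = R0202 (jetv q) (djetv q)]).
Proof.
have XJ p (X : 'rV[R]_4) : M p -> X *m J p *m Qf p = X *m Qf p *m J0.
  by move=> Mp; rewrite -!mulmxA JQf.
split=> [[_ H] q Vq|H].
  have [p Mp bp] := R_times_surj Vq.
  have := H p; rewrite inE => /(_ Mp) {}H.
  have K (c d a b : 'I_4) := H (row c (Ff p)) (row d (Ff p)) (row a (Ff p)) (row b (Ff p)).
  have {H}K (c d a b : 'I_4) : let x := delta_mx 0 c in let y := delta_mx 0 d in
      let z := delta_mx 0 a in let t := delta_mx 0 b in
      riem_form q x y z t - riem_form q (x *m J0) (y *m J0) z t =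
      riem_form q (x *m J0) y (z *m J0) t + riem_form q (x *m J0) y z (t *m J0).
    by have := K c d a b; rewrite !(riemann_form az harm) // !XJ // !row_Ff // bp.
  have J0d (c : 'I_4) := mul_J0 (delta_mx 0 c).
  have [a0 a1 a2 a3] := J0d o0; have [b0 b1 b2 b3] := J0d o1.
  have [c0 c1 c2 c3] := J0d o2; have [d0 d1 d2 d3] := J0d o3.
  have := K o0 o1 o0 o3; have := K o0 o2 o0 o3.
  have := K o0 o1 o0 o1; have := K o0 o1 o0 o2; move=> /=.
  rewrite /riem_form /p2 a0 a1 a2 a3 b0 b1 b2 b3 c0 c1 c2 c3 d0 d1 d2 d3 !mxE /=.
  rewrite /curv_form ?mulr1n ?mulr0n.
  move: (R0101 _ _) (R0202 _ _) (R0102 _ _) (R0103 _ _) (R0203 _ _) (R0303 _ _) (R0312 _) (R1212 _ _).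
  move=> ? ? ? r t ? ? ? h1 h2 h3 h4; split.
  - by move: h4 {h1 h2 h3} => h4; lra.
  - by move: h3 {h1 h2 h4} => h3; lra.
  - by move: h1 {h2 h3 h4} => h1; lra.
  - by move: h2 {h1 h3 h4} => h2; lra.
split; first exact/almost_kahler_iff.
move=> p; rewrite inE => Mp X Y Z T; rewrite !(riemann_form az harm) // !XJ //.
move: (X *m _) (Y *m _) (Z *m _) (T *m _) => xi eta zeta om.
rewrite /riem_form /p2; have [-> -> -> ->] := mul_J0 xi.
have [-> -> -> ->] := mul_J0 eta; have [-> -> -> ->] := mul_J0 zeta.
have [-> -> -> ->] := mul_J0 om; rewrite /curv_form.
have [-> -> -> ->] := H _ (Mp : V (base p)).
move: (R0202 _ _) (R0303 _ _) (R0312 _) (R1212 _ _).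
move: (xi 0 o0) (xi 0 o1) (xi 0 o2) (xi 0 o3).
move: (eta 0 o0) (eta 0 o1) (eta 0 o2) (eta 0 o3).
move: (zeta 0 o0) (zeta 0 o1) (zeta 0 o2) (zeta 0 o3).
by move: (om 0 o0) (om 0 o1) (om 0 o2) (om 0 o3) => *; ring.
Qed.

(** Without w_x and w_y the surviving connection coefficients, those in w_z, a_x and a_y, give
    matrices that commute with [J0]. *)
Lemma kahler_of_gradient_eq0 :
  (forall q, V q -> pd ix w q = 0 /\ pd iy w q = 0) -> kahler M (metric u w omega) J.
Proof.
move=> g0; split; first exact/almost_kahler_iff.
move=> X Y Xs Ys p; rewrite inE => Mp; have [Js JJ] := J_acs.
have := JJ p; rewrite inE => /(_ Mp) JJp.
apply: (nijenhuis_commute oM Qf_smooth FQf (torsion_f az) Js JQf Mp JJp _ Xs Ys) => c.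
have [x0 y0] := g0 _ (Mp : V (base p)).
apply/matrixP => a b; rewrite !mx_mulE !sum4 !BfE /J0 !mxE /pl /Bv.
have wx0 : jetv (base p) Wx = 0 := x0.
have wy0 : jetv (base p) Wy = 0 := y0.
by elim/ord4_ind: c; elim/ord4_ind: a; elim/ord4_ind: b => /=;
  rewrite ?wx0 ?wy0; ring.
Qed.

(** The Nijenhuis tensor is tested on e_0 and e_2: its components along e_0 and e_3 are, up to sign,
    2 w_y / w and 2 w_x / w. *)
Lemma gradient_eq0_of_integrable : integrable_acs M J ->
  forall q, V q -> pd ix w q = 0 /\ pd iy w q = 0.
Proof.
move=> N0 q Vq; have [p Mp bp] := R_times_surj Vq; have [Js _] := J_acs.
have Vp : V (base p) := Mp.
have Es (c : 'I_4) : smooth_vec M (fun x => row c (Ff x)).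
  by move=> k; under eq_fun do rewrite mxE; exact: Ff_smooth.
have EQ (c : 'I_4) x : M x -> row c (Ff x) *m Qf x = delta_mx 0 c by exact: row_Ff.
have := nijenhuis_frame oM Qf_smooth FQf (torsion_f az) Js JQf Mp (Es o0) (Es o2) (EQ o0) (EQ o2).
rewrite N0 ?inE // mul0mx.
(* Brackets of frame vectors are multiples of e_0, since dx, dy and dz are closed. *)
have brE xi eta : frame_bracket Bf p xi eta = - (\sum_(c < 4) \sum_(d < 4)
    xi 0 c * eta 0 d * torsion_coef (jetv (base p)) c d) *: delta_mx 0 o0.
  apply/rowP => b; rewrite mx_scaleE summxE mulNr big_distrl -sumrN /=.
  transitivity (\sum_(c < 4) \sum_(d < 4)
      xi 0 c * eta 0 d * (Bf c p d b - Bf d p c b)).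
    transitivity (\sum_(c < 4) \sum_(d < 4) xi 0 c * eta 0 d * Bf c p d b
      - \sum_(c < 4) \sum_(d < 4) xi 0 c * eta 0 d * Bf d p c b).
      rewrite [X in _ = _ - X]exchange_big -sumrB; apply: eq_bigr => c _.
      rewrite mx_addE mx_oppE !mx_scaleE !mx_mulE !big_distrr /= .
      congr (_ - _); apply: eq_bigr => d _; first by rewrite mulrA.
      by rewrite mulrA (mulrC (xi 0 d)).
    rewrite -sumrB; apply: eq_bigr => c _; rewrite -sumrB; apply: eq_bigr => d _.
    by rewrite -mulrBr.
  apply: eq_bigr => c _; rewrite big_distrl -sumrN; apply: eq_bigr => d _.
  rewrite -opprB mulrN !BfE (torsion_table (jetW0 Vp) (jetA0 Vp)) mxE eqxx /=.
  by case: eqP => _; rewrite ?mulr1 ?mulr0.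
rewrite !brE -!scalemxAl.
have [a0 a1 a2 a3] := mul_J0 (delta_mx 0 o0); have [c0 c1 c2 c3] := mul_J0 (delta_mx 0 o2).
rewrite !sum4 a0 a1 a2 a3 c0 c1 c2 c3 => /matrixP E.
have := E 0 o0; have := E 0 o3 => {E}.
rewrite !(mx_addE, mx_oppE, mx_scaleE) a0 a3 !mxE /torsion_coef /pl /=.
rewrite ?mulr1n ?mulr0n bp -[pd ix w q]/(jetv q Wx) -[pd iy w q]/(jetv q Wy).
move: (jetW0 Vq); move: (jetv q W) (jetv q Wx) (jetv q Wy) (jetv q Wz).
move=> d x y z d0 h1 h2.
have e1 : x / d = 0 by move: h1; lra.
have e2 : y / d = 0 by move: h2; lra.
by split; apply/eqP; [move/eqP: e1|move/eqP: e2]; rewrite mulf_eq0 invr_eq0 (negbTE d0) orbF.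
Qed.

End AK.

End WithJ.

End AnsatzFrame.

(** * Functions of x and y *)

Section Descent.
Context {R : realType}.
Variables (V : set 'rV[R]_3).
Hypothesis oV : open V.
Implicit Types (f : 'rV[R]_3 -> R) (phi : 'rV[R]_2 -> R) (q : 'rV[R]_3) (c : 'rV[R]_2).

Local Notation emb := (widen_ord (isT : 2 <= 3)%N).

(** The point above [c] at the height of [q]: a horizontal section of [pr_xy] through [q], along
    which a plane function can be read off from its pull-back. *)
Definition over q c : 'rV[R]_3 :=
  \row_i (if insub (val i) is Some j then c 0 j else q 0 i).

Lemma over_emb q c j : over q c 0 (emb j) = c 0 j.
Proof.
rewrite mxE; case: insubP => [k _ /= kj|]; last by rewrite /= ltn_ord.
by congr (c _ _); exact: val_inj.
Qed.

Lemma over_z q c : over q c 0 iz = q 0 iz.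
Proof. by rewrite mxE insubN. Qed.

Lemma ord3_emb (i : 'I_3) : i = iz \/ exists j, i = emb j.
Proof.
case: i => [[|[|[|//]]]] lt; last by left; exact: val_inj.
  by right; exists jx; exact: val_inj.
by right; exists jy; exact: val_inj.
Qed.

Lemma emb_x : emb jx = ix. Proof. exact: val_inj. Qed.
Lemma emb_y : emb jy = iy. Proof. exact: val_inj. Qed.
Lemma emb_neq_z j : (emb j == iz) = false.
Proof. by apply/negbTE; rewrite -val_eqE /= ltn_eqF. Qed.

Lemma pr_xyE q j : pr_xy q 0 j = q 0 (emb j).
Proof. by rewrite mxE. Qed.

Lemma pr_over q c : pr_xy (over q c) = c.
Proof. by apply/rowP => j; rewrite pr_xyE over_emb. Qed.

Lemma over_pr q : over q (pr_xy q) = q.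
Proof.
apply/rowP => i; case: (ord3_emb i) => [->|[j ->]]; first exact: over_z.
by rewrite over_emb pr_xyE.
Qed.

Lemma over_shift q c t j : over q (t *: delta_mx 0 j + c) =
  t *: delta_mx 0 (emb j) + over q c.
Proof.
apply/rowP => i; rewrite shiftE; case: (ord3_emb i) => [->|[k ->]].
  by rewrite !over_z eq_sym emb_neq_z mulr0n add0r.
by rewrite !over_emb shiftE -(inj_eq val_inj (emb k)).
Qed.

Lemma pr_shift_z q t : pr_xy (t *: delta_mx 0 iz + q) = pr_xy q.
Proof.
by apply/rowP => j; rewrite !pr_xyE shiftE emb_neq_z mulr0n add0r.
Qed.

Lemma over_cube q r c : 0 < r -> cube (pr_xy q) r c -> cube q r (over q c).
Proof.
move=> r0 R0103 i; case: (ord3_emb i) => [->|[j ->]].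
  by rewrite over_z subrr normr0.
by rewrite over_emb -pr_xyE; exact: R0103.
Qed.

Section Factor.
Variables (f : 'rV[R]_3 -> R) (phi : 'rV[R]_2 -> R).
Hypotheses (fE : forall q, V q -> f q = phi (pr_xy q)).

Lemma near_over q : V q -> \forall c \near pr_xy q, f (over q c) = phi c.
Proof.
move=> Vq; have [r r0 rV] := open_cube oV Vq.
apply/nbhs_cube; exists r => // c R0103; rewrite fE ?pr_over //.
by apply: rV; exact: over_cube.
Qed.

Lemma factor_isd q j : smooth V f -> V q ->
  is_derive (pr_xy q) (delta_mx 0 j) phi (pd (emb j) f q).
Proof.
move=> fs Vq.
apply: (isd_near (near_over Vq)).
have [fd fv] := pd_isd (emb j) fs Vq.
have E : (fun h : R => h^-1 *: ((f \o shift q) (h *: delta_mx 0 (emb j)) - f q))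
  = (fun h : R => h^-1 *: (((fun c => f (over q c)) \o shift (pr_xy q))
    (h *: delta_mx 0 j) - f (over q (pr_xy q)))).
  by apply/funext => h /=; rewrite over_shift over_pr.
by split; [rewrite /derivable -E|rewrite -fv /derive E].
Qed.

Lemma factor_pd q j : smooth V f -> V q -> pd j phi (pr_xy q) = pd (emb j) f q.
Proof. by move=> fs Vq; apply: pd_val; exact: factor_isd. Qed.

Lemma factor_z q : V q -> pd iz f q = 0.
Proof.
move=> Vq; rewrite (pd_eq iz oV Vq fE); apply: pd_val.
have E : (fun h : R => h^-1 *: (((fun x => phi (pr_xy x)) \o shift q)
    (h *: delta_mx 0 iz) - phi (pr_xy q))) = fun=> 0.
  by apply/funext => h /=; rewrite pr_shift_z subrr scaler0.
by split; rewrite /derivable /derive E; [exact: is_cvg_cst|exact: lim_cst].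
Qed.

Lemma factor_cont q : smooth V f -> V q -> phi c @[c --> pr_xy q] --> phi (pr_xy q).
Proof.
move=> fs Vq.
have oc : over q c @[c --> pr_xy q] --> over q (pr_xy q).
  move=> A /nbhs_cube[r r0 rA]; apply/nbhs_cube; exists r => // c R0103; apply: rA.
  by rewrite over_pr; exact: over_cube.
have fc : f x @[x --> over q (pr_xy q)] --> f (over q (pr_xy q)).
  by rewrite over_pr; exact: (smooth_cont fs Vq).
have h := continuous_comp oc fc.
have e : f (over q (pr_xy q)) = phi (pr_xy q) by rewrite over_pr fE.
have near_eq : {near pr_xy q, f \o over q =1 phi} by exact: near_over.
by rewrite -e; exact: (cvg_trans (near_eq_cvg near_eq) h).
Qed.

End Factor.

(** Near each point of the shadow, phi is f on a horizontal slice, and its partial derivatives are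
    again factors of those of f; so the induction runs over the pair. *)
Lemma factor_smooth f phi : (forall q, V q -> f q = phi (pr_xy q)) -> smooth V f ->
  smooth (shadow V) phi.
Proof.
move=> fE fs k; elim: k f phi fE fs => [|k IHk] f phi fE fs.
all: have cf : {in shadow V, continuous phi}
  by move=> c; rewrite inE => -[q Vq <-]; exact: (factor_cont fE fs Vq).
  by split.
split=> // j; split.
  by move=> c; rewrite inE => -[q Vq <-]; case: (factor_isd fE j fs Vq).
apply: (IHk (pd (emb j) f)); last exact: pd_smooth.
by move=> q Vq; rewrite -pdE (factor_pd fE j fs Vq).
Qed.

(** A vanishing z-derivative gives constancy on each vertical piece within a cube; connectedness of
    the fibre joins the pieces. *)
Lemma const_on_fibre f q q' : connected (V `&` pr_xy @^-1` [set pr_xy q]) ->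
  smooth V f -> (forall x, V x -> pd iz f x = 0) -> V q -> V q' ->
  pr_xy q' = pr_xy q -> f q' = f q.
Proof.
move=> cF fs fz Vq Vq' prq.
apply: (connected_ind cF (A := [set x | f x = f q])); last by split.
  by exists q.
move=> x [Vx prx]; have [r r0 rV] := open_cube oV Vx.
have h y : cube x r y -> V y /\ pr_xy y = pr_xy q -> f y = f x.
  move=> yr [Vy pry].
  have E : y = (y 0 iz - x 0 iz) *: delta_mx 0 iz + x.
    apply/rowP => i; rewrite shiftE; case: (ord3_emb i) => [->|[j ->]].
      by rewrite eqxx mulr1n subrK.
    rewrite emb_neq_z mulr0n add0r -!pr_xyE; congr (_ 0 j).
    by rewrite pry -prx.
  rewrite E; apply: (const_axis fs rV _ (cube_center x r0)); last by rewrite -E.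
  by move=> z /rV Vz; rewrite -pdE fz.
have [e|e] := pselect (f x = f q); [left|right]; apply/nbhs_cube; exists r => //.
  by move=> y yr Hy /=; rewrite (h y).
by move=> y yr Hy /=; rewrite (h y).
Qed.

Lemma descends_exists f : connected_fibres V -> smooth V f ->
  (forall q, V q -> pd iz f q = 0) -> exists phi, descends V f phi.
Proof.
move=> cF fs fz.
(* An arbitrary point of the fibre is chosen; the default 0 occurs only off the shadow. *)
pose phi c := f (xget 0 [set q | V q /\ pr_xy q = c]).
have fE q : V q -> f q = phi (pr_xy q).
  move=> Vq; rewrite /phi; case: xgetP => [x _ [Vx prx]|no].
    by apply: esym; exact: (const_on_fibre (cF _)).
  by have := no q; case.
exists phi; split; first exact: (factor_smooth fE).
by move=> q; rewrite inE; exact: fE.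
Qed.

End Descent.

(** * From the curvature conditions to the classification *)

Section Classification.
Context {R : realType}.
Variables (V : set 'rV[R]_3) (u w : 'rV[R]_3 -> R) (omega : 'rV[R]_4 -> 'rV[R]_4).
Variables (J : 'rV[R]_4 -> 'M[R]_4).
Hypotheses (oV : open V) (cV : connected V) (us : smooth V u) (ws : smooth V w).
Hypothesis w_pos : forall q, V q -> 0 < w q.
Hypothesis w_eq : forall q, V q -> pd ix (pd ix w) q + pd iy (pd iy w) q
  + pd iz (pd iz (euw u w)) q = 0.
Hypothesis omegas : smooth_vec (R_times V) omega.
Hypothesis omega0 : forall p, R_times V p -> omega p 0 ord0 != 0.
Hypothesis d_omega : forall p, R_times V p ->
  ext_d omega p = curvature_form u w (base p).
Hypotheses (J_acs : almost_complex (R_times V) J)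
  (J_orth : orthogonal_for (R_times V) (metric u w omega) J).
Hypothesis J_form : forall p, R_times V p ->
  fundamental_form (metric u w omega) J p = Omega_J u w omega p.

Local Notation M := (R_times V).
Local Notation g := (metric u w omega).
Local Notation a_z_eq0 := (forall q, V q -> pd iz (euw u w) q = 0).
Local Notation grad_eq0 := (forall q, V q -> pd ix w q = 0 /\ pd iy w q = 0).

Definition harmonic_pd : Prop :=
  [/\ forall q, V q -> pd iz u q = 0 /\ pd iz w q = 0,
      forall q, V q -> pd ix (pd ix w) q + pd iy (pd iy w) q = 0
    & ~ constant_on V w].

Lemma harmonic_xyP : harmonic_xy V u w <-> harmonic_pd.
Proof.
rewrite /harmonic_xy /harmonic_pd pdE.
by split=> -[h1 h2 h3]; split=> // q; have := h1 q; have := h2 q; rewrite inE; auto.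
Qed.

Lemma explicit_uP : explicit_u V u w <-> explicit_log V u w.
Proof.
rewrite /explicit_u /explicit_log pdE.
split=> -[h1 [C h2]]; (split; [move=> q|exists C => q]);
  by have := h1 q; have := h2 q; rewrite inE; auto.
Qed.

Lemma pd_euw i q : V q ->
  pd i (euw u w) q = expR (u q) * (pd i u q * w q + pd i w q).
Proof.
move=> Vq; apply: pd_val.
have h := isd_mul (isd_exp (pd_isd i us Vq)) (pd_isd i ws Vq).
by apply: (is_derive_eq h); rewrite mulrDr mulrA.
Qed.

Lemma harm_of_az : a_z_eq0 -> forall q, V q -> pd ix (pd ix w) q + pd iy (pd iy w) q = 0.
Proof.
move=> az q Vq; have := w_eq Vq; rewrite (pd_eq iz oV Vq az).
by rewrite (pd_val (isd_cst q (delta_mx 0 iz) (0 : R))) addr0.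
Qed.

Lemma az_of_harmonic : harmonic_pd -> a_z_eq0.
Proof.
by move=> [h _ _] q Vq; have [h1 h2] := h q Vq; rewrite pd_euw // h1 h2 mul0r addr0 mulr0.
Qed.

Lemma akP : almost_kahler M g J <-> a_z_eq0.
Proof. exact: (almost_kahler_iff oV us ws w_pos omegas omega0 d_omega J_acs J_orth J_form). Qed.

Lemma kahlerP : a_z_eq0 -> (kahler M g J <-> grad_eq0).
Proof.
move=> az; split.
  move=> [_ N0].
  exact: (gradient_eq0_of_integrable oV us ws w_pos omegas omega0 d_omega J_acs J_form az N0).
exact: (kahler_of_gradient_eq0 oV us ws w_pos omegas omega0 d_omega J_acs J_orth J_form az).
Qed.

(** This translates non-Kaehler, a nonzero horizontal gradient somewhere, into the non-constancy
    demanded of w; connectedness of V gives one direction. *)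
Lemma nonconstant_gradient : (forall q, V q -> pd iz w q = 0) ->
  (~ grad_eq0 <-> ~ constant_on V w).
Proof.
move=> wz; split=> h1 h2; apply: h1.
  move=> q Vq; have [c cE] := h2.
  have e i : pd i w q = 0.
    by rewrite (pd_eq i oV Vq cE); exact: (pd_val (isd_cst _ _ _)).
  by split.
apply: (const_connected_pd oV cV ws) => q Vq i.
have [->|iz'] := eqVneq i iz; first exact: wz.
by have [] := h2 q Vq; case: (ord3_xy iz') => ->.
Qed.

Lemma R0103_eq0 q : V q -> R0103 (jetv u w q) (djetv u w q) = 0 <->
  w q * pd iz (pd ix w) q = 2 * (pd ix w q * pd iz w q).
Proof.
move=> Vq; have := w_pos Vq; rewrite /R0103 /jetv /djetv /=.
move: (w q) (pd iz _ q) (pd ix w q) (pd iz w q) => a xz x z a0.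
have an : a != 0 by rewrite gt_eqF.
have -> : - xz / 2 + x * z / a = (2 * (x * z) - a * xz) / (2 * a) by field.
split=> [/eqP|->]; last by rewrite subrr mul0r.
by rewrite mulf_eq0 invr_eq0 mulf_eq0 (negbTE an) pnatr_eq0 !orbF subr_eq0 => /eqP.
Qed.

Lemma R0203_eq0 q : V q -> R0203 (jetv u w q) (djetv u w q) = 0 <->
  w q * pd iz (pd iy w) q = 2 * (pd iy w q * pd iz w q).
Proof.
move=> Vq; have := w_pos Vq; rewrite /R0203 /jetv /djetv /=.
move: (w q) (pd iz _ q) (pd iy w q) (pd iz w q) => a xz x z a0.
have an : a != 0 by rewrite gt_eqF.
have -> : - xz / 2 + x * z / a = (2 * (x * z) - a * xz) / (2 * a) by field.
split=> [/eqP|->]; last by rewrite subrr mul0r.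
by rewrite mulf_eq0 invr_eq0 mulf_eq0 (negbTE an) pnatr_eq0 !orbF subr_eq0 => /eqP.
Qed.

Lemma R0101_eq_R0202 q : V q ->
  R0101 (jetv u w q) (djetv u w q) = R0202 (jetv u w q) (djetv u w q) <-> hessian_eq1 u w q.
Proof.
move=> Vq; have := w_pos Vq; have := expR_gt0 (u q).
rewrite /R0101 /R0202 /hessian_eq1 /jetv /djetv /= !pd_euw // /euw.
move: (expR _) (w q) (pd ix w q) (pd iy w q) (pd ix u q) (pd iy u q) (pd ix _ q).
move=> e a x y ux uy xx /lt0r_neq0 e0 /lt0r_neq0 a0.
set p := - xx / 2 + _ + _; set n := xx / 2 - _ + _.
have pnE : p - n = (x * ux - y * uy + 3 * (x ^+ 2 - y ^+ 2) / a - 2 * xx) / 2.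
  by rewrite /p /n; field; apply/andP.
split=> [/eqP|h]; last by apply/eqP; rewrite -subr_eq0 pnE h subrr mul0r.
by rewrite -subr_eq0 pnE mulf_eq0 invr_eq0 pnatr_eq0 orbF subr_eq0 => /eqP.
Qed.

Lemma R0102_eq0 q : V q ->
  R0102 (jetv u w q) (djetv u w q) = 0 <-> hessian_eq2 u w q.
Proof.
move=> Vq; have := w_pos Vq; have := expR_gt0 (u q).
rewrite /R0102 /hessian_eq2 /jetv /djetv /= !pd_euw // /euw.
move: (expR _) (w q) (pd ix w q) (pd iy w q) (pd ix u q) (pd iy u q) (pd iy _ q).
move=> e a x y ux uy xx /lt0r_neq0 e0 /lt0r_neq0 a0.
have -> : - xx / 2 + (x * (e * (uy * a + y)) + y * (e * (ux * a + x))) / (4 * (e * a))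
    + x * y / a = (x * uy + y * ux + 6 * x * y / a - 2 * xx) / 4.
  by field; apply/andP.
split=> [/eqP|->]; last by rewrite subrr mul0r.
by rewrite mulf_eq0 invr_eq0 pnatr_eq0 orbF subr_eq0 => /eqP.
Qed.

Lemma AK3_harmonic : (~ kahler M g J /\ AK3 M g J) <-> harmonic_pd.
Proof.
split=> [[nK ak3]|H].
  have az : a_z_eq0 by apply/akP; case: ak3.
  have harm := harm_of_az az.
  have ng : ~ grad_eq0 by move=> h; apply: nK; exact/kahlerP.
  have crct := (AK3_iff oV us ws w_pos omegas omega0 d_omega J_acs J_orth J_form az harm).1 ak3.
  have xz q (Vq : V q) := (R0103_eq0 Vq).1 (crct q Vq).1.
  have yz q (Vq : V q) := (R0203_eq0 Vq).1 (crct q Vq).2.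
  have wz := wz_eq0 oV cV ws w_pos harm xz yz ng.
  split=> //; last exact/nonconstant_gradient.
  (* As a_z = e^u (u_z w + w_z), the vanishing of w_z turns a_z = 0 into u_z = 0. *)
  move=> q Vq; split; last exact: wz.
  have := az q Vq; rewrite pd_euw // wz // addr0 => /eqP.
  by rewrite !mulf_eq0 (gt_eqF (expR_gt0 _)) (gt_eqF (w_pos Vq)) orbF => /eqP.
have az := az_of_harmonic H; have [H1 H2 H3] := H.
have wz q (Vq : V q) := (H1 q Vq).2.
split; first by move=> /(kahlerP az); apply/nonconstant_gradient.
apply/(AK3_iff oV us ws w_pos omegas omega0 d_omega J_acs J_orth J_form az H2) => q Vq.
by split; [apply/R0103_eq0|apply/R0203_eq0] => //; rewrite wz // (mixed_z_eq0 oV ws wz) // !mulr0.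
Qed.

Lemma AK2_explicit :
  (~ kahler M g J /\ AK2 M g J) <-> harmonic_pd /\ explicit_log V u w.
Proof.
have ak2 az harm := AK2_iff oV us ws w_pos omegas omega0 d_omega J_acs J_orth J_form az harm.
have ak3 az harm := AK3_iff oV us ws w_pos omegas omega0 d_omega J_acs J_orth J_form az harm.
split=> [[nK k2]|[H E]].
  have az : a_z_eq0 by apply/akP; case: k2.
  have harm := harm_of_az az.
  have c2 := (ak2 az harm).1 k2.
  have H : harmonic_pd.
    apply/AK3_harmonic; split=> //; apply/(ak3 az harm) => q Vq.
    by have [] := c2 q Vq.
  split=> //; have [H1 _ H3] := H.
  have wz q (Vq : V q) := (H1 q Vq).2; have uz q (Vq : V q) := (H1 q Vq).1.
  apply: (explicit_u_of_hessian oV us ws w_pos harm wz uz cV).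
    exact/(nonconstant_gradient wz).
  move=> q Vq; have [_ _ m0 pn] := c2 q Vq.
  by split; [apply/R0101_eq_R0202|apply/R0102_eq0].
have [nK k3] := AK3_harmonic.2 H; split=> //.
have az := az_of_harmonic H; have [H1 harm _] := H.
have wz q (Vq : V q) := (H1 q Vq).2.
apply/(ak2 az harm) => q Vq; have [r0 t0] := (ak3 az harm).1 k3 q Vq.
have [h1 h2] := hessian_of_explicit_u oV ws w_pos harm wz E Vq.
by split=> //; [apply/R0102_eq0|apply/R0101_eq_R0202].
Qed.

(** * The same conditions on the plane domain *)

Section Plane.
Hypothesis cF : connected_fibres V.
Local Notation U := (shadow V).

Lemma descendsE (f : 'rV[R]_3 -> R) phi : descends V f phi ->
  forall q, V q -> f q = phi (pr_xy q).
Proof. by move=> [_ h] q Vq; apply: h; rewrite inE. Qed.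

Lemma descends_pd (f : 'rV[R]_3 -> R) phi q : smooth V f -> descends V f phi ->
  V q -> pd jx phi (pr_xy q) = pd ix f q /\ pd jy phi (pr_xy q) = pd iy f q.
Proof.
move=> fs /descendsE fE Vq.
by rewrite -emb_x -emb_y !(factor_pd oV fE _ fs Vq).
Qed.

Lemma descends_laplace phi q : descends V w phi -> V q ->
  pd jx (pd jx phi) (pr_xy q) + pd jy (pd jy phi) (pr_xy q) =
  pd ix (pd ix w) q + pd iy (pd iy w) q.
Proof.
move=> wE Vq.
have ex x : V x -> pd ix w x = pd jx phi (pr_xy x).
  by move=> Vx; have [] := descends_pd ws wE Vx.
have ey x : V x -> pd iy w x = pd jy phi (pr_xy x).
  by move=> Vx; have [] := descends_pd ws wE Vx.
rewrite (factor_pd oV ex jx (pd_smooth ix ws) Vq).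
by rewrite (factor_pd oV ey jy (pd_smooth iy ws) Vq) emb_x emb_y.
Qed.

Lemma harmonic_planeP phi : descends V w phi ->
  (harmonic_plane U phi <->
   (forall q, V q -> pd ix (pd ix w) q + pd iy (pd iy w) q = 0) /\ ~ constant_on V w).
Proof.
move=> wE; have E := descendsE wE; rewrite /harmonic_plane -pdE; split.
  move=> [_ h nc]; split.
    by move=> q Vq; rewrite -(descends_laplace wE Vq); apply: h; rewrite inE; exists q.
  by move=> [c cE]; apply: nc; exists c => x [q Vq <-]; rewrite -E // cE.
move=> [h nc]; split.
- by move=> x; rewrite inE => -[q Vq <-]; rewrite -E // w_pos.
- by move=> x; rewrite inE => -[q Vq <-]; rewrite descends_laplace // h.
- by move=> [c cE]; apply: nc; exists c => q Vq; rewrite E // cE //; exists q.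
Qed.

Lemma explicit_planeP psi phi : descends V u psi -> descends V w phi ->
  (explicit_u_plane U psi phi <-> explicit_log V u w).
Proof.
move=> uE wE; rewrite /explicit_u_plane -pdE; split.
  move=> [h [C hC]]; split.
    move=> q Vq; have [<- <-] := descends_pd ws wE Vq.
    by apply: h; rewrite inE; exists q.
  exists C => q Vq; have [<- <-] := descends_pd ws wE Vq.
  by rewrite (descendsE uE Vq) (descendsE wE Vq); apply: hC; rewrite inE; exists q.
move=> [h [C hC]]; split.
  move=> x; rewrite inE => -[q Vq <-]; have [-> ->] := descends_pd ws wE Vq.
  exact: h.
exists C => x; rewrite inE => -[q Vq <-]; have [-> ->] := descends_pd ws wE Vq.
by rewrite -(descendsE uE Vq) -(descendsE wE Vq) hC.
Qed.

(** Connected fibres supply the plane functions; conversely a pull-back from the plane has zero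
    z-derivative. *)
Lemma harmonic_pd_plane : harmonic_pd <-> exists psi phi,
  [/\ descends V u psi, descends V w phi & harmonic_plane U phi].
Proof.
split=> [[h1 h2 h3]|[psi [phi [uE wE /(harmonic_planeP wE)[h2 h3]]]]].
  have [psi uE] := descends_exists oV cF us (fun q Vq => (h1 q Vq).1).
  have [phi wE] := descends_exists oV cF ws (fun q Vq => (h1 q Vq).2).
  by exists psi, phi; split=> //; apply/(harmonic_planeP wE).
split=> // q Vq.
by rewrite (factor_z oV (descendsE uE)) // (factor_z oV (descendsE wE)).
Qed.

Lemma explicit_pd_plane : harmonic_pd /\ explicit_log V u w <-> exists psi phi,
  [/\ descends V u psi, descends V w phi, harmonic_plane U phi
    & explicit_u_plane U psi phi].
Proof.
split=> [[/harmonic_pd_plane[psi [phi [uE wE h]]] e]|[psi [phi [uE wE h e]]]].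
  by exists psi, phi; split=> //; apply/(explicit_planeP uE wE).
split; first by apply/harmonic_pd_plane; exists psi, phi.
exact/(explicit_planeP uE wE).
Qed.

End Plane.

End Classification.

Theorem proposition1 (R : realType) (V : set 'rV[R]_3)
    (u w : 'rV[R]_3 -> R)
    (omega : 'rV[R]_4 -> 'rV[R]_4) (J : 'rV[R]_4 -> 'M[R]_4)
    (V_open : open V) (V_sc : simply_connected R V)
    (u_smooth : smooth V u) (w_smooth : smooth V w)
    (w_gt0 : {in V, forall q, 0 < w q})
    (w_eq : {in V, forall q,
       partial ix (partial ix w) q + partial iy (partial iy w) q
       + partial iz (partial iz (euw u w)) q = 0})
    (omega_smooth : smooth_vec (R_times V) omega)
    (omega_fibre : {in R_times V, forall p, omega p 0 ord0 != 0})
    (d_omega : {in R_times V, forall p,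
       ext_d omega p = curvature_form u w (base p)})
    (J_acs : almost_complex (R_times V) J)
    (J_orth : orthogonal_for (R_times V) (metric u w omega) J)
    (J_form : {in R_times V, forall p,
       fundamental_form (metric u w omega) J p = Omega_J u w omega p}) :
  let M := R_times V in
  let g := metric u w omega in
  let U := shadow V in
  (almost_kahler M g J <-> {in V, forall q, partial iz (euw u w) q = 0}) /\
  ({in V, forall q, partial iz (euw u w) q = 0} ->
   {in V, forall q, partial ix w q = 0 /\ partial iy w q = 0} ->
   kahler M g J) /\
  ((~ kahler M g J /\ AK3 M g J) <-> harmonic_xy V u w) /\
  ((~ kahler M g J /\ AK2 M g J) <->
   harmonic_xy V u w /\ explicit_u V u w) /\
  (connected_fibres V ->
   ((~ kahler M g J /\ AK3 M g J) <->
    exists u0 w0 : 'rV[R]_2 -> R,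
      [/\ descends V u u0, descends V w w0 & harmonic_plane U w0]) /\
   ((~ kahler M g J /\ AK2 M g J) <->
    exists u0 w0 : 'rV[R]_2 -> R,
      [/\ descends V u u0, descends V w w0, harmonic_plane U w0
        & explicit_u_plane U u0 w0])).
Proof.
move=> M g U.
have cV := path_connected_connected V_sc.1.
have {}w_gt0 : forall q, V q -> 0 < w q by move=> q Vq; apply: w_gt0; rewrite inE.
have {}w_eq : forall q, V q -> pd ix (pd ix w) q + pd iy (pd iy w) q
    + pd iz (pd iz (euw u w)) q = 0.
  by rewrite pdE => q Vq; apply: w_eq; rewrite inE.
have {}omega_fibre : forall p, R_times V p -> omega p 0 ord0 != 0.
  by move=> p Mp; apply: omega_fibre; rewrite inE.
have {}d_omega : forall p, R_times V p -> ext_d omega p = curvature_form u w (base p).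
  by move=> p Mp; apply: d_omega; rewrite inE.
have {}J_form : forall p, R_times V p ->
    fundamental_form (metric u w omega) J p = Omega_J u w omega p.
  by move=> p Mp; apply: J_form; rewrite inE.
have azP : {in V, forall q, partial iz (euw u w) q = 0} <->
    forall q, V q -> pd iz (euw u w) q = 0.
  by rewrite pdE; exact: in_setP_iff.
have akE := akP V_open u_smooth w_smooth w_gt0 omega_smooth omega_fibre d_omega
  J_acs J_orth J_form.
have k3 := AK3_harmonic V_open cV u_smooth w_smooth w_gt0 w_eq omega_smooth
  omega_fibre d_omega J_acs J_orth J_form.
have k2 := AK2_explicit V_open cV u_smooth w_smooth w_gt0 w_eq omega_smooth
  omega_fibre d_omega J_acs J_orth J_form.
split; first by rewrite azP.
split.
  move=> /azP az g0; apply/(kahlerP V_open u_smooth w_smooth) => //.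
  by rewrite pdE => q Vq; apply: g0; rewrite inE.
split; first by rewrite k3 harmonic_xyP.
split; first by rewrite k2 harmonic_xyP explicit_uP.
move=> cF; split.
  rewrite k3; exact: harmonic_pd_plane.
rewrite k2; exact: explicit_pd_plane.
Qed.
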